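(* Let $\mathbf{P}$ be a set of $n$ points in the grid $[0,n)\times[0,n)$ having exactly one point in each row and each column, each point $p$ having an associated integer value $w(p)\in[0,W)$, and let $m=\min(n,W)$. For any $\ell\in[2,m]$ there is a data structure using $n\log n\log_\ell m+O(n\log m)$ bits that, for any query rectangle $Q=[x_0,x_1]\times[y_0,y_1]$ and any value $w$, computes the successor $\mathrm{Succ}(w,Q)$ and the predecessor $\mathrm{Pred}(w,Q)$ in time $O(\ell\log n\log_\ell m)$.
   Context: Model: word RAM with words of $\Theta(\log n)$ bits; $\log$ is base 2; space is measured in bits. $\mathrm{Succ}(w,Q)$ is the smallest value in $\{w(p):p\in\mathbf{P}\cap Q\}$ that is $\ge w$, and $\mathrm{Pred}(w,Q)$ is the largest value in that set that is $\le w$. Original point coordinates are assumed already mapped to this rank-space grid; the storage of the mapping and of the raw values is not counted in the space bound. *)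

(* Defs.v *)
From Stdlib Require Import Reals.
From mathcomp Require Import all_boot perm.
Set Implicit Arguments. Unset Strict Implicit. Unset Printing Implicit Defensive.

Definition log2R (x : R) : R := Rdiv (ln x) (ln (IZR 2)).
Definition logbR (base x : R) : R := Rdiv (ln x) (ln base).

(* Point set: for each column x : 'I_n exactly one point (x, pi x); pi is a
   permutation, so there is also exactly one point per row.  wv x is the
   value of the point in column x. *)

Definition in_rect n (pi : {perm 'I_n}) (x0 x1 y0 y1 : nat) (x : 'I_n) : bool :=
  (x0 <= x <= x1) && (y0 <= pi x <= y1).

Definition vals_in n (pi : {perm 'I_n}) (wv : 'I_n -> nat) x0 x1 y0 y1 : seq nat :=
  [seq wv x | x <- enum 'I_n & in_rect pi x0 x1 y0 y1 x].

Definition Succ n (pi : {perm 'I_n}) (wv : 'I_n -> nat) (w x0 x1 y0 y1 : nat)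
  : option nat :=
  match [seq v <- vals_in pi wv x0 x1 y0 y1 | w <= v] with
  | [::] => None
  | v :: s => Some (foldr minn v s)
  end.

Definition Pred n (pi : {perm 'I_n}) (wv : 'I_n -> nat) (w x0 x1 y0 y1 : nat)
  : option nat :=
  match [seq v <- vals_in pi wv x0 x1 y0 y1 | v <= w] with
  | [::] => None
  | v :: s => Some (foldr maxn v s)
  end.

Inductive instr : Type :=
| IConst (d k : nat)
| IAdd (d s t : nat)
| ISub (d s t : nat)
| IMul (d s t : nat)
| IDiv (d s t : nat)          (* r_d := r_s / r_t  (0 if r_t = 0)         *)
| IMod (d s t : nat)          (* r_d := r_s mod r_t (r_s if r_t = 0)      *)
| IAnd (d s t : nat) | IOr (d s t : nat) | IXor (d s t : nat)
| IShl (d s t : nat)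
| IShr (d s t : nat)
| ILt (d s t : nat)
| IEq (d s t : nat)
| ILoad (d s : nat)
| IStore (d s : nat)
| IJz (s target : nat)
| IJmp (target : nat)
| IHalt.

Definition program := seq instr.

Record config := Config { pc : nat; regs : nat -> nat; mem : nat -> nat }.

Definition upd (f : nat -> nat) (i v : nat) : nat -> nat :=
  fun j => if j == i then v else f j.

(* One step; None means the machine has halted (IHalt or pc out of range). *)
Definition step (b : nat) (p : program) (c : config) : option config :=
  let M := 2 ^ b in
  let r := regs c in
  let nx := (pc c).+1 in
  let setr d v := Some (Config nx (upd r d (v %% M)) (mem c)) in
  match nth IHalt p (pc c) with
  | IConst d k => setr d k
  | IAdd d s t => setr d (r s + r t)
  | ISub d s t => setr d (r s + (M - r t %% M))
  | IMul d s t => setr d (r s * r t)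
  | IDiv d s t => setr d (r s %/ r t)
  | IMod d s t => setr d (r s %% r t)
  | IAnd d s t => setr d (Nat.land (r s) (r t))
  | IOr d s t => setr d (Nat.lor (r s) (r t))
  | IXor d s t => setr d (Nat.lxor (r s) (r t))
  | IShl d s t => setr d (r s * 2 ^ r t)
  | IShr d s t => setr d (r s %/ 2 ^ r t)
  | ILt d s t => setr d (r s < r t)
  | IEq d s t => setr d (r s == r t)
  | ILoad d s => setr d (mem c (r s))
  | IStore d s => Some (Config nx r (upd (mem c) (r d) (r s %% M)))
  | IJz s tg => Some (Config (if r s == 0 then tg else nx) r (mem c))
  | IJmp tg => Some (Config tg r (mem c))
  | IHalt => None
  end.

Fixpoint run (b : nat) (p : program) (fuel : nat) (c : config) : option config :=
  match step b p c with
  | None => Some c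
  | Some c' => if fuel is k.+1 then run b p k c' else None
  end.

Definition runs_within b p T c0 c : Prop := run b p T c0 = Some c.

Definition word_at (b : nat) (bits : seq bool) (j : nat) : nat :=
  \sum_(i < b) nth false bits (j * b + i) * 2 ^ i.

Definition nwords (b : nat) (bits : seq bool) : nat := (size bits + b.-1) %/ b.

(* The raw (uncounted) value table: the sorted list of distinct values. *)
Definition value_table n (wv : 'I_n -> nat) : seq nat :=
  sort leq (undup [seq wv x | x <- enum 'I_n]).

(* Initial memory: raw value table at addresses [0, k), the data structure
   (counted space) at addresses [n, n + nwords), zero elsewhere. *)
Definition init_mem n (wv : 'I_n -> nat) (b : nat) (bits : seq bool) : nat -> nat :=
  fun a => if a < size (value_table wv) then nth 0 (value_table wv) a
           else if (n <= a) && (a < n + nwords b bits) then word_at b bits (a - n)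
           else 0.

(* Initial registers: r0=n, r1=W, r2=ell, r3=x0, r4=x1, r5=y0, r6=y1, r7=w,
   r8=b, r9=#distinct values, r10=base address of the data structure. *)
Definition init_regs n (wv : 'I_n -> nat) (W ell x0 x1 y0 y1 w b : nat) : nat -> nat :=
  fun i => nth 0 [:: n; W; ell; x0; x1; y0; y1; w; b; size (value_table wv); n] i.

(* Output convention: r0 = [Succ exists], r1 = Succ, r2 = [Pred exists], r3 = Pred *)
Definition correct_output (o : option nat) (flag v : nat) : Prop :=
  match o with
  | None => flag = 0
  | Some s => flag = 1 /\ v = s
  end.

(* Main.v *)
Require Import Defs.
From Stdlib Require Import Reals Lra FunctionalExtensionality PeanoNat.
From mathcomp Require Import all_boot perm.
From mathcomp Require Import zify.
Set Implicit Arguments. Unset Strict Implicit. Unset Printing Implicit Defensive.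

(* Replace each value by its rank among the distinct values and split the rank
   into a class, its top g = log2 ell + O(1) bits, and a remainder of r bits.
   One wavelet matrix sorts the points by class and then by row number; the row
   bits are grouped into K = O(log n / g) super-levels of g bits, and at each
   super-level a further wavelet matrix on the remainders is stored.  All these
   bitmaps together have n (g + K (g + r)) bits, which is
   n log n log_ell m + O(n log m).  They are stored in cells indexed by popcount
   classes with o(1) overhead per bit and rank in constant time.

   Within one class, the rows strictly between the two query bounds are covered,
   per super-level, by fewer than 2^g siblings of each of the two search paths,
   and the remainder matrix of the super-level answers a successor or
   predecessor query on each sibling in O(g + r) time.  If the class of the
   query value has no answer, the answer is the extreme one in the nearest class
   that meets the rectangle, and such a class is found by counting.  Grids with
   n below a constant are scanned. *)

(** * Structured programs and their compilation *)

(** The leading space term has constant exactly 1, so only [O(n log m)] bits of redundancy are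
    allowed. Two choices pay for this. Splitting off the class lets a super-level spend [g + r] bits
    per point, about [log m], on row digits and remainders together; storing whole ranks beside the
    row digits would add [n log n] bits. And for bounded [ell] the bitmaps leave room for only
    [O(1 / log n)] extra bits per bit, whereas a directory with one count per block of [log n] bits
    costs [log log n / log n]. Hence the popcounts of the blocks of a cell are coded jointly with
    their contents: the class sizes, rounded to powers of two, sum to at most [2^(u+2)], so by
    Kraft's inequality about 2 extra bits per block suffice. Explicit counts are kept only for cells
    of about [sqrt(log n)] blocks and for groups of as many cells. One fixed program must serve all
    [n] and cannot compute logarithms cheaply, so on large grids every width is read from the
    structure itself. *)

Inductive binop := OAdd | OSub | OMul | ODiv | OMod | OAnd | OShl | OShr | OLt | OEq.

Inductive expr :=
| Cst of nat
| Var of nat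
| Bin of binop & expr & expr
| Ld of expr.

(** No command writes to memory, so the memory is a fixed function [me] in the semantics. [Rep]
    evaluates its count once, before the first round, so every program terminates and its cost is a
    plain recursive function. *)
Inductive cmd :=
| Skip
| Asn of nat & expr
| Seq of cmd & cmd
| If of expr & cmd & cmd
| Rep of expr & cmd.

Definition state := nat -> nat.

Definition opval (M : nat) (o : binop) (x y : nat) : nat :=
  match o with
  | OAdd => x + y
  | OSub => x + (M - y %% M)
  | OMul => x * y
  | ODiv => x %/ y
  | OMod => x %% y
  | OAnd => Nat.land x y
  | OShl => x * 2 ^ y
  | OShr => x %/ 2 ^ y
  | OLt => x < y
  | OEq => x == y
  end %% M.

Definition opinstr (o : binop) : nat -> nat -> nat -> instr :=
  match o with
  | OAdd => IAdd | OSub => ISub | OMul => IMul | ODiv => IDiv | OMod => IMod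
  | OAnd => IAnd | OShl => IShl | OShr => IShr | OLt => ILt | OEq => IEq
  end.

(** [IOr d x x] serves as a register move. Scratch registers form a stack: the second operand is
    computed in [d.+1] so that the first survives in [d]. *)
Fixpoint ecode (e : expr) (d : nat) : seq instr :=
  match e with
  | Cst k => [:: IConst d k]
  | Var x => [:: IOr d x x]
  | Bin o e1 e2 => ecode e1 d ++ ecode e2 d.+1 ++ [:: opinstr o d d d.+1]
  | Ld e1 => ecode e1 d ++ [:: ILoad d d]
  end.

Fixpoint ecost (e : expr) : nat :=
  match e with
  | Cst _ | Var _ => 1
  | Bin _ e1 e2 => ecost e1 + ecost e2 + 1
  | Ld e1 => ecost e1 + 1
  end.

Fixpoint csize (c : cmd) : nat :=
  match c with
  | Skip => 0
  | Asn _ e => ecost e + 1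
  | Seq c1 c2 => csize c1 + csize c2
  | If e c1 c2 => ecost e + (csize c1 + (csize c2 + 2))
  | Rep e c1 => ecost e + (csize c1 + 4)
  end.

(* [a] is the address of the first instruction, [d] the first scratch register. *)
Fixpoint ccode (c : cmd) (a d : nat) : seq instr :=
  match c with
  | Skip => [::]
  | Asn x e => ecode e d ++ [:: IOr x d d]
  | Seq c1 c2 => ccode c1 a d ++ ccode c2 (a + csize c1) d
  | If e c1 c2 =>
      let a1 := a + ecost e + 1 in
      let a2 := a1 + csize c1 + 1 in
      ecode e d ++ IJz d a2 :: ccode c1 a1 d ++
      IJmp (a2 + csize c2) :: ccode c2 a2 d
  | Rep e c1 =>
      let a1 := a + ecost e in
      ecode e d ++ IJz d (a1 + csize c1 + 4) :: ccode c1 (a1 + 1) d.+1 ++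
      [:: IConst d.+1 1; ISub d d d.+1; IJmp a1]
  end.

Fixpoint ewf (nv : nat) (e : expr) : bool :=
  match e with
  | Cst _ => true
  | Var x => x < nv
  | Bin _ e1 e2 => ewf nv e1 && ewf nv e2
  | Ld e1 => ewf nv e1
  end.

Fixpoint cwf (nv : nat) (c : cmd) : bool :=
  match c with
  | Skip => true
  | Asn x e => (x < nv) && ewf nv e
  | Seq c1 c2 => cwf nv c1 && cwf nv c2
  | If e c1 c2 => [&& ewf nv e, cwf nv c1 & cwf nv c2]
  | Rep e c1 => ewf nv e && cwf nv c1
  end.

Fixpoint mods (c : cmd) : seq nat :=
  match c with
  | Skip => [::]
  | Asn x _ => [:: x]
  | Seq c1 c2 => mods c1 ++ mods c2
  | If _ c1 c2 => mods c1 ++ mods c2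
  | Rep _ c1 => mods c1
  end.

Section Semantics.
Variables (b : nat) (me : nat -> nat).
Local Notation M := (2 ^ b).

Fixpoint eval (e : expr) (s : state) : nat :=
  match e with
  | Cst k => k %% M
  | Var x => s x
  | Bin o e1 e2 => opval M o (eval e1 s) (eval e2 s)
  | Ld e1 => me (eval e1 s) %% M
  end.

Fixpoint sem (c : cmd) (s : state) : state :=
  match c with
  | Skip => s
  | Asn x e => upd s x (eval e s)
  | Seq c1 c2 => sem c2 (sem c1 s)
  | If e c1 c2 => if eval e s == 0 then sem c2 s else sem c1 s
  | Rep e c1 => iter (eval e s) (sem c1) s
  end.

Fixpoint cost (c : cmd) (s : state) : nat :=
  match c with
  | Skip => 0
  | Asn _ e => ecost e + 1
  | Seq c1 c2 => cost c1 s + cost c2 (sem c1 s)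
  | If e c1 c2 => ecost e + 1 + (if eval e s == 0 then cost c2 s else cost c1 s + 1)
  | Rep e c1 => ecost e + 1 + \sum_(i < eval e s) (cost c1 (iter i (sem c1) s) + 4)
  end.

Lemma sem_frame c s x : x \notin mods c -> sem c s x = s x.
Proof.
elim: c s => //= [y e|c1 IH1 c2 IH2|e c1 IH1 c2 IH2|e c1 IH1] s.
- by rewrite inE /upd => /negPf->.
- by rewrite mem_cat negb_or => /andP[h1 h2]; rewrite IH2 // IH1.
- by rewrite mem_cat negb_or => /andP[h1 h2]; case: ifP => _; [apply: IH2|apply: IH1].
- by move=> h; elim: (eval e s) => //= k IHk; rewrite IH1.
Qed.

Definition inM (s : state) := forall x, s x < M.

Lemma eval_lt e s : inM s -> eval e s < M.
Proof. by case: e => //= *; rewrite ?ltn_mod ?expn_gt0. Qed.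

Lemma sem_inM c s : inM s -> inM (sem c s).
Proof.
elim: c s => //= [y e|c1 IH1 c2 IH2|e c1 IH1 c2 IH2|e c1 IH1] s h.
- by move=> x; rewrite /upd; case: ifP => _ //; apply: eval_lt.
- by apply/IH2/IH1.
- by case: ifP => _; [apply: IH2|apply: IH1].
- by elim: (eval e s) => //= k IHk; apply: IH1.
Qed.

End Semantics.

Section Compile.
Variables (b : nat) (me : nat -> nat) (p : program) (nv : nat).
Local Notation M := (2 ^ b).
Local Notation eval := (eval b me).
Local Notation sem := (sem b me).
Local Notation cost := (cost b me).

(** Stripping [k] units of fuel for every remaining amount [f] makes reachability compose by adding
    step counts, with no claim about halting. *)
Definition reach k c c' := forall f, run b p (k + f) c = run b p f c'.

Lemma reach_trans k l c c' c'' :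
  reach k c c' -> reach l c' c'' -> reach (k + l) c c''.
Proof. by move=> h1 h2 f; rewrite -addnA h1 h2. Qed.

Lemma reach1 c c' : step b p c = Some c' -> reach 1 c c'.
Proof. by move=> h f; rewrite add1n /= h. Qed.

Definition code_at a (code : seq instr) :=
  forall i, i < size code -> nth IHalt p (a + i) = nth IHalt code i.

Lemma code_at_cat a c1 c2 :
  code_at a (c1 ++ c2) -> code_at a c1 /\ code_at (a + size c1) c2.
Proof.
move=> h; split=> i hi.
  by rewrite h ?nth_cat ?hi // size_cat ltn_addr.
by rewrite -addnA h ?nth_cat ?size_cat ?ltn_add2l // ltnNge leq_addr /= addKn.
Qed.

Lemma code_at_cons a i c : code_at a (i :: c) ->
  nth IHalt p a = i /\ code_at a.+1 c.
Proof.
move=> h; split; first by have := h 0 isT; rewrite addn0.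
by move=> j hj; have := h j.+1 hj; rewrite addnS addSn.
Qed.

Lemma size_ecode e d : size (ecode e d) = ecost e.
Proof. by elim: e d => //= [o e1 IH1 e2 IH2|e1 IH1] d; rewrite !size_cat ?IH1 ?IH2 //= ; lia. Qed.

Lemma size_ccode c a d : size (ccode c a d) = csize c.
Proof.
elim: c a d => //= [y e|c1 IH1 c2 IH2|e c1 IH1 c2 IH2|e c1 IH1] a d;
  rewrite ?(size_cat, size_ecode) /= ?size_cat /= ?IH1 ?IH2 //=; lia.
Qed.

Lemma ecodeP e a d s rg : nv <= d -> ewf nv e -> code_at a (ecode e d) ->
  (forall i, i < nv -> rg i = s i) -> inM b s ->
  exists rg', [/\ reach (ecost e) (Config a rg me) (Config (a + ecost e) rg' me),
    rg' d = eval e s & forall i, i < d -> rg' i = rg i].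
Proof.
elim: e a d rg => /= [k|x|o e1 IH1 e2 IH2|e1 IH1] a d rg hd wf hc hr hs.
- have [h _] := code_at_cons hc.
  exists (upd rg d (k %% M)); split; last by move=> i hi; rewrite /upd ltn_eqF.
    by apply: reach1; rewrite /step /= h addn1.
  by rewrite /upd eqxx.
- have [h _] := code_at_cons hc.
  exists (upd rg d (s x)); split; last by move=> i hi; rewrite /upd ltn_eqF.
    by apply: reach1; rewrite /step /= h addn1 PeanoNat.Nat.lor_diag hr // modn_small.
  by rewrite /upd eqxx.
- have [wf1 wf2] := andP wf.
  have [hc1] := code_at_cat hc; rewrite size_ecode => /code_at_cat[hc2].
  rewrite size_ecode => /code_at_cons[ho _].
  have [rg1 [r1 v1 f1]] := IH1 a d rg hd wf1 hc1 hr hs.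
  have hr1 i : i < nv -> rg1 i = s i.
    by move=> hi; rewrite f1 ?hr //; apply: leq_trans hi hd.
  have [rg2 [r2 v2 f2]] := IH2 _ d.+1 rg1 (leqW hd) wf2 hc2 hr1 hs.
  exists (upd rg2 d (opval M o (eval e1 s) (eval e2 s))); split.
  + apply: reach_trans (reach_trans r1 r2) _; apply: reach1.
    by rewrite /step /= ho; case: (o) => /=; rewrite f2 // v1 v2 !addnA addn1.
  + by rewrite /upd eqxx.
  + by move=> i hi; rewrite /upd ltn_eqF // f2 ?f1 // ltnW.
- have [hc1] := code_at_cat hc; rewrite size_ecode => /code_at_cons[ho _].
  have [rg1 [r1 v1 f1]] := IH1 a d rg hd wf hc1 hr hs.
  exists (upd rg1 d (me (eval e1 s) %% M)); split.
  + by apply: reach_trans r1 _; apply: reach1; rewrite /step /= ho v1 addnA addn1.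
  + by rewrite /upd eqxx.
  + by move=> i hi; rewrite /upd ltn_eqF // f1.
Qed.

(** The step count is exactly [cost]. The last clause, that registers between the variables and [d]
    survive, keeps the counter of an enclosing loop intact while its body runs: the counter is in
    [d] and the body is compiled for [d.+1]. *)
Lemma ccodeP c a d s rg : nv <= d -> cwf nv c -> 1 < M -> code_at a (ccode c a d) ->
  (forall i, i < nv -> rg i = s i) -> inM b s ->
  exists rg', [/\ reach (cost c s) (Config a rg me) (Config (a + csize c) rg' me),
    forall i, i < nv -> rg' i = sem c s i &
    forall i, nv <= i < d -> rg' i = rg i].
Proof.
move=> hd wf hM; elim: c a d s rg hd wf => /= [|y e|c1 IH1 c2 IH2|e c1 IH1 c2 IH2|e c1 IH1]
  a d s rg hd wf hc hr hs.
- by exists rg; rewrite addn0.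
- have [hy wfe] := andP wf.
  have [hc1] := code_at_cat hc; rewrite size_ecode => /code_at_cons[ho _].
  have [rg1 [r1 v1 f1]] := ecodeP hd wfe hc1 hr hs.
  exists (upd rg1 y (eval e s)); split.
  + apply: reach_trans r1 _; apply: reach1.
    by rewrite /step /= ho PeanoNat.Nat.lor_diag v1 addnA addn1 modn_small // eval_lt.
  + move=> i hi; rewrite /upd; case: ifP => // _; rewrite f1 ?hr //.
    exact: leq_trans hi hd.
  + by move=> i /andP[h1 h2]; rewrite /upd gtn_eqF ?f1 // (leq_trans hy).
- have [wf1 wf2] := andP wf.
  have [hc1] := code_at_cat hc; rewrite size_ccode => hc2.
  have [rg1 [r1 v1 f1]] := IH1 _ _ _ _ hd wf1 hc1 hr hs.
  have [rg2 [r2 v2 f2]] := IH2 _ _ _ _ hd wf2 hc2 v1 (sem_inM me c1 hs).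
  exists rg2; split => //; first by rewrite addnA; apply: reach_trans r1 r2.
  by move=> i hi; rewrite f2 ?f1.
- case/and3P: wf => wfe wf1 wf2.
  have [hce] := code_at_cat hc; rewrite size_ecode => /code_at_cons[hj].
  rewrite -[_.+1]addn1 => /code_at_cat[hc1]; rewrite size_ccode => /code_at_cons[hjm].
  rewrite -[_.+1]addn1 => hc2.
  have [rg0 [r0 v0 f0]] := ecodeP hd wfe hce hr hs.
  have hr0 i : i < nv -> rg0 i = s i.
    by move=> hi; rewrite f0 ?hr // (leq_trans hi).
  case: eqP => he.
  + have [rg2 [r2 v2 f2]] := IH2 _ _ _ _ hd wf2 hc2 hr0 hs.
    exists rg2; split => //.
      apply: reach_trans (reach_trans r0 _) _; last first.
        have -> : a + (ecost e + (csize c1 + (csize c2 + 2))) =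
          a + ecost e + 1 + csize c1 + 1 + csize c2 by lia.
        exact: r2.
      by apply: reach1; rewrite /step /= hj v0 he eqxx.
    by move=> i hi; rewrite f2 // f0 //; case/andP: hi.
  + have [rg1 [r1 v1 f1]] := IH1 _ _ _ _ hd wf1 hc1 hr0 hs.
    exists rg1; split => //.
      apply: reach_trans (reach_trans r0 _) _.
        by apply: reach1; rewrite /step /= hj v0; move/eqP/negPf: he => ->.
      rewrite -[(a + ecost e).+1]addn1; apply: reach_trans r1 _; apply: reach1.
      by rewrite /step /= hjm; congr (Some (Config _ _ _)); lia.
    by move=> i hi; rewrite f1 // f0 //; case/andP: hi.
- have [wfe wf1] := andP wf.
  have [hce] := code_at_cat hc; rewrite size_ecode => /code_at_cons[hj].
  rewrite -[_.+1]addn1 => /code_at_cat[hc1]; rewrite size_ccode.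
  move=> /code_at_cons[hk] /code_at_cons[hsb] /code_at_cons[hjm _].
  have [rg0 [r0 v0 f0]] := ecodeP hd wfe hce hr hs.
  have hr0 i : i < nv -> rg0 i = s i.
    by move=> hi; rewrite f0 ?hr // (leq_trans hi).
  have ke := eval_lt me e hs.
  set k := eval e s in v0 ke *.
  (* After [j] rounds the counter register [d] holds [k - j]; the zero test precedes each decrement,
     so it never wraps. *)
  have loop : forall j, j <= k -> exists rg',
    [/\ reach (\sum_(i < j) (cost c1 (iter i (sem c1) s) + 4))
          (Config (a + ecost e) rg0 me) (Config (a + ecost e) rg' me),
        forall i, i < nv -> rg' i = iter j (sem c1) s i,
        rg' d = k - j & forall i, nv <= i < d -> rg' i = rg0 i].
    elim=> [|j IHj] hjk.
      by exists rg0; rewrite big_ord0 v0 subn0.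
    have [rg1 [r1 v1 d1 f1]] := IHj (ltnW hjk).
    have hsj : inM b (iter j (sem c1) s).
      by elim: (j) => //= l hl; apply: sem_inM.
    have [rg2 [r2 v2 f2]] := IH1 _ d.+1 _ _ (leqW hd) wf1 hc1 v1 hsj.
    pose rg3 := upd rg2 d.+1 (1 %% M).
    exists (upd rg3 d ((rg3 d + (M - rg3 d.+1 %% M)) %% M)); split.
    + rewrite big_ord_recr /=; apply: reach_trans r1 _.
      have -> : cost c1 (iter j (sem c1) s) + 4 = 1 + (cost c1 (iter j (sem c1) s) + (1 + (1 + 1))) by lia.
      apply: reach_trans.
        apply: reach1; rewrite /step /= hj d1.
        by rewrite (_ : (k - j == 0) = false) //; lia.
      rewrite -[(a + ecost e).+1]addn1; apply: reach_trans r2 _.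
      apply: reach_trans; first by apply: reach1; rewrite /step /= hk.
      apply: reach_trans; first by apply: reach1; rewrite /step /= hsb.
      by apply: reach1; rewrite /step /= hjm.
    + move=> i hi; rewrite /upd ltn_eqF ?(leq_trans hi) // /rg3 /upd ltn_eqF ?v2 //.
      by apply: (leq_trans hi); apply: leqW.
    + rewrite /upd eqxx /rg3 /upd eqxx (ltn_eqF (ltnSn d)) f2 ?hd ?ltnSn // d1.
      rewrite modn_mod (modn_small hM).
      have -> : k - j + (M - 1) = M + (k - j.+1) by lia.
      by rewrite modnDl modn_small //; lia.
    + move=> i /andP[h1 h2]; rewrite /upd ltn_eqF // /rg3 /upd ltn_eqF; last exact: leqW.
      by rewrite f2 ?h1 ?f1 ?h1 // leqW.
  have [rg1 [r1 v1 d1 f1]] := loop k (leqnn k).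
  exists rg1; split => //.
    have -> : ecost e + 1 + \sum_(i < k) (cost c1 (iter i (sem c1) s) + 4) =
      ecost e + (\sum_(i < k) (cost c1 (iter i (sem c1) s) + 4) + 1) by lia.
    apply: reach_trans r0 (reach_trans r1 _); apply: reach1.
    by rewrite /step /= hj d1 subnn eqxx; congr (Some (Config _ _ _)); lia.
  by move=> i hi; rewrite f1 // f0 //; case/andP: hi.
Qed.

End Compile.

Lemma ccode_runs b me nv c s rg : cwf nv c -> 1 < 2 ^ b ->
  (forall i, rg i = s i) -> inM b s ->
  exists rg', runs_within b (ccode c 0 nv) (cost b me c s) (Config 0 rg me)
     (Config (csize c) rg' me) /\ forall i, i < nv -> rg' i = sem b me c s i.
Proof.
move=> wf hM hr hs.
have hc : code_at (ccode c 0 nv) 0 (ccode c 0 nv) by move=> i _.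
have [rg' [r v _]] := ccodeP me (leqnn nv) wf hM hc (fun i _ => hr i) hs.
(* The run ends by falling off the end of the code, where the default instruction is [IHalt]; the
   fuel is then exactly used up. *)
exists rg'; split=> //; rewrite /runs_within -[cost _ _ _ _]addn0 r add0n /=.
by rewrite /step nth_default // size_ccode.
Qed.

(** * Reading packed bits *)

Definition bval (s : seq bool) (p w : nat) : nat :=
  \sum_(i < w) nth false s (p + i) * 2 ^ i.

Lemma word_atE b s j : word_at b s j = bval s (j * b) b.
Proof. by []. Qed.

Lemma bval_lt s p w : bval s p w < 2 ^ w.
Proof.
rewrite /bval; elim: w => [|w IH]; first by rewrite big_ord0.
rewrite big_ord_recr /= expnS; move: (\sum_(i < w) _) (2 ^ w) IH => x y IH.
by case: (nth _ _ _); lia.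
Qed.

Lemma bval_split s p v w : bval s p (v + w) = bval s p v + 2 ^ v * bval s (p + v) w.
Proof.
rewrite /bval big_split_ord /=; congr (_ + _); rewrite big_distrr /=.
by apply: eq_bigr => i _; rewrite addnA expnD mulnCA.
Qed.

Lemma bval_cat A B C p w : p + w <= size B ->
  bval (A ++ B ++ C) (size A + p) w = bval B p w.
Proof.
move=> h; apply: eq_bigr => i _; congr (_ * _); congr (nat_of_bool _).
have hi := ltn_ord i; rewrite -addnA nth_cat ltnNge leq_addr /= addKn nth_cat.
by rewrite (_ : p + i < size B) //; lia.
Qed.

Lemma bval_catl A B p w : p + w <= size A -> bval (A ++ B) p w = bval A p w.
Proof. by move=> h; rewrite -(@bval_cat [::] A B). Qed.

Lemma bval_catr A B p w : p + w <= size B -> bval (A ++ B) (size A + p) w = bval B p w.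
Proof. by move=> h; rewrite -[in LHS](cats0 B) bval_cat. Qed.

Definition enc (w v : nat) : seq bool := [seq odd (v %/ 2 ^ i) | i <- iota 0 w].

Lemma size_enc w v : size (enc w v) = w.
Proof. by rewrite size_map size_iota. Qed.

Lemma bval_enc w v : v < 2 ^ w -> bval (enc w v) 0 w = v.
Proof.
rewrite /bval => h.
have -> : \sum_(i < w) nth false (enc w v) (0 + i) * 2 ^ i =
          \sum_(i < w) odd (v %/ 2 ^ i) * 2 ^ i.
  by apply: eq_bigr => i _; rewrite add0n (nth_map 0) ?size_iota // nth_iota.
elim: w v h => [|w IH] v h; first by rewrite big_ord0; rewrite expn0 in h; lia.
rewrite big_ord_recl /= divn1 muln1.
have -> : \sum_(i < w) odd (v %/ 2 ^ bump 0 i) * 2 ^ bump 0 i =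
  2 * \sum_(i < w) odd (v %/ 2 %/ 2 ^ i) * 2 ^ i.
  rewrite big_distrr /=; apply: eq_bigr => i _.
  by rewrite /bump /= expnS mulnCA -divnMA.
by rewrite IH; [rewrite divn2; lia | rewrite ltn_divLR // mulnC -expnS].
Qed.

Definition fields (w : nat) (vs : seq nat) : seq bool := flatten [seq enc w v | v <- vs].

Lemma size_fields w vs : size (fields w vs) = size vs * w.
Proof.
rewrite /fields; elim: vs => //= v vs IH.
by rewrite size_cat IH size_enc mulSn.
Qed.

Lemma flatten_nth_cat (T : Type) (ss : seq (seq T)) i w :
  i < size ss -> (forall j, j < size ss -> size (nth [::] ss j) = w) ->
  exists A C, flatten ss = A ++ nth [::] ss i ++ C /\ size A = i * w.
Proof.
elim: ss i => //= s ss IH [|i] hi hs.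
  by exists [::], (flatten ss).
have [A [C [e sA]]] := IH i hi (fun j hj => hs j.+1 hj).
exists (s ++ A), C; rewrite e /= -!catA; split=> //.
by rewrite size_cat sA mulSn (hs 0 isT).
Qed.

Lemma bval_fields w vs i : i < size vs -> nth 0 vs i < 2 ^ w ->
  bval (fields w vs) (i * w) w = nth 0 vs i.
Proof.
move=> hi hv; rewrite /fields.
have hw j : j < size [seq enc w v | v <- vs] -> size (nth [::] [seq enc w v | v <- vs] j) = w.
  by rewrite size_map => hj; rewrite (nth_map 0) // size_enc.
have hi' : i < size [seq enc w v | v <- vs] by rewrite size_map.
have [A [C [-> sA]]] := flatten_nth_cat hi' hw.
rewrite (nth_map 0) // -sA -[size A]addn0 bval_cat ?size_enc ?add0n //.
exact: bval_enc.
Qed.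

(** A field of at most [b] bits meets at most two words. The high part of the first is shifted down,
    the second is shifted up above it, and the excess is cut off modulo [2 ^ w]. Register 8 holds
    the word size [b]. *)
Definition rdE (eb : expr) (ep ew : expr) : expr :=
  Bin OMod
    (Bin OAdd
      (Bin OShr (Ld (Bin OAdd eb (Bin ODiv ep (Var 8)))) (Bin OMod ep (Var 8)))
      (Bin OShl (Ld (Bin OAdd (Bin OAdd eb (Bin ODiv ep (Var 8))) (Cst 1)))
               (Bin OSub (Var 8) (Bin OMod ep (Var 8)))))
    (Bin OShl (Cst 1) ew).

(* The second of the two words may lie outside the data (the address may even
   wrap around); its contribution is then masked out. *)
Lemma rd_words b bits p w x : 0 < b -> w <= b ->
  (p %% b + w <= b \/ x = word_at b bits (p %/ b).+1) ->
  ((word_at b bits (p %/ b) %/ 2 ^ (p %% b)) + (x * 2 ^ (b - p %% b)) %% 2 ^ b) %% 2 ^ w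
   = bval bits p w.
Proof.
move=> hb hw hx; set o := p %% b; set q := p %/ b.
have ho : o < b by rewrite ltn_mod.
have hp : p = q * b + o by rewrite -divn_eq.
have e1 : word_at b bits q %/ 2 ^ o = bval bits p (b - o).
  rewrite word_atE -{2}(subnKC (ltnW ho)) bval_split -hp addnC mulnC divnMDl ?expn_gt0 //.
  by rewrite divn_small ?bval_lt ?addn0 .
rewrite e1.
(* Whatever [x] is, the wrapped shift is a multiple of [2 ^ (b - o)]. If the field ends inside the
   first word, then [w <= b - o] and the reduction modulo [2 ^ w] removes it. *)
have [y hy] : exists y, (x * 2 ^ (b - o)) %% 2 ^ b = y * 2 ^ (b - o).
  by exists (x %% 2 ^ o); rewrite -{2}(subnKC (ltnW ho)) expnD muln_modl.
have split_mod R : (bval bits p w + 2 ^ w * R) %% 2 ^ w = bval bits p w.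
  by rewrite addnC mulnC modnMDl modn_small // bval_lt.
have [le|lt] := leqP (o + w) b.
  rewrite hy; have -> : b - o = w + (b - o - w) by lia.
  rewrite bval_split expnD mulnCA -addnA -mulnDr; exact: split_mod.
have {}hx : x = bval bits (q.+1 * b) b by case: hx => // h; lia.
have -> : (x * 2 ^ (b - o)) %% 2 ^ b = 2 ^ (b - o) * bval bits (p + (b - o)) o.
  have -> : p + (b - o) = q.+1 * b by lia.
  have eb : 2 ^ b = 2 ^ o * 2 ^ (b - o) by rewrite -expnD (subnKC (ltnW ho)).
  rewrite hx -{2}(subnKC (ltnW ho)) bval_split mulnDl mulnAC -eb addnC.
  rewrite [2 ^ b * _]mulnC modnMDl mulnC modn_small //.
  by rewrite eb mulnC ltn_pmul2r ?expn_gt0 // bval_lt.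
rewrite -bval_split (subnK (ltnW ho)) -{1}(subnKC hw) bval_split; exact: split_mod.
Qed.

Lemma word_lt b p w (bits : seq bool) : 0 < b -> 0 < w -> p + w <= size bits ->
  p %/ b < nwords b bits.
Proof.
move=> hb hw h; rewrite /nwords leq_divRL // mulSn.
have := leq_trunc_div p b; move: (p %/ b * b) => x; lia.
Qed.

Lemma next_word_lt b p w (bits : seq bool) : 0 < b -> p + w <= size bits ->
  b < p %% b + w -> (p %/ b).+1 < nwords b bits.
Proof.
move=> hb h; rewrite /nwords leq_divRL // !mulSn.
have := divn_eq p b; move: (p %/ b * b) (p %% b) => x y; lia.
Qed.

Section Reading.
Variables (b n : nat) (bits : seq bool) (me : nat -> nat).
Hypotheses (hb : 0 < b) (hbM : b < 2 ^ b).
Hypothesis hme : forall j, j < nwords b bits -> me (n + j) = word_at b bits j.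
Hypothesis hadr : n + nwords b bits <= 2 ^ b.

Lemma eval_rdE s eb ep ew p w :
  s 8 = b -> eval b me eb s = n -> eval b me ep s = p -> eval b me ew s = w -> w <= b ->
  p + w <= size bits ->
  eval b me (rdE eb ep ew) s = bval bits p w.
Proof.
move=> h8 hn hp hw wb hpw; have [w0|w0] := posnP w.
  (* A field of width 0 may start after the last word, where nothing is known of the memory;
     reduction modulo 1 gives 0 anyway. *)
  have e1 : 1 %% 2 ^ b = 1 by apply: modn_small; lia.
  have e2 : opval (2 ^ b) OShl (eval b me (Cst 1) s) (eval b me ew s) = 1.
    by rewrite hw w0 /= /opval e1 muln1.
  rewrite /rdE; move: (Bin OAdd _ _) => e.
  have -> : eval b me (Bin OMod e (Bin OShl (Cst 1) ew)) s =
    opval (2 ^ b) OMod (eval b me e s) (opval (2 ^ b) OShl (eval b me (Cst 1) s) (eval b me ew s)) by [].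
  by rewrite e2 w0 /opval modn1 mod0n /bval big_ord0.
rewrite /= /opval h8 hn hp hw.
have hMl := expn_gt0 2 b; set M := 2 ^ b in hMl *; have hbM' : b < M := hbM.
have hadr' : n + nwords b bits <= M := hadr.
have hq : p %/ b < nwords b bits by apply: (word_lt hb _ hpw).
have hqM : p %/ b < M by lia.
have ho : p %% b < b by rewrite ltn_mod.
rewrite (@modn_small (p %/ b)) // (@modn_small (p %% b)); last exact: ltn_trans hbM.
rewrite (@modn_small (n + p %/ b)); last by lia.
rewrite hme //.
rewrite (@modn_small (word_at _ _ _)); last exact: bval_lt.
have dlt : word_at b bits (p %/ b) %/ 2 ^ (p %% b) < M.
  by apply: leq_ltn_trans (leq_div _ _) (bval_lt _ _ _).
rewrite [(_ %/ 2 ^ _) %% M]modn_small //.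
have -> : (b + (M - p %% b %% M)) %% M = b - p %% b.
  rewrite (@modn_small (p %% b)); last exact: ltn_trans hbM.
  have -> : b + (M - p %% b) = M + (b - p %% b) by lia.
  by rewrite modnDl modn_small // (leq_ltn_trans (leq_subr _ _)).
set x := me _ %% M.
have E := @rd_words b bits p w x hb wb.
have hx : p %% b + w <= b \/ x = word_at b bits (p %/ b).+1.
  have [le|gt] := leqP (p %% b + w) b; [by left|right].
  have hq' : (p %/ b).+1 < nwords b bits by apply: (next_word_lt hb hpw).
  rewrite /x (@modn_small 1); last exact: leq_ltn_trans hb hbM.
  rewrite addn1 (@modn_small (n + p %/ b).+1); last by rewrite -addnS; apply: leq_trans hadr'; rewrite ltn_add2l.
  by rewrite -addnS hme // modn_small // bval_lt.
have {E} := E hx; rewrite -/M.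
set y := (x * _) %% M; set z := _ %/ 2 ^ _ => E.
(* The two parts occupy disjoint bit positions, below and from [b - p %% b] on, so their sum does
   not overflow. *)
have yz : z + y < M.
  have eM : M = 2 ^ (p %% b) * 2 ^ (b - p %% b) by rewrite -expnD (subnKC (ltnW ho)).
  have hy : y = (x %% 2 ^ (p %% b)) * 2 ^ (b - p %% b) by rewrite /y eM muln_modl.
  have hz : z < 2 ^ (b - p %% b).
    rewrite /z ltn_divLR ?expn_gt0 // -expnD (subnK (ltnW ho)); exact: bval_lt.
  have hxx : x %% 2 ^ (p %% b) < 2 ^ (p %% b) by rewrite ltn_mod expn_gt0.
  rewrite hy eM; move: hz hxx; move: (2 ^ (p %% b)) (2 ^ (b - p %% b)) (x %% _) => A C d hz hd.
  by apply: leq_trans (leq_mul hd (leqnn C)); rewrite mulSn ltn_add2r.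
rewrite (@modn_small (z + y)) // (@modn_small 1); last exact: leq_ltn_trans hb hbM.
rewrite mul1n.
have [wlt|/eqP weq] : w < b \/ w == b by lia.
  rewrite (@modn_small (2 ^ w)) ?E ?modn_small //; last by rewrite /M ltn_exp2l.
  by apply: leq_trans (bval_lt _ _ _) _; rewrite /M leq_exp2l.
(* For [w = b] the modulus [2 ^ b] wraps to 0, and reduction modulo 0 is the identity, as wanted. *)
rewrite weq in E *; rewrite -/M modnn modn0 modn_small //.
by rewrite -E modn_small.
Qed.

End Reading.

(** * Evaluation of the operators in the absence of overflow *)

Section EvalLemmas.
Variables (b : nat) (me : nat -> nat) (s : state).
Local Notation M := (2 ^ b).
Local Notation ev e := (eval b me e s).

Lemma evCst k : k < M -> ev (Cst k) = k.
Proof. exact: modn_small. Qed.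

Lemma evAdd e f x y : ev e = x -> ev f = y -> x + y < M -> ev (Bin OAdd e f) = x + y.
Proof. by move=> /= -> -> ?; rewrite /opval modn_small. Qed.

Lemma evMul e f x y : ev e = x -> ev f = y -> x * y < M -> ev (Bin OMul e f) = x * y.
Proof. by move=> /= -> -> ?; rewrite /opval modn_small. Qed.

Lemma evSub e f x y : ev e = x -> ev f = y -> y <= x -> x < M -> ev (Bin OSub e f) = x - y.
Proof.
move=> /= -> -> yx xM; rewrite /opval (@modn_small y) ?(leq_ltn_trans yx) //.
have -> : x + (M - y) = M + (x - y) by lia.
by rewrite modnDl modn_small //; lia.
Qed.

Lemma evDiv e f x y : ev e = x -> ev f = y -> x < M -> ev (Bin ODiv e f) = x %/ y.
Proof. by move=> /= -> -> ?; rewrite /opval modn_small // (leq_ltn_trans (leq_div _ _)). Qed.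

Lemma evMod e f x y : ev e = x -> ev f = y -> x < M -> ev (Bin OMod e f) = x %% y.
Proof. by move=> /= -> -> ?; rewrite /opval modn_small // (leq_ltn_trans (leq_mod _ _)). Qed.

Lemma evShr e f x y : ev e = x -> ev f = y -> x < M -> ev (Bin OShr e f) = x %/ 2 ^ y.
Proof. by move=> /= -> -> ?; rewrite /opval modn_small // (leq_ltn_trans (leq_div _ _)). Qed.

Lemma evShl e f x y : ev e = x -> ev f = y -> x * 2 ^ y < M -> ev (Bin OShl e f) = x * 2 ^ y.
Proof. by move=> /= -> -> ?; rewrite /opval modn_small. Qed.

Lemma evLt e f x y : ev e = x -> ev f = y -> 1 < M -> ev (Bin OLt e f) = (x < y).
Proof. by move=> /= -> -> ?; rewrite /opval modn_small //; case: (x < y) => //; apply: ltnW. Qed.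

End EvalLemmas.

(** * Encoding blocks of bits by popcount class *)

Lemma bval_flatten (ss : seq (seq bool)) i : i < size ss ->
  bval (flatten ss) (\sum_(j < i) size (nth [::] ss j)) (size (nth [::] ss i)) =
  bval (nth [::] ss i) 0 (size (nth [::] ss i)).
Proof.
elim: ss i => //= s ss IH [|i] hi; first by rewrite big_ord0 bval_catl.
rewrite big_ord_recl /= -IH //; set k := \sum_(j < i) _.
by apply: eq_bigr => j _; rewrite -addnA nth_cat ltnNge leq_addr /= addKn.
Qed.

Lemma bval_div B p v w : bval B p (v + w) %/ 2 ^ v = bval B (p + v) w.
Proof.
by rewrite bval_split addnC mulnC divnMDl ?expn_gt0 // divn_small ?bval_lt ?addn0.
Qed.

Definition ones (B : seq bool) p w : nat := \sum_(i < w) nth false B (p + i).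
Definition rank B p := ones B 0 p.

Lemma onesD B p v w : ones B p (v + w) = ones B p v + ones B (p + v) w.
Proof.
rewrite /ones big_split_ord /=; congr (_ + _).
by apply: eq_bigr => i _; rewrite addnA.
Qed.

Lemma rankD B v w : rank B (v + w) = rank B v + ones B v w.
Proof. by rewrite /rank onesD. Qed.

Lemma ones_le B p w : ones B p w <= w.
Proof.
rewrite /ones -[X in _ <= X]card_ord -sum1_card; apply: leq_sum => i _.
by case: nth.
Qed.

Lemma odd_bval B p w i : i < w -> odd (bval B p w %/ 2 ^ i) = nth false B (p + i).
Proof.
move=> h; rewrite -(subnKC (ltnW h)) bval_div.
have -> : w - i = 1 + (w - i).-1 by lia.
rewrite bval_split expn1 oddD oddM addbF /bval big_ord1 muln1 addn0.
by rewrite oddb.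
Qed.

Definition popcnt (r x : nat) : nat := \sum_(i < r) odd (x %/ 2 ^ i).

Lemma popcnt_bval B p u r : r <= u -> popcnt r (bval B p u) = ones B p r.
Proof.
move=> h; apply: eq_bigr => i _; rewrite odd_bval //.
exact: leq_trans (ltn_ord i) h.
Qed.

Lemma popcnt_le r x : popcnt r x <= r.
Proof.
rewrite /popcnt -[X in _ <= X]card_ord -sum1_card; apply: leq_sum => i _.
by case: odd.
Qed.

Section Alloc.
Variables (T : finType) (sz : T -> nat).

(* Packs disjoint intervals, each aligned to a multiple of its own size. *)
Definition presum (t : T) := \sum_(x | enum_rank x < enum_rank t) 2 * sz x.
Definition start (t : T) := (presum t + sz t).-1 %/ sz t * sz t.

Hypothesis sz0 : forall t, 0 < sz t.

Lemma start_ge t : presum t <= start t.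
Proof. rewrite /start; have := divn_eq (presum t + sz t).-1 (sz t); have := ltn_mod (presum t + sz t).-1 (sz t); have := sz0 t; lia. Qed.

(** Rounding [presum t] up to a multiple of [sz t] skips fewer than [sz t] codes; this is why
    [presum] reserves twice the size. *)
Lemma start_le t : start t + sz t <= presum t + 2 * sz t.
Proof. rewrite /start; have := leq_trunc_div (presum t + sz t).-1 (sz t); have := sz0 t; lia. Qed.

Lemma presum_next t t' : enum_rank t < enum_rank t' ->
  presum t + 2 * sz t <= presum t'.
Proof.
move=> h; rewrite /presum [X in _ <= X](bigD1 t) //= [X in _ <= X]addnC leq_add2r.
rewrite [X in X <= _]big_mkcond [X in _ <= X]big_mkcond; apply: leq_sum => x _.
case: ifP => // hx; rewrite (ltn_trans hx h) /=.
by case: eqP hx => [->|//]; rewrite ltnn.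
Qed.

Lemma presum_total t : presum t + 2 * sz t <= \sum_x 2 * sz x.
Proof.
rewrite /presum [X in _ <= X](bigD1 t) //= [X in _ <= X]addnC leq_add2r.
rewrite [X in X <= _]big_mkcond [X in _ <= X]big_mkcond; apply: leq_sum => x _.
case: ifP => // hx; by case: eqP hx => [->|//]; rewrite ltnn.
Qed.

Lemma start_inj t t' x : start t <= x < start t + sz t -> start t' <= x < start t' + sz t' ->
  t = t'.
Proof.
have := start_le t; have := start_le t'; have := start_ge t; have := start_ge t'.
case: (ltngtP (enum_rank t) (enum_rank t')) => [/presum_next|/presum_next|/val_inj/enum_rank_inj//]; lia.
Qed.

End Alloc.

Section Cells.
Variables (u q H : nat).
(** Two spare bits per block pay for rounding the class sizes to powers of two. Two more per cell
    pay for the alignment and for the minimum interval length [2 ^ (G - H)]. *)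
Definition cellw := (u + 2) * q + 2.
Local Notation G := cellw.
Hypotheses (hH : u.+1 ^ q * 4 <= 2 ^ H) (hHG : H <= G).

Definition class_list (c : nat) : seq nat := [seq x <- iota 0 (2 ^ u) | popcnt u x == c].
Definition offlen (c : nat) : nat := up_log 2 (size (class_list c)).
Definition offset (x : nat) : nat := index x (class_list (popcnt u x)).

Lemma mem_class x : x < 2 ^ u -> x \in class_list (popcnt u x).
Proof. by move=> h; rewrite mem_filter eqxx mem_iota. Qed.

Lemma nth_offset x : x < 2 ^ u -> nth 0 (class_list (popcnt u x)) (offset x) = x.
Proof. by move=> h; rewrite nth_index // mem_class. Qed.

Lemma size_class c : size (class_list c) <= 2 ^ u.
Proof. by rewrite size_filter (leq_trans (count_size _ _)) ?size_iota. Qed.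

Lemma size_offlen c : size (class_list c) <= 2 ^ offlen c.
Proof.
rewrite /offlen; case: (size _) => [|[|k]] //; last by have /andP[] := up_log_bounds (isT : 1 < 2) (isT : 1 < k.+2).
Qed.

Lemma offset_lt_size x : x < 2 ^ u -> offset x < size (class_list (popcnt u x)).
Proof. by move=> h; rewrite /offset index_mem mem_class. Qed.

Lemma offset_lt x : x < 2 ^ u -> offset x < 2 ^ offlen (popcnt u x).
Proof. by move=> h; apply: leq_trans (offset_lt_size h) (size_offlen _). Qed.

Lemma offlen_le c : offlen c <= u.
Proof. by rewrite /offlen up_log_min // size_class. Qed.

(** Rounding up to a power of two less than doubles a nonempty class; the added 1 covers an empty
    class, whose offset length is 0. *)
Lemma offlen_bound c : 2 ^ offlen c <= 2 * size (class_list c) + 1.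
Proof.
rewrite /offlen; case: (size _) => [|[|k]] //.
have /andP[h _] := up_log_bounds (isT : 1 < 2) (isT : 1 < k.+2).
case E: (up_log 2 k.+2) h => [|l] /=; first by lia.
rewrite expnS; lia.
Qed.

(** The classes partition the [2 ^ u] blocks, so the sum is at most [2 * 2 ^ u + (u + 1)]. *)
Lemma sum_offlen : \sum_(c < u.+1) 2 ^ offlen c <= 2 ^ (u + 2).
Proof.
apply: leq_trans (_ : \sum_(c < u.+1) (2 * size (class_list c) + 1) <= _).
  by apply: leq_sum => c _; apply: offlen_bound.
rewrite big_split /= -big_distrr /= sum_nat_const card_ord muln1.
have -> : \sum_(c < u.+1) size (class_list c) = 2 ^ u.
  have -> : \sum_(c < u.+1) size (class_list c) =
      \sum_(c < u.+1) \sum_(x <- iota 0 (2 ^ u) | popcnt u x == c) 1.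
    by apply: eq_bigr => c _; rewrite /class_list size_filter sum1_count.
  rewrite -[RHS](size_iota 0) -sum1_size.
  rewrite (exchange_big_dep xpredT) //= big_seq [RHS]big_seq.
  apply: eq_bigr => x _.
  have hx : popcnt u x < u.+1 by rewrite ltnS popcnt_le.
  by rewrite (big_pred1 (Ordinal hx)).
by rewrite expnD; have := @ltn_expl 2 u isT; lia.
Qed.

(* The codes of the cells with a given class vector form an aligned interval of
   at least 2^(G - H) codes, so the top H bits of a cell determine the vector. *)
Definition cvec := {ffun 'I_q -> 'I_u.+1}.
Definition cvlen (v : cvec) := \sum_i offlen (v i).
Definition cvsize (v : cvec) := 2 ^ maxn (cvlen v) (G - H).

Lemma cvsize_gt0 v : 0 < cvsize v. Proof. by rewrite expn_gt0. Qed.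

(** Kraft's inequality for class vectors. The sum of the products [2 ^ cvlen v] factors into [q]
    sums bounded by [sum_offlen] and, doubled for alignment, takes half of the codes. By [hH] the
    vectors lifted to the minimum length take at most the other half. *)
Lemma sum_cvsize : \sum_v 2 * cvsize v <= 2 ^ G.
Proof.
apply: leq_trans (_ : \sum_(v : cvec) (2 * 2 ^ cvlen v + 2 * 2 ^ (G - H)) <= _).
  apply: leq_sum => v _; rewrite /cvsize /maxn; case: ifP => _; lia.
rewrite big_split /= -!big_distrr /= sum_nat_const card_ffun !card_ord.
have h1 : \sum_(v : cvec) 2 ^ cvlen v <= 2 ^ ((u + 2) * q).
  under eq_bigr => v _ do rewrite /cvlen expn_sum.
  rewrite -(bigA_distr_bigA (fun (i : 'I_q) (c : 'I_u.+1) => 2 ^ offlen c)) /=.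
  rewrite prod_nat_const card_ord expnM; case: (posnP q) => [->//|q0].
  by rewrite leq_exp2r // sum_offlen.
have h2 : u.+1 ^ q * 2 ^ (G - H) * 4 <= 2 ^ G.
  by rewrite mulnAC -{2}(subnKC hHG) expnD leq_mul2r hH orbT.
have h3 : 2 ^ ((u + 2) * q) * 4 = 2 ^ G by rewrite /cellw expnD.
move: h1 h2 h3; move: (\sum_(v : cvec) _) (2 ^ (G - H)) (2 ^ G) (2 ^ _) (u.+1 ^ q); nia.
Qed.

Local Notation st := (start cvsize).

Lemma start_cvsize_lt v : st v + cvsize v <= 2 ^ G.
Proof.
apply: leq_trans (start_le cvsize_gt0 v) (leq_trans _ sum_cvsize).
exact: presum_total.
Qed.

Lemma cvlen_le v : cvlen v <= G.
Proof.
rewrite -(@leq_exp2l 2) //; apply: leq_trans (start_cvsize_lt v).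
apply: leq_trans (leq_addl _ _); by rewrite leq_exp2l // leq_maxl.
Qed.

Lemma dvd_start v k : k <= maxn (cvlen v) (G - H) -> 2 ^ k %| st v.
Proof. by move=> h; apply: dvdn_mull; apply: dvdn_exp2l. Qed.

Definition decode (hw : nat) : option cvec :=
  [pick v | st v <= hw * 2 ^ (G - H) < st v + cvsize v].

(** The default 0, for [hw] that begins no valid code or [i] out of range, makes the lookup table
    total. *)
Definition dcls (hw i : nat) : nat :=
  if decode hw is Some v then (if insub i is Some j then v j else 0 : nat) else 0.

Variable xs : nat -> nat.
Hypothesis xs_lt : forall i, i < q -> xs i < 2 ^ u.

Definition classes : cvec := [ffun i : 'I_q => inord (popcnt u (xs i))].

Definition pieces : seq (seq bool) :=
  [seq enc (offlen (popcnt u (xs i))) (offset (xs i)) | i <- iota 0 q].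

(** Bits are least significant first, so the offsets form the low part and the start of the interval
    of the class vector the high part: as a number the cell is [st classes] plus something below
    [2 ^ cvlen classes]. *)
Definition cell : seq bool :=
  flatten pieces ++ enc (G - cvlen classes) (st classes %/ 2 ^ cvlen classes).

Lemma classesE (i : 'I_q) : classes i = popcnt u (xs i) :> nat.
Proof. by rewrite ffunE inordK // ltnS popcnt_le. Qed.

Lemma size_pieces : size pieces = q.
Proof. by rewrite size_map size_iota. Qed.

Lemma nth_pieces i : i < q ->
  nth [::] pieces i = enc (offlen (popcnt u (xs i))) (offset (xs i)).
Proof. by move=> h; rewrite (nth_map 0) ?size_iota // nth_iota. Qed.

Lemma size_flatten_pieces : size (flatten pieces) = cvlen classes.
Proof.
have -> : cvlen classes = \sum_(i < q) offlen (popcnt u (xs i)).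
  by apply: eq_bigr => i _; rewrite classesE.
rewrite size_flatten /shape sumnE /pieces !big_map -{1}(subn0 q) big_mkord.
by apply: eq_bigr => i _; rewrite size_enc.
Qed.

Lemma size_cell : size cell = G.
Proof. by rewrite size_cat size_flatten_pieces size_enc subnKC // cvlen_le. Qed.

Lemma bval_cell : exists2 y, y < 2 ^ cvlen classes & bval cell 0 G = st classes + y.
Proof.
exists (bval (flatten pieces) 0 (cvlen classes)); first exact: bval_lt.
rewrite -{1}(subnKC (cvlen_le classes)) bval_split add0n addnC /cell; congr (_ + _).
  have /= := @bval_catr (flatten pieces) (enc (G - cvlen classes) (st classes %/ 2 ^ cvlen classes)) 0 (G - cvlen classes).
  rewrite addn0 size_flatten_pieces => ->; last by rewrite size_enc.
  rewrite bval_enc.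
    by rewrite mulnC divnK // dvd_start // leq_maxl.
  rewrite ltn_divLR ?expn_gt0 // -expnD subnK ?cvlen_le //.
  by apply: leq_trans (start_cvsize_lt classes); rewrite -addn1 leq_add2l cvsize_gt0.
by rewrite bval_catl // size_flatten_pieces.
Qed.

Lemma decode_cell : decode (bval cell (G - H) H) = Some classes.
Proof.
have [y hy e] := bval_cell.
have hw : bval cell (G - H) H = (st classes + y) %/ 2 ^ (G - H).
  by rewrite -e -{2}(subnK hHG) bval_div.
(* Clearing the low [G - H] bits does not leave the interval, because its start is a multiple of
   [2 ^ (G - H)]. *)
have in1 : st classes <= (st classes + y) %/ 2 ^ (G - H) * 2 ^ (G - H) < st classes + cvsize classes.
  have hs : st classes = st classes %/ 2 ^ (G - H) * 2 ^ (G - H).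
    by rewrite divnK // dvd_start // leq_maxr.
  apply/andP; split.
    by rewrite {1}hs leq_mul2r leq_div2r ?orbT // leq_addr.
  apply: leq_ltn_trans (leq_trunc_div _ _) _; rewrite ltn_add2l.
  by apply: leq_trans hy _; rewrite leq_exp2l // leq_maxl.
rewrite /decode hw; case: pickP => [v hv|/(_ classes)]; last by rewrite in1.
by congr Some; apply: (start_inj cvsize_gt0 hv in1).
Qed.

Lemma dcls_cell i : i < q -> dcls (bval cell (G - H) H) i = popcnt u (xs i).
Proof.
move=> hi; rewrite /dcls decode_cell; case: insubP => [j _ <-|]; first exact: classesE.
by rewrite hi.
Qed.

(** The offsets have variable lengths, but the classes decoded from the top [H] bits give the
    lengths of all preceding ones, hence the position of the wanted one. *)
Lemma offset_cell i : i < q ->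
  bval cell (\sum_(j < i) offlen (dcls (bval cell (G - H) H) j)) (offlen (popcnt u (xs i)))
  = offset (xs i).
Proof.
move=> hi; have hi' : i < size pieces by rewrite size_pieces.
have -> : \sum_(j < i) offlen (dcls (bval cell (G - H) H) j) =
   \sum_(j < i) size (nth [::] pieces j).
  apply: eq_bigr => j _; have hj := ltn_trans (ltn_ord j) hi.
  by rewrite dcls_cell // nth_pieces // size_enc.
have e : size (nth [::] pieces i) = offlen (popcnt u (xs i)) by rewrite nth_pieces // size_enc.
rewrite -e bval_catl.
  by rewrite bval_flatten // e nth_pieces // bval_enc // offset_lt // xs_lt.
rewrite size_flatten /shape sumnE big_map.
rewrite (big_nth [::]) big_mkord -(big_mkord xpredT (fun j => size (nth [::] pieces j))).
rewrite -(big_mkord xpredT (fun j => size (nth [::] pieces j))) -big_nat_recr //=.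
by rewrite [X in _ <= X](@big_cat_nat _ _ _ i.+1) //= leq_addr.
Qed.

End Cells.

(** * A compressed bitmap with constant-time rank *)

Lemma rank_le B p : rank B p <= size B.
Proof.
have [h|h] := leqP p (size B); first exact: leq_trans (ones_le _ _ _) h.
rewrite -(subnKC (ltnW h)) rankD; apply: leq_trans (_ : size B + 0 <= _); last by rewrite addn0.
rewrite leq_add // ?ones_le // /ones big1 // => i _.
by rewrite nth_default // leq_addr.
Qed.

Lemma rank_mono B p p' : p <= p' -> rank B p <= rank B p'.
Proof. by move=> h; rewrite -(subnKC h) rankD leq_addr. Qed.

Lemma rank_sub_le B p p' : p <= p' -> rank B p' - rank B p <= p' - p.
Proof. by move=> h; rewrite -{1}(subnKC h) rankD addKn ones_le. Qed.

Lemma size_flatten_const (T : Type) (ss : seq (seq T)) w :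
  (forall j, j < size ss -> size (nth [::] ss j) = w) -> size (flatten ss) = size ss * w.
Proof.
elim: ss => //= s ss IH h; rewrite size_cat IH ?(h 0) // => j hj.
exact: (h j.+1).
Qed.

Lemma size_cat5 (T : Type) (a b c d e : seq T) :
  size (a ++ b ++ c ++ d ++ e) = size a + (size b + (size c + (size d + size e))).
Proof. by rewrite !size_cat. Qed.

Lemma size_cat3 (T : Type) (a b c : seq T) : size (a ++ b ++ c) = size a + (size b + size c).
Proof. by rewrite !size_cat. Qed.

Lemma size_cat4 (T : Type) (a b c d : seq T) :
  size (a ++ b ++ c ++ d) = size a + (size b + (size c + size d)).
Proof. by rewrite !size_cat. Qed.

Section RankData.
Variables (B : seq bool) (lam rho u q H : nat).
Local Notation GU := (q * u).
Local Notation SU := (q * (q * u)).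
Local Notation G := (cellw u q).
(** One entry more than there are full cells, so that the position [size B], the largest argument of
    a rank query, has a cell too. *)
Local Notation NG := ((size B %/ GU).+1).
Local Notation NS := ((size B %/ SU).+1).

Definition block_val g i := bval B (g * GU + i * u) u.
Definition supers := fields lam (mkseq (fun j => rank B (j * SU)) NS).
Definition rels :=
  fields rho (mkseq (fun j => rank B (j * GU) - rank B (j %/ q * SU)) NG).
Definition cells := flatten (mkseq (fun j => cell u q H (block_val j)) NG).

(** Addressed by the top bits [hw] of a cell, a block number [i] and a field number. The four fields
    are the number of ones before block [i], the bit position and the length of its offset, and the
    address of the part of [tableD] that belongs to its class. *)
Definition tableA_entry (dbase t : nat) :=
  let hw := t %/ 4 %/ q in let i := t %/ 4 %% q in
  nth 0 [:: \sum_(j < i) dcls u q H hw j; \sum_(j < i) offlen u (dcls u q H hw j);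
   offlen u (dcls u q H hw i); dbase + dcls u q H hw i * 2 ^ u * u * lam] (t %% 4).
Definition tableA dbase := fields lam (mkseq (tableA_entry dbase) (2 ^ H * q * 4)).
(** Addressed by class, offset and a length below [u]; class and offset determine the block, and the
    entry counts the ones in its prefix of that length. *)
Definition tableD := fields lam (mkseq (fun t =>
   popcnt (t %% u) (nth 0 (class_list u (t %/ u %/ 2 ^ u)) (t %/ u %% 2 ^ u)))
   (u.+1 * 2 ^ u * u)).

Definition relbase sb := sb + NS * lam.
Definition cellbase sb := relbase sb + NG * rho.
Definition tabAbase sb := cellbase sb + NG * G.
Definition tabDbase sb := tabAbase sb + 2 ^ H * q * 4 * lam.
Definition rank_bits sb := supers ++ rels ++ cells ++ tableA (tabDbase sb) ++ tableD.

Hypotheses (u0 : 0 < u) (q0 : 0 < q) (hH : u.+1 ^ q * 4 <= 2 ^ H) (hHG : H <= G).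

Lemma block_val_lt g i : block_val g i < 2 ^ u. Proof. exact: bval_lt. Qed.

Lemma size_cells : size cells = NG * G.
Proof.
rewrite (@size_flatten_const _ _ G) ?size_mkseq // => j hj.
by rewrite nth_mkseq // size_cell // => i _; apply: block_val_lt.
Qed.

Lemma size_rank_bits sb :
  sb + size (rank_bits sb) = tabDbase sb + u.+1 * 2 ^ u * u * lam.
Proof.
rewrite /rank_bits size_cat5 size_cells !size_fields !size_mkseq.
by rewrite /tabDbase /tabAbase /cellbase /relbase !addnA.
Qed.

Lemma dcls_le hw i : dcls u q H hw i <= u.
Proof.
rewrite /dcls; case: decode => // v; case: insub => // j; by rewrite -ltnS ltn_ord.
Qed.

Lemma sum_le_mul k c (F : nat -> nat) : (forall j, F j <= c) -> \sum_(j < k) F j <= k * c.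
Proof.
move=> h; apply: leq_trans (_ : \sum_(j < k) c <= _); first by apply: leq_sum => j _.
by rewrite sum_nat_const card_ord.
Qed.

Variables (pre : seq bool).
Local Notation sb := (size pre).
Local Notation bits := (pre ++ rank_bits sb).
Hypothesis (hlam : size bits < 2 ^ lam).
Hypothesis (hrho : SU < 2 ^ rho).

Lemma bits_lt x : x <= size bits -> x < 2 ^ lam.
Proof. by move=> h; apply: leq_ltn_trans hlam. Qed.

Lemma size_bitsE : size bits = tabDbase sb + u.+1 * 2 ^ u * u * lam.
Proof. by rewrite size_cat size_rank_bits. Qed.

Lemma bval_region (X Y Z : seq bool) p o w : p = size pre + size X ->
  rank_bits sb = X ++ Y ++ Z -> o + w <= size Y ->
  p + o + w <= size bits /\ bval bits (p + o) w = bval Y o w.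
Proof.
move=> -> -> h; split; first by rewrite !size_cat; lia.
by rewrite -addnA bval_catr ?bval_cat // !size_cat; lia.
Qed.

Lemma mulS_le j k w : j < k -> j * w + w <= k * w.
Proof. by move=> h; rewrite addnC -mulSn leq_mul2r h orbT. Qed.

(** The cells alone take at least [size B] bits, so counts in [B] fit in a field as soon as
    addresses do. *)
Lemma sizeB_bits : size B < 2 ^ lam.
Proof.
apply: bits_lt; rewrite size_bitsE /tabDbase /tabAbase.
have h : size B <= NG * G.
  rewrite {1}(divn_eq (size B) GU) mulSn addnC leq_add //.
    by rewrite /cellw; have := @ltn_pmod (size B) GU; rewrite muln_gt0 q0 u0 => /(_ isT); nia.
  by rewrite leq_mul2l /cellw; nia.
lia.
Qed.

Lemma supers_ok j : j < NS ->
  sb + j * lam + lam <= size bits /\ bval bits (sb + j * lam) lam = rank B (j * SU).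
Proof.
move=> hj; have hs : j * lam + lam <= size supers.
  by rewrite size_fields size_mkseq mulS_le.
have [] := @bval_region [::] supers (rels ++ cells ++ tableA (tabDbase sb) ++ tableD)
  sb (j * lam) lam (esym (addn0 _)) erefl hs.
move=> -> ->; rewrite /supers bval_fields ?size_mkseq ?nth_mkseq //.
exact: leq_ltn_trans (rank_le _ _) sizeB_bits.
Qed.

Lemma rels_ok j : j < NG ->
  relbase sb + j * rho + rho <= size bits /\
  bval bits (relbase sb + j * rho) rho = rank B (j * GU) - rank B (j %/ q * SU).
Proof.
move=> hj; have hs : j * rho + rho <= size rels.
  by rewrite size_fields size_mkseq mulS_le.
have e : relbase sb = sb + size supers by rewrite size_fields size_mkseq.
have [] := @bval_region supers rels (cells ++ tableA (tabDbase sb) ++ tableD)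
  (relbase sb) (j * rho) rho e erefl hs.
move=> -> ->; rewrite /rels bval_fields ?size_mkseq ?nth_mkseq //.
have le : j %/ q * SU <= j * GU by rewrite mulnA leq_mul2r leq_trunc_div orbT.
apply: leq_ltn_trans (rank_sub_le _ le) (leq_ltn_trans _ hrho).
rewrite [j %/ q * _]mulnA -mulnBl leq_mul2r; apply/orP; right.
have := divn_eq j q; have := ltn_pmod j q0; lia.
Qed.

Lemma cells_ok j o w : j < NG -> o + w <= G ->
  cellbase sb + j * G + o + w <= size bits /\
  bval bits (cellbase sb + j * G + o) w = bval (cell u q H (block_val j)) o w.
Proof.
move=> hj how; have hs : j * G + o + w <= size cells.
  by rewrite size_cells; apply: leq_trans (mulS_le _ hj); rewrite -addnA leq_add2l.
have e : cellbase sb = sb + size (supers ++ rels).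
  by rewrite size_cat !size_fields !size_mkseq /cellbase /relbase addnA.
have e2 : rank_bits sb = (supers ++ rels) ++ cells ++ (tableA (tabDbase sb) ++ tableD).
  by rewrite /rank_bits -!catA.
have [] := @bval_region _ _ _ _ _ _ e e2 hs; rewrite -!addnA => -> ->; split => //.
have hc k : k < NG -> size (nth [::] (mkseq (fun j => cell u q H (block_val j)) NG) k) = G.
  by move=> hk; rewrite nth_mkseq // size_cell // => i _; apply: block_val_lt.
have hj' : j < size (mkseq (fun j => cell u q H (block_val j)) NG) by rewrite size_mkseq.
have [|A [C [eq sA]]] := flatten_nth_cat hj' (w := G).
  by move=> k; rewrite size_mkseq; apply: hc.
rewrite /cells eq -sA bval_cat ?nth_mkseq //.
by rewrite size_cell // => i _; apply: block_val_lt.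
Qed.

Lemma tableA_ok hw i f : hw < 2 ^ H -> i < q -> f < 4 ->
  tabAbase sb + ((hw * q + i) * 4 + f) * lam + lam <= size bits /\
  bval bits (tabAbase sb + ((hw * q + i) * 4 + f) * lam) lam =
  nth 0 [:: \sum_(j < i) dcls u q H hw j; \sum_(j < i) offlen u (dcls u q H hw j);
   offlen u (dcls u q H hw i); tabDbase sb + dcls u q H hw i * 2 ^ u * u * lam] f.
Proof.
move=> hhw hi hf; set t := (hw * q + i) * 4 + f.
have ht : t < 2 ^ H * q * 4.
  have h1 : hw * q + i < 2 ^ H * q.
    by apply: leq_trans (mulS_le q hhw); rewrite ltn_add2l.
  by apply: leq_trans (mulS_le 4 h1); rewrite ltn_add2l.
have hs : t * lam + lam <= size (tableA (tabDbase sb)).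
  by rewrite size_fields size_mkseq mulS_le.
have e : tabAbase sb = sb + size (supers ++ rels ++ cells).
  by rewrite size_cat3 size_cells !size_fields !size_mkseq /tabAbase /cellbase /relbase !addnA.
have e2 : rank_bits sb = (supers ++ rels ++ cells) ++ tableA (tabDbase sb) ++ tableD.
  by rewrite /rank_bits -!catA.
have [] := @bval_region _ _ _ _ _ _ e e2 hs => -> ->; split => //.
have t4 : t %/ 4 = hw * q + i by rewrite /t divnMDl // divn_small ?addn0.
have tf : t %% 4 = f by rewrite /t modnMDl modn_small.
have th : t %/ 4 %/ q = hw by rewrite t4 divnMDl // divn_small ?addn0.
have ti : t %/ 4 %% q = i by rewrite t4 modnMDl modn_small.
have bnd : q * u < 2 ^ lam.
  apply: bits_lt; rewrite size_bitsE /tabDbase /tabAbase.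
  have : q * u <= NG * G by rewrite mulSn; apply: leq_trans (leq_addr _ _); rewrite /cellw; nia.
  lia.
rewrite /tableA bval_fields ?size_mkseq ?nth_mkseq // {1}/tableA_entry /= tf th ti //.
case: f hf {t ht hs e e2 t4 tf th ti} => [|[|[|[|//]]]] _ /=.
- apply: leq_ltn_trans (sum_le_mul i (dcls_le hw)) (leq_ltn_trans _ bnd).
  by rewrite leq_mul2r ltnW ?orbT.
- apply: leq_ltn_trans (sum_le_mul i (fun j => offlen_le u (dcls u q H hw j))) (leq_ltn_trans _ bnd).
  by rewrite leq_mul2r ltnW ?orbT.
- by apply: leq_ltn_trans (offlen_le _ _) (leq_ltn_trans _ bnd); rewrite leq_pmull.
- apply: bits_lt; rewrite size_bitsE leq_add2l !leq_mul2r.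
  by rewrite (leq_trans (dcls_le hw i)) ?leqnSn ?orbT.
Qed.

Lemma tableD_ok c o r : c <= u -> o < 2 ^ u -> r < u ->
  tabDbase sb + c * 2 ^ u * u * lam + (o * u + r) * lam + lam <= size bits /\
  bval bits (tabDbase sb + c * 2 ^ u * u * lam + (o * u + r) * lam) lam =
  popcnt r (nth 0 (class_list u c) o).
Proof.
move=> hc ho hr; set t := (c * 2 ^ u + o) * u + r.
have et : c * 2 ^ u * u * lam + (o * u + r) * lam = t * lam.
  by rewrite /t !mulnDl !addnA.
rewrite -(addnA (tabDbase sb)) et.
have ht : t < u.+1 * 2 ^ u * u.
  have h1 : c * 2 ^ u + o < u.+1 * 2 ^ u.
    by apply: leq_trans (mulS_le _ (hc : c < u.+1)); rewrite ltn_add2l.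
  by apply: leq_trans (mulS_le u h1); rewrite ltn_add2l.
have hs : t * lam + lam <= size tableD by rewrite size_fields size_mkseq mulS_le.
have e : tabDbase sb = sb + size (supers ++ rels ++ cells ++ tableA (tabDbase sb)).
  by rewrite size_cat4 size_cells !size_fields !size_mkseq /tabDbase /tabAbase /cellbase /relbase !addnA.
have e2 : rank_bits sb = (supers ++ rels ++ cells ++ tableA (tabDbase sb)) ++ tableD ++ [::].
  by rewrite /rank_bits -!catA cats0.
have [] := @bval_region _ _ _ _ _ _ e e2 hs => -> ->; split=> //.
have tu : t %/ u = c * 2 ^ u + o by rewrite /t divnMDl // divn_small ?addn0.
have tr : t %% u = r by rewrite /t modnMDl modn_small.
have tc : t %/ u %/ 2 ^ u = c by rewrite tu divnMDl ?expn_gt0 // divn_small ?addn0.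
have to : t %/ u %% 2 ^ u = o by rewrite tu modnMDl modn_small.
rewrite /tableD bval_fields ?size_mkseq ?nth_mkseq // tr tc to //.
apply: leq_ltn_trans (popcnt_le _ _) (ltn_trans hr _).
apply: bits_lt; rewrite size_bitsE /tabDbase /tabAbase.
have : u <= NG * G by rewrite mulSn; apply: leq_trans (leq_addr _ _); rewrite /cellw; nia.
move=> h; apply: leq_trans h _; do 2!(apply: leq_trans; last exact: leq_addr); exact: leq_addl.
Qed.

End RankData.

(* The rank query as a program *)
Declare Scope prog_scope.
Delimit Scope prog_scope with P.
Bind Scope prog_scope with expr.
Arguments Bin _ (_ _)%_P.
Arguments Ld _%_P.
Arguments Asn _ _%_P.
Arguments If _%_P _ _.
Arguments Rep _%_P _.
Notation "e + f" := (Bin OAdd e f) : prog_scope.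
Notation "e - f" := (Bin OSub e f) : prog_scope.
Notation "e * f" := (Bin OMul e f) : prog_scope.
Notation "e '%/' f" := (Bin ODiv e f) : prog_scope.
Notation "e '%%' f" := (Bin OMod e f) : prog_scope.
Notation "e <<< f" := (Bin OShl e f) (at level 40) : prog_scope.
Notation "e >>> f" := (Bin OShr e f) (at level 40) : prog_scope.
Notation "e < f" := (Bin OLt e f) : prog_scope.
Notation "e == f" := (Bin OEq e f) : prog_scope.
Notation "'#' k" := (Cst k) (at level 8, k at level 0, format "'#' k") : prog_scope.
Notation "'$' k" := (Var k) (at level 8, k at level 0, format "'$' k") : prog_scope.
Notation "x ::= e" := (Asn x e) (at level 85).
Notation "c1 ;; c2" := (Seq c1 c2) (at level 90, right associativity).

Definition rd (ep ew : expr) := rdE (Var 10) ep ew.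

(** For the position in register 40, registers 42 to 46 receive the number of its cell, the position
    inside the cell, the address of the cell, the address of the [tableA] row of its block, and the
    offset of the block. [rE6] adds the four counts that make up the rank. *)
Definition rE1 := ($40 %/ $26)%P.
Definition rE2 := ($40 %% $26)%P.
Definition rE3 := ($34 + $42 * $28)%P.
Definition rE4 := ($35 + (rd ($44 + $29) ($30) * $25 + $43 %/ $24) * #4 * $20)%P.
Definition rE5 := (rd ($44 + rd ($45 + $20) ($20)) (rd ($45 + ($20 + $20)) ($20)))%P.
Definition rE6 := ((rd ($32 + $40 %/ $27 * $20) ($20) + rd ($33 + $42 * $31) ($31))
  + (rd ($45) ($20)
     + rd (rd ($45 + $20 * #3) ($20) + ($46 * $24 + $43 %% $24) * $20) ($20)))%P.

Definition rankc :=
  42 ::= rE1;; 43 ::= rE2;; 44 ::= rE3;; 45 ::= rE4;; 46 ::= rE5;; 41 ::= rE6.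

Section RankProg.
Variables (b n : nat) (me : nat -> nat) (B pre : seq bool) (lam rho u q H : nat).
Local Notation GU := (q * u).
Local Notation SU := (q * (q * u)).
Local Notation G := (cellw u q).
Local Notation sb := (size pre).
Local Notation bits := (pre ++ rank_bits B lam rho u q H sb).
Local Notation relb := (relbase B lam u q sb).
Local Notation cellb := (cellbase B lam rho u q sb).
Local Notation tabA := (tabAbase B lam rho u q sb).
Hypotheses (hb : 0 < b) (hbM : b < 2 ^ b).
Hypothesis hme : forall j, j < nwords b bits -> me (n + j) = word_at b bits j.
Hypothesis hadr : n + nwords b bits <= 2 ^ b.
Hypotheses (u0 : 0 < u) (q0 : 0 < q) (hH : u.+1 ^ q * 4 <= 2 ^ H) (hHG : H <= G).
Hypothesis (hlam : size bits < 2 ^ lam).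
Hypothesis (hrho : SU < 2 ^ rho).
Hypotheses (hlb : lam <= b) (hrb : rho <= b) (hHb : H <= b) (hub : u <= b) (lam4 : 3 < lam).

Definition rank_env (s : state) : Prop :=
  [/\ s 8 = b, s 10 = n, s 20 = lam & [/\ s 24 = u, s 25 = q, s 26 = GU & s 27 = SU]] /\
  [/\ s 28 = G, s 29 = G - H, s 30 = H & [/\ s 31 = rho, s 32 = sb, s 33 = relb & s 34 = cellb /\ s 35 = tabA]].

Lemma leM x : x <= size bits -> x < 2 ^ b.
Proof.
move=> h; apply: leq_ltn_trans h (leq_trans hlam _); by rewrite leq_exp2l.
Qed.

Lemma ev_rd s ep ew p w : s 8 = b -> s 10 = n ->
  eval b me ep s = p -> eval b me ew s = w -> w <= b -> p + w <= size bits ->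
  eval b me (rd ep ew) s = bval bits p w.
Proof. by move=> h8 h10 hp hw wb h; apply: (eval_rdE hb hbM hme hadr h8 (h10 : eval b me (Var 10) s = n) hp hw wb h). Qed.

Lemma rankcP s p : rank_env s -> s 40 = p -> p <= size B ->
  sem b me rankc s 41 = rank B p.
Proof.
case=> [[h8 h10 h20 [h24 h25 h26 h27]] [h28 h29 h30 [h31 h32 h33 [h34 h35]]]] h40 hp.
have pM : p < 2 ^ b.
  by apply: leq_ltn_trans hp (leq_trans (sizeB_bits u0 q0 hH hHG hlam hrho) _); rewrite leq_exp2l.
set gp := p %/ GU; set rm := p %% GU; set i := rm %/ u; set ro := rm %% u.
have GU0 : 0 < GU by rewrite muln_gt0 q0.
have hi : i < q by rewrite ltn_divLR // ltn_pmod.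
have hro : ro < u by rewrite ltn_pmod.
have hgp : gp < (size B %/ GU).+1 by rewrite ltnS leq_div2r.
have hsp : p %/ SU < (size B %/ SU).+1 by rewrite ltnS leq_div2r.
set xs := block_val B u q gp.
have hxs j : j < q -> xs j < 2 ^ u by move=> _; apply: block_val_lt.
set cl := cell u q H xs; set hw := bval cl (G - H) H.
have hhw : hw < 2 ^ H by apply: bval_lt.
have sc : size cl = G by rewrite size_cell.
have cok o w (h : o + w <= G) := @cells_ok B lam rho u q H u0 q0 hH hHG pre hlam hrho gp o w hgp h.
have aok f (h : f < 4) := @tableA_ok B lam rho u q H u0 q0 hH hHG pre hlam hrho hw i f hhw hi h.
have clsE j : j < q -> dcls u q H hw j = popcnt u (xs j).
  by move=> hj; rewrite /hw dcls_cell.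
set c := dcls u q H hw i; set L := offlen u c; set P := \sum_(j < i) offlen u (dcls u q H hw j).
set o := offset u (xs i).
have hc : c <= u by apply: dcls_le.
have cE : c = popcnt u (xs i) by apply: clsE.
have hLu : L <= u by apply: offlen_le.
have hPG : P + L <= G.
  apply: leq_trans (_ : i.+1 * u <= _).
    by rewrite mulSn addnC leq_add // /P; apply: (@sum_le_mul i u (fun j => offlen u (dcls u q H hw j))) => j; apply: offlen_le.
  by apply: leq_trans (leq_mul hi (leqnn u)) _; rewrite /cellw mulnDl mulnC -addnA leq_addr.
have oE : bval cl P L = o by rewrite /L cE; apply: offset_cell.
have ho : o < 2 ^ u.
  by rewrite -oE; apply: leq_trans (bval_lt _ _ _) _; rewrite leq_exp2l.
set t := tabA + (hw * q + i) * 4 * lam.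
have tok f : f < 4 -> t + f * lam + lam <= size bits /\ bval bits (t + f * lam) lam =
  nth 0 [:: \sum_(j < i) dcls u q H hw j; P; L;
   tabDbase B lam rho u q H sb + c * 2 ^ u * u * lam] f.
  by move=> hf; have := aok f hf; rewrite mulnDl addnA.
have dok := @tableD_ok B lam rho u q H u0 q0 hH hHG pre hlam hrho c o ro hc ho hro.
have sok := @supers_ok B lam rho u q H u0 q0 hH hHG pre hlam hrho (p %/ SU) hsp.
have rok := @rels_ok B lam rho u q H u0 q0 hH hHG pre hlam hrho gp hgp.
have cM : 4 < 2 ^ b by apply: leq_trans (_ : 2 ^ 3 <= _) => //; rewrite leq_exp2l //; clear -lam4 hlb; lia.
have e1 : eval b me rE1 s = gp by apply: evDiv.
set s1 := upd s 42 gp.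
have e2 : eval b me rE2 s1 = rm by apply: evMod.
set s2 := upd s1 43 rm.
have [ch1 ch2] := cok (G - H) H (leq_trans (eq_leq (subnK hHG)) (leqnn _)).
have e3 : eval b me rE3 s2 = cellb + gp * G.
  apply: evAdd => //; first (apply: evMul => //; apply: leM); last apply: leM; clear -ch1; lia.
set s3 := upd s2 44 (cellb + gp * G).
have [t3 _] := tok 3 isT.
have e4 : eval b me rE4 s3 = t.
  have f1 : eval b me (rd ($44 + $29) ($30))%P s3 = hw.
    rewrite (@ev_rd _ _ _ (cellb + gp * G + (G - H)) H) //.
    by apply: evAdd => //; apply: leM; clear -ch1; lia.
  have lam0 : 0 < lam by clear -lam4; lia.
  have le1 : hw * q + i <= (hw * q + i) * 4 by rewrite leq_pmulr.
  have le2 : (hw * q + i) * 4 <= (hw * q + i) * 4 * lam by rewrite leq_pmulr.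
  have le4 : tabA + (hw * q + i) * 4 * lam <= size bits.
    by apply: leq_trans t3; rewrite -addnA leq_addr.
  have le3 : (hw * q + i) * 4 * lam <= size bits by apply: leq_trans le4; apply: leq_addl.
  apply: evAdd => //; last exact: leM.
  apply: evMul => //; last exact: leM.
  apply: evMul; [|exact: evCst|by apply: leM; apply: leq_trans le3].
  have le5 := leq_trans le1 (leq_trans le2 le3).
  apply: evAdd; [apply: evMul|apply: evDiv|] => //.
  - by apply: leM; apply: leq_trans le5; apply: leq_addr.
  - by apply: leq_ltn_trans pM; apply: leq_mod.
  - exact: leM.
set s4 := upd s3 45 t.
have [t1 v1] := tok 1 isT.
have [t2 v2] := tok 2 isT.
have [t0 v0] := tok 0 isT.
have [t3' v3] := tok 3 isT.
rewrite /= mul1n in v1 t1; rewrite /= mul0n addn0 in v0 t0.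
have [cp1 cp2] := cok P L hPG.
have e5 : eval b me rE5 s4 = o.
  rewrite (@ev_rd _ _ _ (cellb + gp * G + P) L) ?cp2 //.
  - apply: evAdd => //; last by apply: leM; clear -cp1; lia.
    by rewrite (@ev_rd _ _ _ (t + lam) lam) //; apply: evAdd => //; apply: leM; clear -t1; lia.
  - rewrite (@ev_rd _ _ _ (t + 2 * lam) lam) //.
    rewrite mul2n -addnn in t2 *.
    by apply: evAdd => //; [apply: evAdd => //|]; apply: leM; clear -t2; lia.
  - by clear -hLu hub; lia.
set s5 := upd s4 46 o.
have [d1 d2] := dok; have [su1 su2] := sok; have [re1 re2] := rok.
have SUE : p %/ SU * SU + (gp %/ q - p %/ SU) * SU = gp %/ q * SU.
  by rewrite -mulnDl subnKC // /gp -divnMA mulnC.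
have gpq : gp %/ q = p %/ SU by rewrite /gp -divnMA [GU * q]mulnC.
(* The rank is the count up to the superblock, plus the count from there to the cell, plus the
   classes of the full blocks before the position, plus the ones in a prefix of the last block. *)
have final : rank B (p %/ SU * SU) + (rank B (gp * GU) - rank B (gp %/ q * SU)) +
  (\sum_(j < i) dcls u q H hw j + popcnt ro (nth 0 (class_list u c) o)) = rank B p.
  rewrite gpq subnKC; last first.
    by apply: rank_mono; rewrite -gpq mulnA leq_mul2r leq_trunc_div orbT.
  have pE : p = gp * GU + (i * u + ro) by rewrite -!divn_eq.
  rewrite [in RHS]pE rankD; congr (_ + _); rewrite onesD; congr (_ + _).
    rewrite (eq_bigr (fun j : 'I_i => ones B (gp * GU + j * u) u)); last first.
      by move=> j _; rewrite clsE ?(ltn_trans (ltn_ord j)) // popcnt_bval.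
    move: (i) => k; elim: k => [|k IHk]; first by rewrite big_ord0 /ones big_ord0.
    by rewrite big_ord_recr /= IHk mulSnr onesD.
  by rewrite cE nth_offset ?hxs // popcnt_bval // ltnW.
have e6 : eval b me rE6 s5 = rank B p.
  have pRM : rank B p < 2 ^ b.
    apply: leq_ltn_trans (rank_le _ _) (leq_trans (sizeB_bits u0 q0 hH hHG hlam hrho) _).
    by rewrite leq_exp2l.
  rewrite -final; apply: evAdd; last by rewrite final.
  - apply: evAdd; last by apply: leq_ltn_trans pRM; rewrite -final ?leq_addr ?leq_addl.
    + rewrite (@ev_rd _ _ _ (sb + p %/ SU * lam) lam) //.
      apply: evAdd => //; last by apply: leM; clear -su1; lia.
      by apply: evMul => //; [apply: evDiv|apply: leM; clear -su1; lia].
    + rewrite (@ev_rd _ _ _ (relb + gp * rho) rho) //.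
      apply: evAdd => //; last by apply: leM; clear -re1; lia.
      by apply: evMul => //; apply: leM; clear -re1; lia.
  - apply: evAdd; last by apply: leq_ltn_trans pRM; rewrite -final ?leq_addr ?leq_addl.
    + by rewrite (@ev_rd _ _ _ t lam).
    + rewrite (@ev_rd _ _ _ (tabDbase B lam rho u q H sb + c * 2 ^ u * u * lam + (o * u + ro) * lam) lam) //.
      apply: evAdd; last by apply: leM; clear -d1; lia.
      * rewrite (@ev_rd _ _ _ (t + 3 * lam) lam) //.
        rewrite [3 * lam]mulnC; apply: evAdd => //; last by apply: leM; rewrite mulnC; clear -t3'; lia.
        by apply: evMul => //; [apply: evCst; clear -cM; lia|apply: leM; rewrite mulnC; clear -t3'; lia].
      * have lam0 : 0 < lam by clear -lam4; lia.
        have le2 : (o * u + ro) * lam <= size bits by clear -d1; lia.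
        have le1 : o * u + ro <= size bits by apply: leq_trans le2; rewrite leq_pmulr.
        apply: evMul => //; last exact: leM.
        apply: evAdd; [apply: evMul|apply: evMod|] => //.
        - by apply: leM; apply: leq_trans le1; apply: leq_addr.
        - by apply: leq_ltn_trans pM; apply: leq_mod.
        - exact: leM.
have -> : sem b me rankc s = upd s5 41 (rank B p).
  by rewrite -e6 /s5 -e5 /s4 -e4 /s3 -e3 /s2 -e2 /s1 -e1.
by rewrite /upd eqxx.
Qed.

End RankProg.

(** * Wavelet matrices *)

Section Wavelet.
Variable T : Type.
Implicit Types (s : seq T) (f : T -> bool) (fs : seq (T -> bool)) (phi : T -> nat).

(** A stable partition, zeros first: the passage from one level of a wavelet matrix to the next. *)
Definition part f s := filter (predC f) s ++ filter f s.

Fixpoint after fs s := if fs is f :: fs' then after fs' (part f s) else s.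

Fixpoint bitmaps fs s := if fs is f :: fs' then map f s ++ bitmaps fs' (part f s) else [::].

(** Only the [k] low bits of [phi] are tested, the highest of them first; hence the reductions
    modulo [2 ^ k] in the specifications below. *)
Fixpoint digits phi (k : nat) : seq (T -> bool) :=
  if k is k'.+1 then (fun x => odd (phi x %/ 2 ^ k')) :: digits phi k' else [::].

Definition slice (I J : nat) s := drop I (take J s).

Lemma size_part f s : size (part f s) = size s.
Proof. by rewrite size_cat !size_filter addnC count_predC. Qed.

Lemma size_after fs s : size (after fs s) = size s.
Proof. by elim: fs s => //= f fs IH s; rewrite IH size_part. Qed.

Lemma size_bitmaps fs s : size (bitmaps fs s) = size fs * size s.
Proof. by elim: fs s => //= f fs IH s; rewrite size_cat size_map IH size_part mulSn. Qed.

Lemma size_digits phi k : size (digits phi k) = k.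
Proof. by elim: k => //= k ->. Qed.

Lemma after_cat fs1 fs2 s : after (fs1 ++ fs2) s = after fs2 (after fs1 s).
Proof. by elim: fs1 s => //=. Qed.

Lemma bitmaps_cat fs1 fs2 s :
  bitmaps (fs1 ++ fs2) s = bitmaps fs1 s ++ bitmaps fs2 (after fs1 s).
Proof. by elim: fs1 s => //= f fs IH s; rewrite IH catA. Qed.

Lemma digitsD phi j k :
  digits phi (j + k) = digits (fun x => phi x %/ 2 ^ k) j ++ digits phi k.
Proof.
elim: j => //= j ->; congr (_ :: _); apply: functional_extensionality => x.
by rewrite addnC expnD divnMA.
Qed.

Lemma size_slice I J s : I <= J <= size s -> size (slice I J s) = J - I.
Proof.
by case/andP=> h1 h2; rewrite size_drop size_take_min (minn_idPl h2).
Qed.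

Lemma slice_cat3 I J s : I <= J -> s = take I s ++ slice I J s ++ drop J s.
Proof.
move=> h; rewrite /slice catA -{1}(cat_take_drop J s); congr (_ ++ _).
by rewrite -{1}(cat_take_drop I (take J s)) take_takel.
Qed.

Lemma slice_filter f I J s : I <= J <= size s ->
  filter f (slice I J s) = slice (count f (take I s)) (count f (take J s)) (filter f s).
Proof.
move=> /andP[h1 h2].
have key A C D : slice (count f A) (count f (A ++ C)) (filter f (A ++ C ++ D)) = filter f C.
  by rewrite /slice catA filter_cat -!size_filter take_size_cat // filter_cat drop_size_cat.
have eJ : take J s = take I s ++ slice I J s.
  by rewrite /slice -{1}(cat_take_drop I (take J s)) take_takel.
by have := key (take I s) (slice I J s) (drop J s); rewrite -slice_cat3 // -eJ => ->.
Qed.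

Lemma count_take_mono f I J s : I <= J -> count f (take I s) <= count f (take J s).
Proof.
move=> h; rewrite -(cat_take_drop I (take J s)) take_takel // count_cat.
exact: leq_addr.
Qed.

Lemma count_takeC f I s : I <= size s -> count (predC f) (take I s) = I - count f (take I s).
Proof.
move=> h; have := count_predC f (take I s); rewrite size_take_min (minn_idPl h) => E.
by rewrite -[X in X - _]E addKn.
Qed.

(** By stability the points of an interval that have bit 0 form an interval again, whose ends come
    from two ranks. This lets one walk follow all points of a slice at once. *)
Lemma slice_part0 f I J s : I <= J <= size s ->
  slice (I - count f (take I s)) (J - count f (take J s)) (part f s) =
  filter (predC f) (slice I J s).
Proof.
move=> h; have /andP[h1 h2] := h; rewrite slice_filter // -!count_takeC ?(leq_trans h1) //.
rewrite /slice /part takel_cat // size_filter -{2}(cat_take_drop J s) count_cat.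
exact: leq_addr.
Qed.

Lemma slice_part1 f I J s : I <= J <= size s ->
  slice (size s - count f s + count f (take I s)) (size s - count f s + count f (take J s))
    (part f s) = filter f (slice I J s).
Proof.
move=> h; have /andP[h1 h2] := h; rewrite slice_filter //.
have -> : size s - count f s = size (filter (predC f) s).
  by rewrite size_filter -(count_predC f s) addKn.
rewrite /slice /part take_cat ltnNge leq_addr /= addKn.
by rewrite drop_cat ltnNge leq_addr /= addKn.
Qed.

End Wavelet.

Lemma sum_nth_take (m : seq bool) i : i <= size m ->
  \sum_(j < i) nth false m j = count id (take i m).
Proof.
elim: i => [|i IH] h; first by rewrite big_ord0 take0.
by rewrite big_ord_recr /= IH ?(ltnW h) // (take_nth false h) -cats1 count_cat /= addn0.
Qed.

Lemma ones_count (T : Type) (B : seq bool) O (f : T -> bool) s i :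
  take (size s) (drop O B) = map f s -> i <= size s ->
  ones B O i = count f (take i s).
Proof.
move=> h hi; rewrite -(@count_map _ _ f id) map_take -sum_nth_take ?size_map //.
apply: eq_bigr => j _; rewrite -h nth_take ?nth_drop //.
exact: leq_trans (ltn_ord j) hi.
Qed.

(** * Walking and selecting in a wavelet matrix by program *)

Definition rankAt (e : expr) := 40 ::= e;; rankc.

(* Registers: 50 and 51 bound the interval, 52 is the offset of the bitmap of
   the level, 54 the key with 55 bits to go, 53 the number of keys below it. *)
Definition stepc :=
  rankAt ($52);; 56 ::= $41;;
  rankAt ($52 + $50);; 57 ::= $41 - $56;;
  rankAt ($52 + $51);; 58 ::= $41 - $56;;
  rankAt ($52 + $0);; 59 ::= $0 - ($41 - $56);;
  52 ::= $52 + $0.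

Definition go0 := 50 ::= $50 - $57;; 51 ::= $51 - $58.
Definition go1 := 50 ::= $59 + $57;; 51 ::= $59 + $58.

(** Where the key has bit 1, every element still followed that has bit 0 is smaller; their number,
    the length of the interval of zeros, is added to register 53. *)
Definition walk_body :=
  55 ::= $55 - #1;; stepc;;
  If (($54 >>> $55) %% #2)%P
     (53 ::= $53 + (($51 - $58) - ($50 - $57));; go1)
     go0.

Definition walkc (nb : expr) := 55 ::= nb;; Rep ($55)%P walk_body.

(** Register 60 is the index sought in sorted order and 61 collects the bits found. Zeros come
    first, so comparing the index with their number decides the next bit. *)
Definition quant_body :=
  stepc;; 62 ::= ($51 - $58) - ($50 - $57);;
  If ($60 < $62)%P
     (go0;; 61 ::= $61 + $61)
     (60 ::= $60 - $62;; go1;; 61 ::= $61 + $61 + #1).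

Definition quantc (nb : expr) := 61 ::= #0;; Rep nb quant_body.

Lemma updE f i w j : upd f i w j = if j == i then w else f j. Proof. by []. Qed.

Lemma cost_Rep b me e c s K : (forall s', cost b me c s' <= K) ->
  cost b me (Rep e c) s <= ecost e + 1 + eval b me e s * (K + 4).
Proof.
move=> h /=; rewrite leq_add2l.
apply: leq_trans (_ : \sum_(i < eval b me e s) (K + 4) <= _).
  by apply: leq_sum => i _; rewrite leq_add2r.
by rewrite sum_nat_const card_ord.
Qed.

(** The value 0 for [Rep] is a placeholder; [cmaxP] speaks only of loop-free commands. *)
Fixpoint cmax (c : cmd) : nat :=
  match c with
  | Skip | Rep _ _ => 0
  | Asn _ e => ecost e + 1
  | Seq c1 c2 => cmax c1 + cmax c2
  | If e c1 c2 => ecost e + 1 + maxn (cmax c2) (cmax c1 + 1)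
  end.

Fixpoint norep (c : cmd) : bool :=
  match c with
  | Skip | Asn _ _ => true
  | Rep _ _ => false
  | Seq c1 c2 | If _ c1 c2 => norep c1 && norep c2
  end.

Lemma cmaxP b me c s k : norep c -> cmax c <= k -> cost b me c s <= k.
Proof.
move=> h hk; apply: leq_trans hk; elim: c s h => //= [c1 IH1 c2 IH2|e c1 IH1 c2 IH2] s /andP[h1 h2].
  by rewrite leq_add ?IH1 ?IH2.
by rewrite leq_add2l leq_max; case: ifP => _; rewrite ?leq_add2r ?IH1 ?IH2 ?orbT.
Qed.

Lemma semSeq b me c1 c2 s : sem b me (Seq c1 c2) s = sem b me c2 (sem b me c1 s).
Proof. by []. Qed.

Lemma semAsn b me x e s : sem b me (Asn x e) s = upd s x (eval b me e s).
Proof. by []. Qed.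

Lemma semIf b me e c1 c2 s : sem b me (If e c1 c2) s =
  if eval b me e s == 0 then sem b me c2 s else sem b me c1 s.
Proof. by []. Qed.

Lemma semRep b me e c s : sem b me (Rep e c) s = iter (eval b me e s) (sem b me c) s.
Proof. by []. Qed.

Ltac lookup :=
  cbn [eval]; repeat match goal with s := upd _ _ _ |- _ => subst s end;
  repeat first
   [ rewrite updE /=
   | match goal with
     | H : forall x, is_true _ -> ?s x = _ |- context [?s ?k] => rewrite (H k isT)
     end ].

Lemma modn_exp2S x k : x %% 2 ^ k.+1 = odd (x %/ 2 ^ k) * 2 ^ k + x %% 2 ^ k.
Proof.
by rewrite {1}(divn_eq (x %% 2 ^ k.+1) (2 ^ k)) modn_dvdm ?dvdn_exp2l // -modn2 modn_divl -expnS.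
Qed.

Lemma digit_eq x y k : (x %% 2 ^ k.+1 == y %% 2 ^ k.+1) =
  (odd (x %/ 2 ^ k) == odd (y %/ 2 ^ k)) && (x %% 2 ^ k == y %% 2 ^ k).
Proof.
rewrite !modn_exp2S; have := ltn_pmod x (expn_gt0 2 k); have := ltn_pmod y (expn_gt0 2 k).
move=> h1 h2; move: (2 ^ k) (x %% _) (y %% _) h1 h2 => p r t h1 h2.
by case: (odd _); case: (odd _); rewrite ?mul1n ?mul0n //=; lia.
Qed.

Lemma digit_lt x y k : (x %% 2 ^ k.+1 < y %% 2 ^ k.+1) =
  (~~ odd (x %/ 2 ^ k) && odd (y %/ 2 ^ k)) ||
  ((odd (x %/ 2 ^ k) == odd (y %/ 2 ^ k)) && (x %% 2 ^ k < y %% 2 ^ k)).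
Proof.
rewrite !modn_exp2S; have := ltn_pmod x (expn_gt0 2 k); have := ltn_pmod y (expn_gt0 2 k).
move=> h1 h2; move: (2 ^ k) (x %% _) (y %% _) h1 h2 => p r t h1 h2.
by case: (odd _); case: (odd _); rewrite ?mul1n ?mul0n //=; lia.
Qed.

Lemma count_split (T : Type) (f g : T -> bool) s :
  count g s = count (fun x => g x && ~~ f x) s + count (fun x => g x && f x) s.
Proof. by elim: s => //= x s ->; case: (f x); case: (g x); rewrite /= ?add0n ?add1n ?addnS. Qed.

Section WaveletProg.
Variables (b n : nat) (me : nat -> nat) (B : seq bool) (s0 : state).
Local Notation M := (2 ^ b).
Local Notation sem := (sem b me).
Local Notation ev e s := (eval b me e s).

(** Registers below 40 hold inputs and parameters, which the search programs never write. In every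
    such state [rankc] is assumed correct, which separates the wavelet matrix from the bitmap
    encoding. *)
Definition env (st : state) := forall i, i < 40 -> st i = s0 i.
Hypothesis rank_ok : forall st p, env st -> st 40 = p -> p <= size B ->
  sem rankc st 41 = rank B p.
Hypotheses (hn : s0 0 = n) (hBM : size B < M) (hM : 4 < M) (hnB : n <= size B).

Lemma env_sem c st : all (fun x => 40 <= x) (mods c) -> env st -> env (sem c st).
Proof.
move=> h he i hi; rewrite sem_frame ?he //.
by apply/negP => /(allP h); rewrite leqNgt hi.
Qed.

Lemma env_lt st st' : env st -> (forall x, (x < 40) || (46 < x) -> st' x = st x) -> env st'.
Proof. by move=> h h' i hi; rewrite h' ?hi // h. Qed.

Lemma env_upd st x v : env st -> 40 <= x -> env (upd st x v).
Proof. by move=> h hx i hi; rewrite updE ltn_eqF ?h //; apply: leq_trans hx. Qed.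

Lemma rankAtP e st p : env st -> ev e st = p -> p <= size B ->
  exists s', [/\ sem (rankAt e) st = s', s' 41 = rank B p, env s' &
  forall x, (x < 40) || (46 < x) -> s' x = st x].
Proof.
move=> he hp hpB; exists (sem (rankAt e) st).
have f x : (x < 40) || (46 < x) -> sem (rankAt e) st x = st x.
  by move=> hx; apply: sem_frame; rewrite !inE; lia.
split=> //; last exact: env_lt f.
by rewrite /rankAt semSeq semAsn hp; apply: rank_ok => //; apply: env_upd.
Qed.

Lemma stepcP st I J O : env st -> st 50 = I -> st 51 = J -> st 52 = O ->
  I <= n -> J <= n -> O + n <= size B ->
  [/\ sem stepc st 57 = ones B O I, sem stepc st 58 = ones B O J,
     sem stepc st 59 = n - ones B O n, sem stepc st 52 = O + n &
     forall x, x \notin [:: 40; 41; 42; 43; 44; 45; 46; 52; 56; 57; 58; 59] ->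
       sem stepc st x = st x].
Proof.
move=> he hI hJ hO In Jn On.
have leB x : x <= size B -> x < M by move=> h; apply: leq_ltn_trans hBM.
have hst0 : st 0 = n by rewrite he.
have rB p : rank B p < M by apply: leB; apply: rank_le.
have [s1 [q1 a1 E1 f1]] := rankAtP (e := $52) he hO (leq_trans (leq_addr _ _) On).
pose s2 := upd s1 56 (rank B O).
have E2 : env s2 by apply: env_upd E1 _.
have v2 : ev ($52 + $50) s2 = O + I.
  by apply: evAdd; [lookup|lookup|apply: leB; lia].
have [s3 [q3 a3 E3 f3]] := rankAtP E2 v2 (leq_trans (leq_add (leqnn O) In) On).
pose s4 := upd s3 57 (ones B O I).
have E4 : env s4 by apply: env_upd E3 _.
have v4 : ev ($52 + $51) s4 = O + J.
  by apply: evAdd; [lookup|lookup|apply: leB; lia].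
have [s5 [q5 a5 E5 f5]] := rankAtP E4 v4 (leq_trans (leq_add (leqnn O) Jn) On).
pose s6 := upd s5 58 (ones B O J).
have E6 : env s6 by apply: env_upd E5 _.
have v6 : ev ($52 + $0) s6 = O + n.
  by apply: evAdd; [lookup|lookup|apply: leB; lia].
have [s7 [q7 a7 E7 f7]] := rankAtP E6 v6 (leq_trans (leq_add (leqnn O) (leqnn n)) On).
pose s8 := upd s7 59 (n - ones B O n).
have sub_rank x : rank B (O + x) - rank B O = ones B O x by rewrite rankD addKn.
have onesM x : ones B O x <= rank B (O + x) by rewrite rankD leq_addl.
have k3 : ev ($41 - $56) s3 = ones B O I.
  by rewrite -sub_rank; apply: evSub; [done|lookup|apply: rank_mono; apply: leq_addr|].
have k5 : ev ($41 - $56) s5 = ones B O J.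
  by rewrite -sub_rank; apply: evSub; [done|lookup|apply: rank_mono; apply: leq_addr|].
have k7 : ev ($0 - ($41 - $56)) s7 = n - ones B O n.
  apply: evSub; [by lookup| |exact: ones_le|exact: leB].
  by rewrite -sub_rank; apply: evSub; [done|lookup|apply: rank_mono; apply: leq_addr|].
have k8 : ev ($52 + $0) s8 = O + n.
  by apply: evAdd; [lookup|lookup|apply: leB; lia].
have -> : sem stepc st = upd s8 52 (O + n).
  have r1 : sem (56 ::= $41) s1 = s2 by rewrite semAsn /= a1.
  have r3 : sem (57 ::= $41 - $56) s3 = s4 by rewrite semAsn k3.
  have r5 : sem (58 ::= $41 - $56) s5 = s6 by rewrite semAsn k5.
  have r7 : sem (59 ::= $0 - ($41 - $56)) s7 = s8 by rewrite semAsn k7.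
  rewrite /stepc (semSeq _ _ (rankAt _)) q1 (semSeq _ _ (Asn _ _)) r1.
  rewrite (semSeq _ _ (rankAt _)) q3 (semSeq _ _ (Asn _ _)) r3.
  rewrite (semSeq _ _ (rankAt _)) q5 (semSeq _ _ (Asn _ _)) r5.
  by rewrite (semSeq _ _ (rankAt _)) q7 (semSeq _ _ (Asn _ _)) r7 semAsn k8.
split.
- by lookup.
- by lookup.
- by lookup.
- by lookup.
- move=> x; rewrite !inE !negb_or => hx.
  rewrite updE ifN ?/s8; last by lia.
  rewrite updE ifN; last by lia.
  rewrite f7 ?/s6; last by lia.
  rewrite updE ifN; last by lia.
  rewrite f5 ?/s4; last by lia.
  rewrite updE ifN; last by lia.
  rewrite f3 ?/s2; last by lia.
  rewrite updE ifN; last by lia.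
  by rewrite f1 //; lia.
Qed.

Section Step.
Variables (T : Type) (phi : T -> nat) (k : nat) (sq : seq T) (I J O : nat).
Hypotheses (hIJ : I <= J <= n) (hsq : size sq = n) (hO : O + k.+1 * n <= size B)
  (hseg : take (k.+1 * n) (drop O B) = bitmaps (digits phi k.+1) sq).
Let f x := odd (phi x %/ 2 ^ k).

Lemma seg_head i : i <= n -> ones B O i = count f (take i sq).
Proof.
move=> hi; apply: ones_count; rewrite hsq //.
have e : take n (take (k.+1 * n) (drop O B)) = take n (drop O B).
  by rewrite take_takel // mulSn leq_addr.
by rewrite -e hseg /= take_size_cat // size_map.
Qed.

Lemma seg_tail : take (k * n) (drop (O + n) B) = bitmaps (digits phi k) (part f sq).
Proof.
have e : drop n (take (k.+1 * n) (drop O B)) = bitmaps (digits phi k) (part f sq).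
  by rewrite hseg /= drop_size_cat // size_map.
by rewrite -e addnC -drop_drop take_drop -mulSnr.
Qed.

(** Besides the ranks, it collects the inequalities with which the loop bodies rule out underflow
    and overflow. *)
Lemma stepc_digit st : env st -> st 50 = I -> st 51 = J -> st 52 = O ->
  let a := count f (take I sq) in let c := count f (take J sq) in
  exists s', [/\ sem stepc st = s', s' 57 = a, s' 58 = c,
    s' 59 = n - count f sq & [/\ s' 52 = O + n,
     forall x, x \notin [:: 40; 41; 42; 43; 44; 45; 46; 52; 56; 57; 58; 59] -> s' x = st x,
     env s' & [/\ a <= I, c <= J & I - a <= J - c] /\
       J - c - (I - a) = count (predC f) (slice I J sq) /\
       count f (slice I J sq) = c - a /\ (a <= c /\ n - count f sq + c <= n)]].
Proof.
move=> he h50 h51 h52 a c; have /andP[h1 h2] := hIJ.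
have hO' : O + n <= size B by apply: leq_trans hO; rewrite leq_add2l mulSn leq_addr.
have [w1 w2 w3 w4 w5] := stepcP he h50 h51 h52 (leq_trans h1 h2) h2 hO'.
have sIJ : I <= J <= size sq by rewrite hsq.
have hI : I <= size sq by rewrite hsq (leq_trans h1).
have hJ : J <= size sq by rewrite hsq.
exists (sem stepc st); split=> //.
- by rewrite w1 seg_head // (leq_trans h1).
- by rewrite w2 seg_head.
- by rewrite w3 seg_head // -hsq take_size.
have aI : a <= I by apply: leq_trans (count_size _ _) _; rewrite size_take_min geq_minl.
have cJ : c <= J by apply: leq_trans (count_size _ _) _; rewrite size_take_min geq_minl.
have ac : a <= c by apply: count_take_mono.
have le : I - a <= J - c.
  rewrite -!count_takeC //; exact: count_take_mono.
have cslice g : count g (slice I J sq) = count g (take J sq) - count g (take I sq).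
  have e : take J sq = take I sq ++ slice I J sq.
    by rewrite /slice -{1}(cat_take_drop I (take J sq)) take_takel.
  by rewrite e count_cat addKn.
split=> //.
- by move=> i hi; rewrite w5 ?he // !inE; lia.
- split; first by []; split; first by rewrite cslice !count_takeC.
  split; first by rewrite cslice.
  split=> //; have : c <= count f sq.
    by rewrite -[X in _ <= count _ X](cat_take_drop J sq) count_cat leq_addr.
  have : count f sq <= n by rewrite -hsq count_size.
  lia.
Qed.

End Step.

(** Induction on the number of bits left, the sequence changing to [part f sq] at each level; by
    [seg_tail] the rest of the segment is the wavelet matrix of that sequence. *)
Lemma walk_iter (T : Type) (phi : T -> nat) nb sq st I J O S key :
  env st -> st 50 = I -> st 51 = J -> st 52 = O -> st 53 = S -> st 54 = key -> st 55 = nb ->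
  I <= J <= n -> size sq = n -> O + nb * n <= size B ->
  take (nb * n) (drop O B) = bitmaps (digits phi nb) sq ->
  S + (J - I) < M -> key < M -> nb < M ->
  exists I' J' s', [/\ iter nb (sem walk_body) st = s', s' 50 = I', s' 51 = J',
   I' <= J' <= n & [/\
   slice I' J' (after (digits phi nb) sq) =
     [seq x <- slice I J sq | phi x %% 2 ^ nb == key %% 2 ^ nb],
   s' 53 = S + count (fun x => phi x %% 2 ^ nb < key %% 2 ^ nb) (slice I J sq) &
   s' 52 = O + nb * n]].
Proof.
elim: nb sq st I J O S => [|k IH] sq st I J O S he h50 h51 h52 h53 h54 h55 hIJ hsq hO hseg hS hkey hnb.
  exists I, J, st; split=> //; split=> //.
  - by rewrite /=; under eq_filter => x do rewrite expn0 !modn1 eqxx; rewrite filter_predT.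
  - by rewrite expn0 (eq_count (a2 := pred0)) ?count_pred0 ?addn0 // => x; rewrite !modn1.
  - by rewrite addn0.
have /andP[h1 h2] := hIJ.
have leB x : x <= n -> x < M by move=> h; apply: leq_ltn_trans hBM; apply: leq_trans hnB.
pose st1 := upd st 55 k.
have Q1 : sem (55 ::= $55 - #1) st = st1.
  by rewrite semAsn (@evSub _ _ _ _ _ k.+1 1) ?subn1 //; apply: evCst; lia.
have E1 : env st1 by apply: env_upd.
have [s2 [Q2 v57 v58 v59 [v52 fr E2 [[aI cJ le] [zc [oc [ac Zc]]]]]]] :=
  @stepc_digit T phi k sq I J O hIJ hsq hO hseg st1 E1 h50 h51 h52.
set f := fun x => odd (phi x %/ 2 ^ k) in v57 v58 v59 aI cJ le zc oc ac Zc.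
set a := count f (take I sq) in v57 aI le zc oc ac.
set c := count f (take J sq) in v58 cJ le zc oc ac Zc.
have sIJ : I <= J <= size sq by rewrite hsq.
have g50 : s2 50 = I by rewrite fr.
have g51 : s2 51 = J by rewrite fr.
have g53 : s2 53 = S by rewrite fr.
have g54 : s2 54 = key by rewrite fr.
have g55 : s2 55 = k by rewrite fr.
have cnd : ev (($54 >>> $55) %% #2) s2 = odd (key %/ 2 ^ k).
  rewrite -modn2; apply: evMod; [|by apply: evCst; lia|].
    by apply: evShr => //=; rewrite ?g54 ?g55.
  by apply: leq_ltn_trans hkey; apply: leq_div.
have hO' : O + n + k * n <= size B by rewrite -addnA -mulSn.
have body : sem walk_body st = if odd (key %/ 2 ^ k) then
   sem (53 ::= $53 + (($51 - $58) - ($50 - $57));; go1) s2 else sem go0 s2.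
  rewrite /walk_body (semSeq _ _ (Asn _ _)) Q1 (semSeq _ _ stepc) Q2 semIf cnd.
  by case: (odd _).
rewrite iterSr body; case: ifP => hbit.
- have e1 : ev ($53 + (($51 - $58) - ($50 - $57))) s2 = S + (J - c - (I - a)).
    apply: evAdd; [exact: g53| |by clear -hS le cJ aI ac h1; lia].
    apply: evSub; [| |exact: le|by apply: leB; clear -h2; lia].
      by apply: evSub; [exact: g51|exact: v58|exact: cJ|exact: leB].
    by apply: evSub; [exact: g50|exact: v57|exact: aI|apply: leB; clear -h1 h2; lia].
  pose s3 := upd s2 53 (S + (J - c - (I - a))).
  have e2 : ev ($59 + $57) s3 = n - count f sq + a.
    by apply: evAdd; [exact: v59|exact: v57|apply: leB; clear -Zc ac; lia].
  pose s4 := upd s3 50 (n - count f sq + a).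
  have e3 : ev ($59 + $58) s4 = n - count f sq + c.
    by apply: evAdd; [exact: v59|exact: v58|apply: leB; clear -Zc; lia].
  pose s5 := upd s4 51 (n - count f sq + c).
  have -> : sem (53 ::= $53 + (($51 - $58) - ($50 - $57));; go1) s2 = s5.
    rewrite (semSeq _ _ (Asn _ _)) semAsn e1 -/s3 /go1 (semSeq _ _ (Asn _ _)).
    by rewrite (semAsn _ _ 50) e2 -/s4 semAsn e3.
    have [|||||I' [J' [s' [q1 q2 q3 q4 [q5 q6 q7]]]]] := IH (part f sq) s5 (n - count f sq + a) (n - count f sq + c)
      (O + n) (S + (J - c - (I - a))) _ erefl erefl v52 erefl g54 g55 _ _ hO' _ _ hkey (ltnW hnb).
  + by do !apply: env_upd.
  + by clear -Zc ac; lia.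
  + by rewrite size_part.
  + exact: (@seg_tail T phi k sq O hsq hseg).
  + by clear -hS ac aI cJ h1 le; lia.
  exists I', J', s'; split=> //; split=> //; last by rewrite q7 mulSn addnA.
  + rewrite [after _ _]/= q5 -{1 2}hsq slice_part1 // -filter_predI.
    by apply: eq_filter => x; rewrite digit_eq hbit /= andbC eqb_id.
  + rewrite q6 -{1 2}hsq slice_part1 // zc -addnA; congr (_ + _).
    (* Below the key are all elements with bit 0, counted by [zc], and those with bit 1 whose lower
       bits are smaller. *)
    rewrite count_filter [in RHS](count_split f); congr (_ + _); apply: eq_count => x.
      by rewrite /= digit_lt hbit -/(f x); case: (f x); rewrite ?andbF.
    by rewrite /= digit_lt hbit -/(f x); case: (f x); rewrite ?andbF.
- have e2 : ev ($50 - $57) s2 = I - a.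
    by apply: evSub; [exact: g50|exact: v57|exact: aI|apply: leB; clear -h1 h2; lia].
  pose s4 := upd s2 50 (I - a).
  have e3 : ev ($51 - $58) s4 = J - c.
    by apply: evSub; [exact: g51|exact: v58|exact: cJ|exact: leB].
  pose s5 := upd s4 51 (J - c).
  have -> : sem go0 s2 = s5.
    by rewrite /go0 (semSeq _ _ (Asn _ _)) (semAsn _ _ 50) e2 -/s4 semAsn e3.
  have [|||||I' [J' [s' [q1 q2 q3 q4 [q5 q6 q7]]]]] := IH (part f sq) s5 (I - a) (J - c)
      (O + n) S _ erefl erefl v52 g53 g54 g55 _ _ hO' _ _ hkey (ltnW hnb).
  + by do !apply: env_upd.
  + by clear -le h2 cJ; lia.
  + by rewrite size_part.
  + exact: (@seg_tail T phi k sq O hsq hseg).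
  + by clear -hS zc oc ac aI cJ le h1; lia.
  exists I', J', s'; split=> //; split=> //; last by rewrite q7 mulSn addnA.
  + rewrite [after _ _]/= q5 slice_part0 // -filter_predI.
    apply: eq_filter => x; rewrite digit_eq hbit /= andbC -/(f x); by case: (f x).
  + rewrite q6 slice_part0 // count_filter; congr (_ + _).
    by apply: eq_count => x; rewrite /= digit_lt hbit -/(f x); case: (f x); rewrite ?andbT ?andbF.
Qed.

Lemma walkcP (T : Type) (phi : T -> nat) nb k sq st I J O S key :
  env st -> ev nb st = k -> st 50 = I -> st 51 = J -> st 52 = O -> st 53 = S -> st 54 = key ->
  I <= J <= n -> size sq = n -> O + k * n <= size B ->
  take (k * n) (drop O B) = bitmaps (digits phi k) sq ->
  S + (J - I) < M -> key < M -> k < M ->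
  exists I' J' s', [/\ sem (walkc nb) st = s', env s' /\ (forall x, (x < 40) || (59 < x) -> s' x = st x),
   s' 50 = I', s' 51 = J' & [/\ I' <= J' <= n,
   slice I' J' (after (digits phi k) sq) =
     [seq x <- slice I J sq | phi x %% 2 ^ k == key %% 2 ^ k],
   s' 53 = S + count (fun x => phi x %% 2 ^ k < key %% 2 ^ k) (slice I J sq) &
   s' 52 = O + k * n]].
Proof.
move=> he hnb h50 h51 h52 h53 h54 hIJ hsq hO hseg hS hkey hk.
pose st1 := upd st 55 k.
have E1 : env st1 by apply: env_upd.
have [I' [J' [s' [q1 q2 q3 q4 [q5 q6 q7]]]]] :=
  @walk_iter T phi k sq st1 I J O S key E1 h50 h51 h52 h53 h54 erefl hIJ hsq hO hseg hS hkey hk.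
have e : sem (walkc nb) st = s'.
  by rewrite -q1 /walkc (semSeq _ _ (Asn _ _)) semAsn hnb semRep.
exists I', J', s'; split=> //; split.
  by rewrite -e; apply: env_sem.
by move=> x hx; rewrite -e; apply: sem_frame; rewrite !inE; clear -hx; lia.
Qed.

(** The two counting bounds say that [y] is the key of index [idx] in sorted order, without building
    a sorted sequence. *)
Lemma quant_iter (T : Type) (phi : T -> nat) nb sq st I J O idx V :
  env st -> st 50 = I -> st 51 = J -> st 52 = O -> st 60 = idx -> st 61 = V ->
  I <= J <= n -> size sq = n -> O + nb * n <= size B ->
  take (nb * n) (drop O B) = bitmaps (digits phi nb) sq ->
  idx < J - I -> (V + 1) * 2 ^ nb <= M ->
  exists s' y, [/\ iter nb (sem quant_body) st = s', s' 61 = V * 2 ^ nb + y, y < 2 ^ nb,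
   count (fun x => phi x %% 2 ^ nb < y) (slice I J sq) <= idx &
   idx < count (fun x => phi x %% 2 ^ nb <= y) (slice I J sq)].
Proof.
elim: nb sq st I J O idx V => [|k IH] sq st I J O idx V he h50 h51 h52 h60 h61 hIJ hsq hO hseg hidx hV.
  exists st, 0; split=> //; first by rewrite h61 expn0 muln1 addn0.
  - by rewrite (eq_count (a2 := pred0)) ?count_pred0.
  - rewrite (eq_count (a2 := predT)) ?count_predT; last by move=> x; rewrite modn1.
    by rewrite size_slice // hsq.
have /andP[h1 h2] := hIJ.
have leB x : x <= n -> x < M by move=> h; apply: leq_ltn_trans hBM; apply: leq_trans hnB.
have [s2 [Q2 v57 v58 v59 [v52 fr E2 [[aI cJ le] [zc [oc [ac Zc]]]]]]] :=
  @stepc_digit T phi k sq I J O hIJ hsq hO hseg st he h50 h51 h52.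
set f := fun x => odd (phi x %/ 2 ^ k) in v57 v58 v59 aI cJ le zc oc ac Zc.
set a := count f (take I sq) in v57 aI le zc oc ac.
set c := count f (take J sq) in v58 cJ le zc oc ac Zc.
have sIJ : I <= J <= size sq by rewrite hsq.
have g50 : s2 50 = I by rewrite fr.
have g51 : s2 51 = J by rewrite fr.
have g60 : s2 60 = idx by rewrite fr.
have g61 : s2 61 = V by rewrite fr.
have e1 : ev (($51 - $58) - ($50 - $57)) s2 = J - c - (I - a).
  apply: evSub; [| |exact: le|by apply: leB; clear -h2; lia].
    by apply: evSub; [exact: g51|exact: v58|exact: cJ|exact: leB].
  by apply: evSub; [exact: g50|exact: v57|exact: aI|apply: leB; clear -h1 h2; lia].
pose z := J - c - (I - a).
pose s3 := upd s2 62 z.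
have E3 : env s3 by apply: env_upd.
have cnd : ev ($60 < $62) s3 = (idx < z).
  by apply: evLt; [exact: g60|by []|apply: leq_trans hM].
have hO' : O + n + k * n <= size B by rewrite -addnA -mulSn.
have stail := @seg_tail T phi k sq O hsq hseg.
have body : sem quant_body st = if idx < z then
   sem (go0;; 61 ::= $61 + $61) s3 else sem (60 ::= $60 - $62;; go1;; 61 ::= $61 + $61 + #1) s3.
  rewrite /quant_body (semSeq _ _ stepc) Q2 (semSeq _ _ (Asn _ _)) semAsn e1 -/s3 semIf cnd.
  by case: (idx < z).
have hV2 : (2 * V + 2) * 2 ^ k <= M by move: hV; rewrite expnS; clear; lia.
have hVM : 2 * V + 2 <= M by apply: leq_trans hV2; rewrite leq_pmulr ?expn_gt0.
rewrite iterSr body; case: ifP => hz.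
- have e2 : ev ($50 - $57) s3 = I - a.
    by apply: evSub; [exact: g50|exact: v57|exact: aI|apply: leB; clear -h1 h2; lia].
  pose s4 := upd s3 50 (I - a).
  have e3 : ev ($51 - $58) s4 = J - c.
    by apply: evSub; [exact: g51|exact: v58|exact: cJ|exact: leB].
  pose s5 := upd s4 51 (J - c).
  have e4 : ev ($61 + $61) s5 = V + V.
    by apply: evAdd; [exact: g61|exact: g61|clear -hVM; lia].
  pose s6 := upd s5 61 (V + V).
  have -> : sem (go0;; 61 ::= $61 + $61) s3 = s6.
    rewrite (semSeq _ _ go0) /go0 (semSeq _ _ (Asn 50 _)) (semAsn _ _ 50) e2 -/s4.
    by rewrite (semAsn _ _ 51) e3 -/s5 semAsn e4.
  have [|||||s' [y [q1 q2 q3 q4 q5]]] := IH (part f sq) s6 (I - a) (J - c)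
      (O + n) idx (V + V) _ erefl erefl v52 g60 erefl _ _ hO' stail _ _.
  + by do !apply: env_upd.
  + by clear -le h2 cJ; lia.
  + by rewrite size_part.
  + exact: hz.
  + by move: hV; rewrite expnS; clear; lia.
  rewrite slice_part0 // in q4 q5.
  exists s', y; split=> //; first by rewrite q2 expnS; clear; lia.
  + by rewrite expnS; clear -q3; lia.
  + apply: leq_trans q4; rewrite count_filter; apply/eq_leq/eq_count => x /=.
    rewrite modn_exp2S -/(f x); case: (f x); rewrite ?andbF ?andbT ?mul1n ?mul0n //.
    by apply/negbTE; rewrite -leqNgt; apply: leq_trans (ltnW q3) (leq_addr _ _).
  + apply: leq_trans q5 _; rewrite count_filter; apply/sub_count => x /= /andP[hx].
    by rewrite modn_exp2S -/(f x); case: (f x).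
- have zidx : z <= idx by rewrite leqNgt hz.
  have zE : z + (c - a) = J - I by rewrite /z; clear -h1 aI cJ ac le; lia.
  have e0 : ev ($60 - $62) s3 = idx - z.
    by apply: evSub; [exact: g60|by []|exact: zidx|apply: leB; clear -hidx h2; lia].
  pose s3' := upd s3 60 (idx - z).
  have e2 : ev ($59 + $57) s3' = n - count f sq + a.
    by apply: evAdd; [exact: v59|exact: v57|apply: leB; clear -Zc ac; lia].
  pose s4 := upd s3' 50 (n - count f sq + a).
  have e3 : ev ($59 + $58) s4 = n - count f sq + c.
    by apply: evAdd; [exact: v59|exact: v58|apply: leB; clear -Zc; lia].
  pose s5 := upd s4 51 (n - count f sq + c).
  have e4 : ev ($61 + $61 + #1) s5 = V + V + 1.
    apply: evAdd; [apply: evAdd; [exact: g61|exact: g61|]|by apply: evCst; apply: leq_trans hM|];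
      clear -hVM; lia.
  pose s6 := upd s5 61 (V + V + 1).
  have -> : sem (60 ::= $60 - $62;; go1;; 61 ::= $61 + $61 + #1) s3 = s6.
    rewrite (semSeq _ _ (Asn 60 _)) (semAsn _ _ 60) e0 -/s3' (semSeq _ _ go1).
    rewrite /go1 (semSeq _ _ (Asn 50 _)) (semAsn _ _ 50) e2 -/s4.
    by rewrite (semAsn _ _ 51) e3 -/s5 semAsn e4.
  have [|||||s' [y [q1 q2 q3 q4 q5]]] := IH (part f sq) s6 (n - count f sq + a) (n - count f sq + c)
      (O + n) (idx - z) (V + V + 1) _ erefl erefl v52 erefl erefl _ _ hO' stail _ _.
  + by do !apply: env_upd.
  + by clear -Zc ac; lia.
  + by rewrite size_part.
  + by clear -zE zidx hidx; lia.
  + by apply: leq_trans hV2; rewrite leq_mul2r; apply/orP; right; clear; lia.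
  have sl1 := slice_part1 f sIJ; rewrite hsq -/a -/c in sl1; rewrite sl1 in q4 q5.
  have zE2 : z = count (predC f) (slice I J sq) by [].
  exists s', (2 ^ k + y); split=> //; first by rewrite q2 expnS; clear; lia.
  + by rewrite expnS; clear -q3; lia.
  + rewrite -(subnKC zidx) (count_split f) zE2; apply: leq_add.
      by apply: sub_count => x /= /andP[].
    rewrite zE2 in q4; apply: leq_trans q4; rewrite count_filter; apply: sub_count => x /= /andP[hx fx].
    by move: hx; rewrite fx modn_exp2S -/(f x) fx mul1n ltn_add2l andbT.
  + rewrite -(subnKC zidx) (count_split f) zE2 -addnS; apply: leq_add.
      apply: sub_count => x /= fx; rewrite fx andbT modn_exp2S -/(f x) (negbTE fx) mul0n.
      by apply: leq_trans (ltnW (ltn_pmod _ _)) (leq_addr _ _); rewrite expn_gt0.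
    rewrite zE2 in q5; apply: leq_trans q5 _; rewrite count_filter; apply: sub_count => x /= /andP[hx fx].
    by rewrite fx andbT modn_exp2S -/(f x) fx mul1n leq_add2l.
Qed.

Lemma quantcP (T : Type) (phi : T -> nat) nb k sq st I J O idx :
  env st -> ev nb (upd st 61 0) = k -> st 50 = I -> st 51 = J -> st 52 = O -> st 60 = idx ->
  I <= J <= n -> size sq = n -> O + k * n <= size B ->
  take (k * n) (drop O B) = bitmaps (digits phi k) sq ->
  idx < J - I -> 2 ^ k <= M ->
  exists s' y, [/\ sem (quantc nb) st = s', env s' /\ (forall x, (x < 40) || (62 < x) -> s' x = st x),
   s' 61 = y, y < 2 ^ k &
   count (fun x => phi x %% 2 ^ k < y) (slice I J sq) <= idx <
   count (fun x => phi x %% 2 ^ k <= y) (slice I J sq)].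
Proof.
move=> he hnb h50 h51 h52 h60 hIJ hsq hO hseg hidx hk.
pose st1 := upd st 61 0.
have E1 : env st1 by apply: env_upd.
have hV : (0 + 1) * 2 ^ k <= M by rewrite add0n mul1n.
have [s' [y [q1 q2 q3 q4 q5]]] :=
  @quant_iter T phi k sq st1 I J O idx 0 E1 h50 h51 h52 h60 erefl hIJ hsq hO hseg hidx hV.
have e : sem (quantc nb) st = s'.
  rewrite -q1 /quantc (semSeq _ _ (Asn _ _)) semAsn evCst; last by clear -hM; lia.
  by rewrite semRep hnb.
exists s', y; split=> //; last by rewrite q4.
split; first by rewrite -e; apply: env_sem.
by move=> x hx; rewrite -e; apply: sem_frame; rewrite !inE; clear -hx; lia.
Qed.

End WaveletProg.

(** * Searching the wavelet matrix *)

Section Selection.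
Variables (T : eqType) (rm : T -> nat) (L : seq T).

Lemma count_exact y : count (fun x => rm x <= y) L =
  count (fun x => rm x < y) L + count (fun x => rm x == y) L.
Proof. by elim: L => //= x s ->; lia. Qed.

Lemma count_mem_lt (p q : pred T) x : subpred p q -> x \in L -> q x -> ~~ p x ->
  count p L < count q L.
Proof.
move=> pq xL qx px; rewrite (count_split p q) -[X in X < _]add0n.
have -> : count (fun z => q z && p z) L = count p L.
  by apply: eq_count => z; case E: (p z); rewrite ?andbF ?andbT // (pq _ E).
by rewrite ltn_add2r -has_count; apply/hasP; exists x => //; rewrite qx px.
Qed.

Lemma select_mem y i : count (fun x => rm x < y) L <= i < count (fun x => rm x <= y) L ->
  exists2 x, x \in L & rm x = y.
Proof.
move=> /andP[h1 h2]; have : 0 < count (fun x => rm x == y) L.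
  by move: h2; rewrite count_exact; lia.
by rewrite -has_count => /hasP[x xL /eqP e]; exists x.
Qed.

(** With the number of keys below [t] as index, selection skips exactly these keys, so it hits the
    least of the others. *)
Lemma select_succ y t : 
  count (fun x => rm x < y) L <= count (fun x => rm x < t) L < count (fun x => rm x <= y) L ->
  t <= y /\ forall x, x \in L -> t <= rm x -> y <= rm x.
Proof.
move=> /andP[h1 h2]; split.
  rewrite leqNgt; apply/negP => yt; move: h2; rewrite ltnNge => /negP; apply.
  by apply: sub_count => x /= hx; apply: leq_ltn_trans hx yt.
move=> x xL tx; rewrite leqNgt; apply/negP => xy; move: h1; rewrite leqNgt => /negP; apply.
apply: (@count_mem_lt _ _ x) => //; last by rewrite -leqNgt.
by move=> z /= hz; apply: leq_trans hz (leq_trans tx (ltnW xy)).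
Qed.

Lemma select_pred y t i : count (fun x => rm x < t) L = i.+1 ->
  count (fun x => rm x < y) L <= i < count (fun x => rm x <= y) L ->
  y < t /\ forall x, x \in L -> rm x < t -> rm x <= y.
Proof.
move=> e /andP[h1 h2]; split.
  rewrite ltnNge; apply/negP => ty; move: h1; rewrite leqNgt => /negP; apply.
  rewrite -e; apply: sub_count => x /= hx; exact: leq_trans hx ty.
move=> x xL xt; rewrite leqNgt; apply/negP => yx; move: h2; rewrite -e leqNgt => /negP; apply.
apply: (@count_mem_lt _ _ x) => //; last by rewrite -ltnNge.
by move=> z /= hz; apply: leq_ltn_trans hz (ltn_trans yx xt).
Qed.

Variables (dir : bool) (t : nat).

(** The bound [t] is exclusive for predecessors and inclusive for successors, so that the count of
    keys below [t] serves both directions. *)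
Definition eligible v := if dir then v < t else t <= v.
Definition better v v' := if dir then v' <= v else v <= v'.

(** Characterises an optimum over a set instead of computing it, so that results can be merged as
    the set of searched points grows. *)
Definition best_of (cur : option nat) (P : T -> bool) : Prop :=
  match cur with
  | None => forall x, P x -> ~~ eligible (rm x)
  | Some y => (exists2 x, P x & rm x = y) /\ eligible y /\
              forall x, P x -> eligible (rm x) -> better y (rm x)
  end.

Lemma best_of_ext cur P P' : P =1 P' -> best_of cur P -> best_of cur P'.
Proof.
case: cur => [y|] e /=.
  case=> [[x Px e1] [h1 h2]]; split; first by exists x => //; rewrite -e.
  by split=> // z; rewrite -e; apply: h2.
by move=> h x; rewrite -e; apply: h.
Qed.

Definition merge_best (c1 c2 : option nat) : option nat :=
  match c1, c2 with
  | None, _ => c2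
  | _, None => c1
  | Some y, Some z => if (if dir then y < z else z < y) then Some z else Some y
  end.

Lemma best_of_merge c1 c2 P1 P2 : best_of c1 P1 -> best_of c2 P2 ->
  best_of (merge_best c1 c2) (fun x => P1 x || P2 x).
Proof.
case: c1 => [y|]; case: c2 => [z|] /=.
- move=> [[x1 h1 e1] [o1 b1]] [[x2 h2 e2] [o2 b2]]; case: ifP => yz.
  + split; first by exists x2; rewrite ?h2 ?orbT.
    split=> // x /orP[hx|hx] ok; last exact: b2.
    have := b1 x hx ok; rewrite /better; case: dir yz; lia.
  + split; first by exists x1; rewrite ?h1.
    split=> // x /orP[hx|hx] ok; first exact: b1.
    have := b2 x hx ok; rewrite /better; case: dir yz; lia.
- move=> [[x1 h1 e1] [o1 b1]] n2; split; first by exists x1; rewrite ?h1.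
  by split=> // x /orP[hx|hx] ok; [exact: b1|rewrite (negPf (n2 x hx)) in ok].
- move=> n1 [[x2 h2 e2] [o2 b2]]; split; first by exists x2; rewrite ?h2 ?orbT.
  by split=> // x /orP[hx|hx] ok; [rewrite (negPf (n1 x hx)) in ok|exact: b2].
- by move=> n1 n2 x /orP[/n1|/n2].
Qed.

(** Both directions become selections: index [s] for a successor, [s - 1] for a predecessor. *)
Lemma best_of_select y i : let s := count (fun x => rm x < t) L in
  (if dir then s = i.+1 else s = i) ->
  count (fun x => rm x < y) L <= i < count (fun x => rm x <= y) L ->
  best_of (Some y) (fun x => x \in L).
Proof.
move=> s e h; split; first exact: select_mem h.
rewrite /eligible /better; case: dir e => e; first exact: select_pred e h.
by apply: select_succ; rewrite -/s e.
Qed.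

Lemma best_of_none : let s := count (fun x => rm x < t) L in
  (if dir then s = 0 else s = size L) -> best_of None (fun x => x \in L).
Proof.
move=> s e x xL; rewrite /eligible; case: dir e => e.
  apply/negP => h; have : 0 < s by rewrite /s -has_count; apply/hasP; exists x.
  by rewrite e.
rewrite -ltnNge; move/eqP: e; rewrite -all_count => /allP; exact.
Qed.

End Selection.

(* Registers: 63, 64 column interval; 70 is 1 for predecessor; 71 is 1 while the
   remainder bound 77 applies; 72 class, occupying 73, 74; 75, 76 whether a
   remainder was found and which; 78, 79 exclusive row bounds, shifted by 1;
   80 the path followed, at interval 81, 82 and offset 83; 85 offset of the
   remainder matrix; 86 sibling examined, at interval 87, 88. *)
Definition walkAt (eI eJ eO ek nb : expr) :=
  50 ::= eI;; 51 ::= eJ;; 52 ::= eO;; 53 ::= #0;; 54 ::= ek;; walkc nb.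

Definition classIv := walkAt $63 $64 #0 $72 $21;; 73 ::= $50;; 74 ::= $51.

(** Without the remainder bound the count is the one for threshold [2 ^ r] or 0, so that the
    selection returns the largest or the smallest remainder of the node. *)
Definition node_count :=
  If $71 (walkAt $87 $88 $85 $77 $23;; 89 ::= $53)
         (If $70 (89 ::= $88 - $87) (89 ::= #0)).

Definition keep_best :=
  If $75 (If $70 (If ($76 < $61) (76 ::= $61) Skip) (If ($61 < $76) (76 ::= $61) Skip))
         (76 ::= $61;; 75 ::= #1).

(** For a predecessor with count 0 the index wraps to the largest word; for a successor with full
    count it equals the size of the node. One comparison rejects both. *)
Definition node_proc :=
  87 ::= $50;; 88 ::= $51;; node_count;; 60 ::= $89 - $70;;
  If ($60 < $88 - $87)
     (50 ::= $87;; 51 ::= $88;; 52 ::= $85;; quantc $23;; keep_best)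
     Skip.

Definition digit_body :=
  If ($78 >>> $84 < $86)
     (If ($86 < $79 >>> $84) (walkAt $81 $82 $83 $86 $21;; node_proc) Skip) Skip;;
  86 ::= $86 + #1.

(** Register 86 starts at the first child of the node on the path and the loop meets all [2 ^ g]
    children; [digit_body] searches only those strictly between the prefixes of the two bounds. *)
Definition level_body :=
  84 ::= $84 - $21;; 86 ::= ($80 >>> ($84 + $21)) <<< $21;;
  Rep (#1 <<< $21) digit_body;;
  walkAt $81 $82 $83 ($80 >>> $84) $21;;
  81 ::= $50;; 82 ::= $51;; 83 ::= $52;; 85 ::= $85 + $23 * $0.

Definition search_path (p : expr) :=
  80 ::= p;; 81 ::= $73;; 82 ::= $74;; 83 ::= $21 * $0;; 84 ::= $36;;
  85 ::= ($21 + $36) * $0;; Rep $22 level_body.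

Definition search := 75 ::= #0;; 76 ::= #0;; search_path $78;; search_path $79.

(** Within the class, compares the number of rows below the upper bound with the number of rows up
    to the lower one. Two counts suffice, so testing a class costs only [O(K g)] steps, with no
    search of siblings. *)
Definition nonempty :=
  walkAt $73 $74 ($21 * $0) $79 $36;; 91 ::= $53;;
  walkAt $73 $74 ($21 * $0) ($78 + #1) $36;; 93 ::= $53 < $91.

Definition rep (st : state) (cur : option nat) : Prop :=
  if cur is Some y then st 75 = 1 /\ st 76 = y else st 75 = 0.

Section SearchProg.
Variables (b n : nat) (me : nat -> nat) (B : seq bool) (s0 : state).
Local Notation M := (2 ^ b).
Local Notation sem := (sem b me).
Local Notation ev e s := (eval b me e s).
Local Notation env := (env s0).
Hypothesis rank_ok : forall st p, env st -> st 40 = p -> p <= size B ->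
  sem rankc st 41 = rank B p.
Hypotheses (hn : s0 0 = n) (hBM : size B < M) (hM : 4 < M) (hnB : n <= size B).

Variables (T : eqType) (pts : seq T) (cl yy rm : T -> nat) (g K r : nat).
Local Notation LL := (K * g).
Hypotheses (p21 : s0 21 = g) (p22 : s0 22 = K) (p23 : s0 23 = r) (p36 : s0 36 = LL).
Hypothesis (size_pts : size pts = n).
Hypotheses (cl_lt : forall x, cl x < 2 ^ g) (yy_lt : forall x, yy x < 2 ^ LL)
  (rm_lt : forall x, rm x < 2 ^ r).

Definition class_order := after (digits cl g) pts.
(** The quotient [yy x %/ 2 ^ (LL - k * g)] is the prefix of [k] digits of the row, so this is the
    order reached in the row matrix after [k] super-levels. *)
Definition level_order k := after (digits (fun x => yy x %/ 2 ^ (LL - k * g)) (k * g)) class_order.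

Hypothesis seg1 : take (g * n) (drop 0 B) = bitmaps (digits cl g) pts.
Hypothesis seg2 : take (LL * n) (drop (g * n) B) = bitmaps (digits yy LL) class_order.
Hypothesis seg3 : forall k, k < K ->
  take (r * n) (drop ((g + LL) * n + k * (r * n)) B) = bitmaps (digits rm r) (level_order k.+1).
Hypothesis sizeB : (g + LL) * n + K * (r * n) = size B.

Lemma size_class_order : size class_order = n. Proof. by rewrite size_after. Qed.
Lemma size_level_order k : size (level_order k) = n. Proof. by rewrite size_after size_class_order. Qed.
Lemma level_order0 : level_order 0 = class_order. Proof. by rewrite /level_order mul0n. Qed.

Lemma digits_level k : k < K -> digits (fun x => yy x %/ 2 ^ (LL - k.+1 * g)) (k.+1 * g) =
  digits (fun x => yy x %/ 2 ^ (LL - k * g)) (k * g) ++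
  digits (fun x => yy x %/ 2 ^ (LL - k.+1 * g)) g.
Proof.
move=> hk; rewrite {2}mulSn addnC digitsD; congr (digits _ _ ++ _).
apply: functional_extensionality => x; rewrite -divnMA -expnD; congr (_ %/ 2 ^ _).
by have := leq_mul hk (leqnn g); rewrite mulSn; clear; lia.
Qed.

Lemma level_orderS k : k < K ->
  level_order k.+1 = after (digits (fun x => yy x %/ 2 ^ (LL - k.+1 * g)) g) (level_order k).
Proof. by move=> hk; rewrite /level_order digits_level // after_cat. Qed.

Lemma seg_level k : k < K ->
  take (g * n) (drop (g * n + k * (g * n)) B) =
  bitmaps (digits (fun x => yy x %/ 2 ^ (LL - k.+1 * g)) g) (level_order k).
Proof.
move=> hk; have hle := leq_mul hk (leqnn g).
have e : digits yy LL = (digits (fun x => yy x %/ 2 ^ (LL - k * g)) (k * g) ++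
    digits (fun x => yy x %/ 2 ^ (LL - k.+1 * g)) g) ++ digits yy (LL - k.+1 * g).
  by rewrite -digits_level // -digitsD subnKC.
have := seg2; rewrite e !bitmaps_cat => e2.
have := congr1 (fun s => take (g * n) (drop (k * (g * n)) s)) e2.
rewrite /= -catA drop_size_cat; last first.
  by rewrite size_bitmaps size_digits size_class_order mulnA.
rewrite take_size_cat; last by rewrite size_bitmaps size_digits size_level_order.
rewrite /level_order => <-.
have -> : LL * n = (LL * n - k * (g * n)) + k * (g * n).
  by rewrite subnK // mulnA leq_mul2r leq_mul2r (ltnW hk) !orbT.
rewrite -take_drop take_takel ?drop_drop; first by rewrite [k * _ + _]addnC.
by rewrite mulnA -mulnBl leq_mul2r; apply/orP; right; move: hle; rewrite mulSn; clear; lia.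
Qed.

Variable (sb : state).
Definition fixedr : seq nat := [:: 63; 64; 70; 71; 72; 73; 74; 77; 78; 79].
Definition senv (st : state) := forall i, (i < 40) || (i \in fixedr) -> st i = sb i.
Hypothesis sb_env : env sb.

Lemma senv_env st : senv st -> env st.
Proof. by move=> h i hi; rewrite h ?hi // sb_env. Qed.

Lemma senv_sem c st : all (fun x => (40 <= x) && (x \notin fixedr)) (mods c) ->
  senv st -> senv (sem c st).
Proof.
move=> h he i hi; rewrite sem_frame ?he //.
apply/negP => /(allP h); rewrite leqNgt => /andP[h1 h2].
by rewrite (negPf h1) (negPf h2) in hi.
Qed.

Lemma senv_upd st x v : senv st -> (40 <= x) && (x \notin fixedr) -> senv (upd st x v).
Proof.
move=> h /andP[h1 h2] i hi; rewrite updE ifN ?h //.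
by apply: contraL hi => /eqP->; rewrite ltnNge h1 (negPf h2).
Qed.

Lemma senv_frame st s' : senv st -> env s' ->
  (forall x, (x < 40) || (62 < x) -> s' x = st x) -> senv s'.
Proof.
move=> h e f i hi; rewrite f ?h //.
case/orP: hi => [->//|]; rewrite !inE; clear; lia.
Qed.

Lemma walkAtP (U : Type) (phi : U -> nat) eI eJ eO ek nb k sq st I J O key :
  env st -> ev eI st = I -> ev eJ (upd st 50 I) = J -> ev eO (upd (upd st 50 I) 51 J) = O ->
  ev ek (upd (upd (upd (upd st 50 I) 51 J) 52 O) 53 0) = key ->
  ev nb (upd (upd (upd (upd (upd st 50 I) 51 J) 52 O) 53 0) 54 key) = k ->
  I <= J <= n -> size sq = n -> O + k * n <= size B ->
  take (k * n) (drop O B) = bitmaps (digits phi k) sq -> key < M -> k < M ->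
  exists I' J' s', [/\ sem (walkAt eI eJ eO ek nb) st = s',
   env s' /\ (forall x, (x < 40) || (59 < x) -> s' x = st x),
   s' 50 = I', s' 51 = J' & [/\ I' <= J' <= n,
   slice I' J' (after (digits phi k) sq) =
     [seq x <- slice I J sq | phi x %% 2 ^ k == key %% 2 ^ k],
   s' 53 = count (fun x => phi x %% 2 ^ k < key %% 2 ^ k) (slice I J sq) &
   s' 52 = O + k * n]].
Proof.
move=> he hI hJ hO hk hnb hIJ hsq hOB hseg hkey hkM.
set st5 := upd _ 54 key in hnb.
have E5 : env st5 by do !apply: env_upd.
have hS : 0 + (J - I) < M.
  by rewrite add0n; apply: leq_ltn_trans hBM; clear -hIJ hnB; lia.
have [I' [J' [s' [q1 [q2 q3] q4 q5 [q6 q7 q8 q9]]]]] :=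
  @walkcP b n me B s0 rank_ok hn hBM hM hnB U phi nb k sq st5 I J O 0 key
  E5 hnb erefl erefl erefl erefl erefl hIJ hsq hOB hseg hS hkey hkM.
exists I', J', s'; split=> //; last first.
  split=> // x hx; rewrite q3 // /st5 !updE.
  by do !(rewrite ifN; last by clear -hx; lia).
rewrite -q1 /walkAt (semSeq _ _ (Asn 50 _)) (semAsn _ _ 50) hI.
rewrite (semSeq _ _ (Asn 51 _)) (semAsn _ _ 51) hJ.
rewrite (semSeq _ _ (Asn 52 _)) (semAsn _ _ 52) hO.
rewrite (semSeq _ _ (Asn 53 _)) (semAsn _ _ 53) evCst; last by clear -hM; lia.
by rewrite (semSeq _ _ (Asn 54 _)) (semAsn _ _ 54) hk.
Qed.

Variables (dir first : bool) (rho A Bq CI CJ : nat) (CL : seq T).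
Hypotheses (f70 : sb 70 = dir) (f71 : sb 71 = first) (f73 : sb 73 = CI) (f74 : sb 74 = CJ)
  (f77 : sb 77 = rho) (f78 : sb 78 = A) (f79 : sb 79 = Bq).
Hypotheses (hC : CI <= CJ <= n) (hCL : slice CI CJ class_order = CL).
Hypotheses (rho_lt : rho < 2 ^ r) (A_lt : A < 2 ^ LL) (Bq_lt : Bq < 2 ^ LL)
  (AM : A + 2 * 2 ^ g < M) (BM : Bq + 2 * 2 ^ g < M) (rM : 2 ^ r < M) (LM : LL < M)
  (gM : 2 ^ g < M).

Definition thr := if first then rho else if dir then 2 ^ r else 0.
Local Notation best_of := (best_of rm dir thr).

Lemma exp_lt k : k < 2 ^ k. Proof. exact: ltn_expl. Qed.
Lemma gltM : g < M. Proof. exact: leq_trans (exp_lt g) (ltnW gM). Qed.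
Lemma rltM : r < M. Proof. exact: leq_trans (exp_lt r) (ltnW rM). Qed.

Lemma keep_bestP st cur y : senv st -> rep st cur -> st 61 = y ->
  exists s', [/\ sem keep_best st = s', senv s', rep s' (merge_best dir cur (Some y)) &
   forall x, (x != 75) && (x != 76) -> s' x = st x].
Proof.
move=> he hr h61; exists (sem keep_best st).
have d70 : ev $70 st = dir by rewrite /= he.
have h1 : 1 < M by apply: leq_trans hM.
have hbool (c : bool) : c < M by case: c => //; apply: ltnW.
split=> //; first exact: senv_sem.
  rewrite /keep_best semIf; case: cur hr => [z|] /= => [[h75 h76]|h75].
    rewrite h75 /= he // f70.
    have e1 : opval M OLt (st 76) (st 61) = (z < y) by rewrite h76 h61 /opval modn_small ?hbool.
    have e2 : opval M OLt (st 61) (st 76) = (y < z) by rewrite h76 h61 /opval modn_small ?hbool.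
    case: (dir) => /=; rewrite ?e1 ?e2; [case: (z < y)|case: (y < z)];
      by rewrite /rep /= ?updE /= ?h75 ?h61 ?h76.
  by rewrite h75 /= !updE /= modn_small.
move=> x /andP[h2 h3]; apply: sem_frame; rewrite /= !inE; clear -h2 h3; lia.
Qed.

Lemma node_procP st k NI NJ cur :
  k < K -> senv st -> st 50 = NI -> st 51 = NJ -> st 85 = (g + LL) * n + k * (r * n) ->
  NI <= NJ <= n -> rep st cur ->
  exists s' c2, [/\ sem node_proc st = s', senv s', rep s' (merge_best dir cur c2),
   best_of c2 (fun x => x \in slice NI NJ (level_order k.+1)) &
   forall x, x \in [:: 80; 81; 82; 83; 84; 85; 86] -> s' x = st x].
Proof.
move=> hk he h50 h51 h85 hN hr.
set L := slice NI NJ (level_order k.+1).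
have sL : size L = NJ - NI by rewrite size_slice // size_level_order.
have hO : (g + LL) * n + k * (r * n) + r * n <= size B.
  by rewrite -sizeB -addnA leq_add2l [_ + r * n]addnC -mulSn leq_mul2r hk orbT.
have NM x : x <= n -> x < M by move=> h; apply: leq_ltn_trans hBM; apply: leq_trans hnB.
have h1M : 1 < M by apply: leq_trans hM.
have /andP[N1 N2] := hN.
pose st2 := upd (upd st 87 NI) 88 NJ.
have E2 : senv st2 by apply: senv_upd => //; apply: senv_upd.
have d70 s : senv s -> ev $70 s = dir by move=> h; rewrite /= h.
have d71 s : senv s -> ev $71 s = first by move=> h; rewrite /= h.
have [s3 [q3 E3 h89 F3]] : exists s3, [/\ sem node_count st2 = s3, senv s3,
    s3 89 = count (fun x => rm x < thr) L &
    forall x, (x \in [:: 75; 76; 80; 81; 82; 83; 84; 85; 86; 87; 88]) -> s3 x = st2 x].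
  rewrite /node_count semIf d71 // /thr; case: (first); last first.
    rewrite semIf d70 //; case: (dir) => /=.
      exists (upd st2 89 (NJ - NI)); split.
      - rewrite -[(NJ - NI)](@evSub b me st2 $88 $87 NJ NI) //; exact: NM.
      - exact: senv_upd.
      - rewrite updE /= -sL; symmetry; apply/eqP; rewrite -all_count; apply/allP => x _.
        exact: rm_lt.
      - by move=> x hx; rewrite updE ifN //; move: hx; rewrite !inE; clear; lia.
    exists (upd st2 89 0); split.
    - by rewrite mod0n.
    - exact: senv_upd.
    - by rewrite updE /= (eq_count (a2 := pred0)) ?count_pred0.
    - by move=> x hx; rewrite updE ifN //; move: hx; rewrite !inE; clear; lia.
  rewrite (_ : (nat_of_bool true == 0) = false) //.
  have e77 : ev $77 (upd (upd (upd (upd st2 50 NI) 51 NJ) 52 ((g + LL) * n + k * (r * n))) 53 0) = rho.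
    by rewrite /= !updE /= E2.
  have e23 : ev $23 (upd (upd (upd (upd (upd st2 50 NI) 51 NJ) 52 ((g + LL) * n + k * (r * n))) 53 0) 54 rho) = r.
    by rewrite /= !updE /= E2 // sb_env.
  have e85 : ev $85 (upd (upd st2 50 NI) 51 NJ) = (g + LL) * n + k * (r * n).
    by rewrite /= !updE.
  have [I' [J' [s' [q1 [q2 q4] _ _ [_ _ q7 _]]]]] := walkAtP (senv_env E2) (erefl : ev $87 st2 = NI)
    (erefl : ev $88 (upd st2 50 NI) = NJ) e85 e77 e23 hN (size_level_order k.+1) hO (seg3 hk)
    (ltn_trans rho_lt rM) rltM.
  exists (upd s' 89 (s' 53)); split.
  - by rewrite (semSeq _ _ (walkAt _ _ _ _ _)) q1.
  - apply: senv_upd => //; apply: (senv_frame E2) => // x hx.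
    by apply: q4; clear -hx; lia.
  - rewrite updE /= q7; apply: eq_count => x.
    by rewrite !modn_small.
  - move=> x hx; rewrite updE ifN; last by move: hx; rewrite !inE; clear; lia.
    by apply: q4; move: hx; rewrite !inE; clear; lia.
set s := count (fun x => rm x < thr) L in h89.
have sle : s <= size L by apply: count_size.
have sM : s < M by apply: NM; rewrite sL in sle; clear -sle N2; lia.
have e60 : ev ($89 - $70) s3 = if dir then (if s == 0 then M.-1 else s.-1) else s.
  rewrite /= h89 E3 // f70; case: (dir) => /=; rewrite /opval.
    rewrite (@modn_small 1) //; case: eqP => [->|/eqP s0'].
      by rewrite add0n subn1 modn_small // prednK // ltnW.
    have -> : s + (M - 1) = M + s.-1 by clear -s0' h1M; lia.
    by rewrite modnDl modn_small //; clear -sM; lia.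
  by rewrite mod0n subn0 addnC modnDl modn_small.
set idx := ev ($89 - $70) s3 in e60.
pose s4 := upd s3 60 idx.
have E4 : senv s4 by apply: senv_upd.
have h87 : s4 87 = NI by rewrite /s4 updE /= F3.
have h88 : s4 88 = NJ by rewrite /s4 updE /= F3.
have cnd : ev ($60 < $88 - $87) s4 = (idx < NJ - NI).
  apply: evLt => //; apply: evSub => //; exact: NM.
have r4 : rep s4 cur.
  by move: hr; rewrite /rep /s4 !updE /= !F3 // /st2 !updE.
have body : sem node_proc st = if idx < NJ - NI then
    sem (50 ::= $87;; 51 ::= $88;; 52 ::= $85;; quantc $23;; keep_best) s4 else s4.
  rewrite /node_proc (semSeq _ _ (Asn 87 _)) (semAsn _ _ 87) [ev $50 st]h50.
  rewrite (semSeq _ _ (Asn 88 _)) (semAsn _ _ 88).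
  rewrite [ev $51 _](_ : _ = NJ); last by rewrite /= updE.
  rewrite -/st2 (semSeq _ _ node_count) q3 (semSeq _ _ (Asn 60 _)) (semAsn _ _ 60) -/idx -/s4.
  by rewrite semIf cnd; case: (idx < NJ - NI).
rewrite body; case: ifP => hidx; last first.
  exists s4, None; split=> //.
  - by case: (cur) r4.
  - apply: best_of_none; rewrite -/s sL; move: hidx; rewrite e60; case: (dir).
      case: eqP => // /eqP s0'; move=> h; exfalso; move: h sle; rewrite sL; clear -s0'; lia.
    by move=> h; move: h sle; rewrite sL; clear; lia.
  - move=> x hx; rewrite /s4 updE ifN; last by move: hx; rewrite !inE; clear; lia.
    rewrite F3; last by move: hx; rewrite !inE; clear; lia.
    rewrite /st2 !updE; do !(rewrite ifN; last by move: hx; rewrite !inE; clear; lia).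
    by [].
have h85' : s4 85 = (g + LL) * n + k * (r * n) by rewrite /s4 updE /= F3.
pose s5 := upd (upd (upd s4 50 NI) 51 NJ) 52 ((g + LL) * n + k * (r * n)).
have E5 : senv s5 by do !apply: senv_upd.
have e23 : ev $23 (upd s5 61 0) = r by rewrite /= /s5 !updE /= E4 // sb_env.
have [s6 [y [q6 [e6 F6] h61 ylt hsel]]] := @quantcP b n me B s0 rank_ok hn hBM hM hnB T rm $23 r
   (level_order k.+1) s5 NI NJ ((g + LL) * n + k * (r * n)) idx (senv_env E5) e23
   erefl erefl erefl erefl hN (size_level_order _) hO (seg3 hk) hidx (ltnW rM).
have E6 : senv s6 by apply: (senv_frame E5).
have r6 : rep s6 cur.
  by move: r4; rewrite /rep !F6 // /s5 !updE.
have [s7 [q7 E7 r7 F7]] := keep_bestP E6 r6 h61.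
exists s7, (Some y); split=> //.
- rewrite (semSeq _ _ (Asn 50 _)) (semAsn _ _ 50) [ev $87 s4]h87.
  rewrite (semSeq _ _ (Asn 51 _)) (semAsn _ _ 51) [ev $88 _](_ : _ = NJ); last by rewrite /= updE.
  rewrite (semSeq _ _ (Asn 52 _)) (semAsn _ _ 52).
  rewrite [ev $85 _](_ : _ = (g + LL) * n + k * (r * n)); last by rewrite /= !updE.
  by rewrite -/s5 (semSeq _ _ (quantc _)) q6.
- apply: (@best_of_select _ _ _ _ _ _ idx).
    rewrite -/s; move: hidx; rewrite e60; case: (dir) => //.
    (* For count 0 the wrapped index [M - 1] contradicts [hidx], since [n < M]. *)
    case: eqP => [s0'|/eqP s0' _]; last by rewrite prednK // lt0n.
    move=> h; exfalso; move: h; clear -N2 NM; have := NM n (leqnn n); lia.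
  have em : (fun x => rm x %% 2 ^ r) =1 rm by move=> x; rewrite modn_small.
  have c1 : count (fun x => rm x %% 2 ^ r < y) L = count (fun x => rm x < y) L.
    by apply: eq_count => x; rewrite /= em.
  have c2 : count (fun x => rm x %% 2 ^ r <= y) L = count (fun x => rm x <= y) L.
    by apply: eq_count => x; rewrite /= em.
  by move: hsel; rewrite -/L c1 c2.
- move=> x hx; rewrite F7; last by move: hx; rewrite !inE; clear; lia.
  rewrite F6; last by move: hx; rewrite !inE; clear; lia.
  rewrite /s5 /s4 !updE; do 4!(rewrite ifN; last by move: hx; rewrite !inE; clear; lia).
  rewrite F3; last by move: hx; rewrite !inE; clear; lia.
  rewrite /st2 !updE; do !(rewrite ifN; last by move: hx; rewrite !inE; clear; lia).
  by [].
Qed.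

Definition node (sh D : nat) (x : T) : bool :=
  [&& x \in CL, yy x %/ 2 ^ sh == D, A %/ 2 ^ sh < D & D < Bq %/ 2 ^ sh].

Lemma level_shift k : k < K -> LL - k * g = LL - k.+1 * g + g.
Proof. by move=> hk; have := leq_mul hk (leqnn g); rewrite mulSn; clear; lia. Qed.

Lemma shr_level x k : k < K ->
  x %/ 2 ^ (LL - k * g) = x %/ 2 ^ (LL - k.+1 * g) %/ 2 ^ g.
Proof. by move=> hk; rewrite level_shift // expnD divnMA. Qed.

Lemma digit_bodyP st k P PI PJ D cur : k < K -> senv st ->
  st 81 = PI -> st 82 = PJ -> st 83 = g * n + k * (g * n) -> st 84 = LL - k.+1 * g ->
  st 85 = (g + LL) * n + k * (r * n) -> st 86 = D -> D.+1 < M ->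
  PI <= PJ <= n -> D %/ 2 ^ g = P %/ 2 ^ (LL - k * g) ->
  slice PI PJ (level_order k) =i [pred x | (x \in CL) && (yy x %/ 2 ^ (LL - k * g) == P %/ 2 ^ (LL - k * g))] ->
  rep st cur ->
  exists s' cur', [/\ sem digit_body st = s', senv s' /\ rep s' cur', s' 86 = D.+1,
   forall Pd, best_of cur Pd -> best_of cur' (fun x => Pd x || node (LL - k.+1 * g) D x) &
   forall x, x \in [:: 80; 81; 82; 83; 84; 85] -> s' x = st x].
Proof.
move=> hk he h81 h82 h83 h84 h85 h86 hD hP hDP hsl hr.
set sh := LL - k.+1 * g in h84 *.
have h1M : 1 < M by apply: leq_trans hM.
have [s1 [cur' [q1 E1 r1 B1 F1]]] : exists s1 cur', [/\ sem (If ($78 >>> $84 < $86)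
     (If ($86 < $79 >>> $84) (walkAt $81 $82 $83 $86 $21;; node_proc) Skip) Skip) st = s1,
     senv s1, rep s1 cur',
     forall Pd, best_of cur Pd -> best_of cur' (fun x => Pd x || node sh D x) &
     forall x, x \in [:: 80; 81; 82; 83; 84; 85; 86] -> s1 x = st x].
  have c1 : ev ($78 >>> $84 < $86) st = (A %/ 2 ^ sh < D).
    apply: evLt => //; apply: evShr => //; first by rewrite /= he.
    by apply: leq_ltn_trans AM; apply: leq_addr.
  have c2 : ev ($86 < $79 >>> $84) st = (D < Bq %/ 2 ^ sh).
    apply: evLt => //; apply: evShr => //; first by rewrite /= he.
    by apply: leq_ltn_trans BM; apply: leq_addr.
  have skip : ~~ ((A %/ 2 ^ sh < D) && (D < Bq %/ 2 ^ sh)) -> exists s1 cur', [/\ st = s1,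
     senv s1, rep s1 cur',
     forall Pd, best_of cur Pd -> best_of cur' (fun x => Pd x || node sh D x) &
     forall x, x \in [:: 80; 81; 82; 83; 84; 85; 86] -> s1 x = st x].
    move=> h; exists st, cur; split=> // Pd; apply: best_of_ext => x.
    by rewrite /node (negPf h) !andbF orbF.
  rewrite semIf c1; case C1: (A %/ 2 ^ sh < D); last by apply: skip; rewrite C1.
  rewrite (_ : (nat_of_bool true == 0) = false) // semIf c2.
  case C2: (D < Bq %/ 2 ^ sh); last by apply: skip; rewrite C2 andbF.
  rewrite (_ : (nat_of_bool true == 0) = false) //.
  have e83 : ev $83 (upd (upd st 50 PI) 51 PJ) = g * n + k * (g * n) by rewrite /= !updE.
  have e86 : ev $86 (upd (upd (upd (upd st 50 PI) 51 PJ) 52 (g * n + k * (g * n))) 53 0) = D.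
    by rewrite /= !updE.
  have e21 : ev $21 (upd (upd (upd (upd (upd st 50 PI) 51 PJ) 52 (g * n + k * (g * n))) 53 0) 54 D) = g.
    by rewrite /= !updE /= he // sb_env.
  have hO : g * n + k * (g * n) + g * n <= size B.
    rewrite -sizeB -addnA [k * _ + _]addnC -mulSn mulnDl -addnA leq_add2l.
    by apply: leq_trans (leq_addr _ _); rewrite -mulnA leq_mul2r hk orbT.
  have [NI [NJ [s2 [q2 [e2 F2] n50 n51 [hN hsl2 _ _]]]]] := walkAtP (senv_env he) (h81 : ev $81 st = PI)
    (h82 : ev $82 (upd st 50 PI) = PJ) e83 e86 e21 hP (size_level_order k) hO (seg_level hk)
    (ltnW hD) gltM.
  have E2 : senv s2.
    by apply: (senv_frame he) => // x hx; apply: F2; clear -hx; lia.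
  have h85' : s2 85 = (g + LL) * n + k * (r * n) by rewrite F2.
  have r2 : rep s2 cur by move: hr; rewrite /rep !F2.
  have [s3 [c2' [q3 E3 r3 B3 F3]]] := node_procP hk E2 n50 n51 h85' hN r2.
  exists s3, (merge_best dir cur c2'); split=> //.
  - by rewrite (semSeq _ _ (walkAt _ _ _ _ _)) q2.
  - move=> Pd h; have := best_of_merge h B3; apply: best_of_ext => x; congr (_ || _).
    rewrite level_orderS // hsl2 mem_filter hsl inE /node C1 C2 !andbT -hDP (shr_level (yy x) hk) -/sh.
    set z := yy x %/ 2 ^ sh; rewrite andbC -andbA; congr (_ && _).
    (* A prefix of [k + 1] digits is determined by its prefix of [k] digits and its last digit. *)
    apply/andP/eqP => [[/eqP ed /eqP em]|->]; last by rewrite !eqxx.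
    by rewrite (divn_eq z (2 ^ g)) (divn_eq D (2 ^ g)) ed em.
  - move=> x hx; rewrite F3 //.
    by apply: F2; move: hx; rewrite !inE; clear; lia.
have e86 : ev ($86 + #1) s1 = D.+1.
  by rewrite -(addn1 D); apply: evAdd; [rewrite /= F1|apply: evCst|rewrite addn1].
exists (upd s1 86 D.+1), cur'; split=> //.
- by rewrite /digit_body (semSeq _ _ (If _ _ _)) q1 semAsn e86.
- by split; first exact: senv_upd.
- move=> x hx; rewrite updE ifN; last by move: hx; rewrite !inE; clear; lia.
  by apply: F1; move: hx; rewrite !inE; clear; lia.
Qed.

(** For [P] one of the two bounds: the points whose row follows [P] for [k] digits and then turns
    off strictly between the bounds. *)
Definition lev (P k : nat) (x : T) : bool :=
  [&& x \in CL, yy x %/ 2 ^ (LL - k * g) == P %/ 2 ^ (LL - k * g),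
      A %/ 2 ^ (LL - k.+1 * g) < yy x %/ 2 ^ (LL - k.+1 * g) &
      yy x %/ 2 ^ (LL - k.+1 * g) < Bq %/ 2 ^ (LL - k.+1 * g)].

Lemma level_bodyP st k P PI PJ cur : k < K -> senv st -> P + 2 * 2 ^ g < M ->
  st 80 = P -> st 81 = PI -> st 82 = PJ -> st 83 = g * n + k * (g * n) ->
  st 84 = LL - k * g ->
  st 85 = (g + LL) * n + k * (r * n) ->
  PI <= PJ <= n -> 
  slice PI PJ (level_order k) =i [pred x | (x \in CL) && (yy x %/ 2 ^ (LL - k * g) == P %/ 2 ^ (LL - k * g))] ->
  rep st cur ->
  exists s' cur' PI' PJ', [/\ sem level_body st = s', senv s' /\ rep s' cur',
   forall Pd, best_of cur Pd -> best_of cur' (fun x => Pd x || lev P k x),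
   [/\ s' 80 = P, s' 81 = PI', s' 82 = PJ', s' 83 = g * n + k.+1 * (g * n) & s' 84 = LL - k.+1 * g] &
   [/\ s' 85 = (g + LL) * n + k.+1 * (r * n), PI' <= PJ' <= n &
    slice PI' PJ' (level_order k.+1) =i
    [pred x | (x \in CL) && (yy x %/ 2 ^ (LL - k.+1 * g) == P %/ 2 ^ (LL - k.+1 * g))]]].
Proof.
move=> hk he PM h80 h81 h82 h83 h84 h85 hP hsl hr.
set sh := LL - k.+1 * g.
have shg : LL - k * g = sh + g by apply: level_shift.
have h1M : 1 < M by apply: leq_trans hM.
have d21 s : senv s -> ev $21 s = g by move=> h; rewrite /= h // sb_env.
pose base := P %/ 2 ^ (sh + g) * 2 ^ g.
have baseP : base <= P.
  apply: leq_trans (_ : P %/ 2 ^ sh <= _); last exact: leq_div.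
  by rewrite /base expnD divnMA leq_trunc_div.
have shM : sh + g < M by rewrite -shg; apply: leq_ltn_trans (leq_subr _ _) LM.
have e84 : ev ($84 - $21) st = sh.
  rewrite -(addnK g sh) -shg; apply: evSub => //; [exact: d21|by rewrite shg leq_addl|].
  by rewrite shg.
pose s1 := upd st 84 sh.
have E1 : senv s1 by apply: senv_upd.
have e86 : ev (($80 >>> ($84 + $21)) <<< $21) s1 = base.
  apply: evShl; [|exact: d21|by apply: leq_ltn_trans baseP _; clear -PM; lia].
  apply: evShr => //; last by clear -PM; lia.
  by apply: evAdd => //; exact: d21.
pose s2 := upd s1 86 base.
have E2 : senv s2 by apply: senv_upd.
have hsl' := hsl; rewrite shg in hsl'.
have loop d : d <= 2 ^ g -> exists s' cur', [/\ iter d (sem digit_body) s2 = s',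
    senv s' /\ rep s' cur', s' 86 = base + d,
    forall Pd, best_of cur Pd -> best_of cur' (fun x => Pd x ||
       [&& x \in CL, base <= yy x %/ 2 ^ sh, yy x %/ 2 ^ sh < base + d,
           A %/ 2 ^ sh < yy x %/ 2 ^ sh & yy x %/ 2 ^ sh < Bq %/ 2 ^ sh]) &
    forall x, x \in [:: 80; 81; 82; 83; 84; 85] -> s' x = s2 x].
  elim: d => [|d IH] hd.
    exists s2, cur; split=> //; first by rewrite addn0 /s2 updE.
    move=> Pd; apply: best_of_ext => x; rewrite addn0.
    rewrite [X in _ || X](_ : _ = false) ?orbF //; apply/negP => /and5P[_ h1 h2 _ _].
    by clear -h1 h2; lia.
  have [s3 [c3 [q3 [E3 r3] h86 B3 F3]]] := IH (ltnW hd).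
  have DM : (base + d).+1 < M by clear -baseP hd PM; lia.
  have hDP : (base + d) %/ 2 ^ g = P %/ 2 ^ (LL - k * g).
    by rewrite shg /base divnMDl ?expn_gt0 // (divn_small hd) addn0.
  have g81 : s3 81 = PI by rewrite F3.
  have g82 : s3 82 = PJ by rewrite F3.
  have g83 : s3 83 = g * n + k * (g * n) by rewrite F3.
  have g84 : s3 84 = sh by rewrite F3.
  have g85 : s3 85 = (g + LL) * n + k * (r * n) by rewrite F3.
  have [s4 [c4 [q4 [E4 r4] i86 B4 F4]]] :=
    digit_bodyP hk E3 g81 g82 g83 g84 g85 h86 DM hP hDP hsl r3.
  exists s4, c4; split.
  - by rewrite iterS q3.
  - by split.
  - by rewrite i86 addnS.
  - move=> Pd h; have := B4 _ (B3 Pd h); apply: best_of_ext => x; rewrite /node -/sh.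
    rewrite -orbA; congr (_ || _); rewrite -andb_orr; congr (_ && _).
    set z := yy x %/ 2 ^ sh; clear.
    have [->|ne] := eqVneq z (base + d).
      by rewrite leq_addr ltnn addnS ltnSn.
    rewrite orbF; congr (_ && _); congr (_ && _); by rewrite addnS ltnS [RHS]leq_eqVlt (negPf ne).
  - by move=> x hx; rewrite F4 ?F3.
have [s3 [c3 [q3 [E3 r3] h86 B3 F3]]] := loop _ (leqnn _).
have cnt : ev (#1 <<< $21) s2 = 2 ^ g.
  by rewrite -[RHS]mul1n; apply: evShl; [apply: evCst|exact: d21|rewrite mul1n].
have e83 : ev $83 (upd (upd s3 50 PI) 51 PJ) = g * n + k * (g * n) by rewrite /= !updE /= F3.
have i84 : s3 84 = sh by rewrite F3.
have i80 : s3 80 = P by rewrite F3.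
have j81 : s3 81 = PI by rewrite F3.
have j82 : s3 82 = PJ by rewrite F3.
have e80 : ev ($80 >>> $84) (upd (upd (upd (upd s3 50 PI) 51 PJ) 52 (g * n + k * (g * n))) 53 0) = P %/ 2 ^ sh.
  by apply: evShr => //; clear -PM; lia.
have e21 : ev $21 (upd (upd (upd (upd (upd s3 50 PI) 51 PJ) 52 (g * n + k * (g * n))) 53 0) 54 (P %/ 2 ^ sh)) = g.
  by rewrite /= !updE /= E3 // sb_env.
have hO : g * n + k * (g * n) + g * n <= size B.
  rewrite -sizeB -addnA [k * _ + _]addnC -mulSn mulnDl -addnA leq_add2l.
  by apply: leq_trans (leq_addr _ _); rewrite -mulnA leq_mul2r hk orbT.
have hPM : P %/ 2 ^ sh < M by apply: leq_ltn_trans (leq_div _ _) _; clear -PM; lia.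
have [NI [NJ [s4 [q4 [e4 F4] n50 n51 [hN hsl2 _ n52]]]]] := walkAtP (senv_env E3) (j81 : ev $81 s3 = PI)
    (j82 : ev $82 (upd s3 50 PI) = PJ) e83 e80 e21 hP (size_level_order k) hO (seg_level hk) hPM gltM.
pose s5 := upd s4 81 NI.
pose s6 := upd s5 82 NJ.
pose s7 := upd s6 83 (g * n + k.+1 * (g * n)).
have E4 : senv s4 by apply: (senv_frame E3) => // x hx; apply: F4; clear -hx; lia.
have E7 : senv s7 by do !apply: senv_upd.
have krn : k.+1 * (r * n) <= size B.
  by rewrite -sizeB; apply: leq_trans (leq_addl _ _); rewrite leq_mul2r hk orbT.
have e85 : ev ($85 + $23 * $0) s7 = (g + LL) * n + k.+1 * (r * n).
  rewrite mulSn [r * n + _]addnC addnA; apply: evAdd.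
  - by rewrite /= /s7 /s6 /s5 !updE /= F4 // F3.
  - apply: evMul; [by rewrite /= E7 // sb_env|by rewrite /= E7 // sb_env|].
    by apply: leq_ltn_trans hBM; apply: leq_trans krn; rewrite leq_pmull.
  - rewrite -addnA -mulSnr; apply: leq_ltn_trans hBM; rewrite -sizeB leq_add2l.
    by rewrite leq_mul2r hk orbT.
exists (upd s7 85 ((g + LL) * n + k.+1 * (r * n))), c3, NI, NJ; split.
- rewrite /level_body (semSeq _ _ (Asn 84 _)) (semAsn _ _ 84) e84 -/s1.
  rewrite (semSeq _ _ (Asn 86 _)) (semAsn _ _ 86) e86 -/s2.
  rewrite (semSeq _ _ (Rep _ _)) semRep cnt q3.
  rewrite (semSeq _ _ (walkAt _ _ _ _ _)) q4.
  rewrite (semSeq _ _ (Asn 81 _)) (semAsn _ _ 81) [ev $50 s4]n50 -/s5.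
  rewrite (semSeq _ _ (Asn 82 _)) (semAsn _ _ 82) [ev $51 s5]n51 -/s6.
  rewrite (semSeq _ _ (Asn 83 _)) (semAsn _ _ 83).
  rewrite [ev $52 s6](_ : _ = g * n + k.+1 * (g * n)); last first.
    by rewrite /= /s6 /s5 !updE /= n52 -addnA [k * _ + _]addnC -mulSn.
  by rewrite -/s7 (semAsn _ _ 85) e85.
- split; first exact: senv_upd.
  by move: r3; rewrite /rep /s7 /s6 /s5 !updE /= !F4.
- move=> Pd h; have := B3 Pd h; apply: best_of_ext => x; congr (_ || _).
  rewrite /lev -/sh shg; congr (_ && _); rewrite andbA; congr (_ && _).
  rewrite expnD !divnMA; set z := yy x %/ 2 ^ sh; rewrite /base expnD divnMA.
  move: (P %/ 2 ^ sh %/ 2 ^ g) => w.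
  (* The prefixes from [base] up to [base + 2 ^ g] are exactly those with quotient [w] by [2 ^ g],
     that is, the children of the node on the path. *)
  by rewrite addnC -mulSn -leq_divRL ?expn_gt0 // -ltn_divLR ?expn_gt0 // ltnS -eqn_leq eq_sym.
- by split; rewrite /s7 /s6 /s5 !updE /= ?F4 ?F3.
- split=> //.
  move=> x; rewrite level_orderS // hsl2 mem_filter hsl !inE (shr_level (yy x) hk) (shr_level P hk) -/sh.
  set z := yy x %/ 2 ^ sh; set w := P %/ 2 ^ sh.
  rewrite andbC -andbA; congr (_ && _).
  apply/andP/eqP => [[/eqP ed /eqP em]|->]; last by rewrite !eqxx.
  by rewrite (divn_eq z (2 ^ g)) (divn_eq w (2 ^ g)) ed em.
Qed.

Hypothesis n0 : 0 < n.

Lemma search_pathP st p P cur : senv st -> ev p st = P -> P + 2 * 2 ^ g < M -> P < 2 ^ LL ->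
  rep st cur ->
  exists s' cur', [/\ sem (search_path p) st = s', senv s' /\ rep s' cur' &
   forall Pd, best_of cur Pd -> best_of cur' (fun x => Pd x || has (fun k => lev P k x) (iota 0 K))].
Proof.
move=> he hp PM PL hr.
have gn : g * n <= size B by rewrite -sizeB mulnDl -addnA leq_addr.
have gLn : (g + LL) * n <= size B by rewrite -sizeB leq_addr.
have lM x : x <= size B -> x < M by move=> h; apply: leq_ltn_trans hBM.
pose t1 := upd st 80 P; pose t2 := upd t1 81 CI; pose t3 := upd t2 82 CJ.
pose t4 := upd t3 83 (g * n); pose t5 := upd t4 84 LL; pose t6 := upd t5 85 ((g + LL) * n).
have e1 : ev $73 t1 = CI by rewrite /= /t1 updE /= he.
have e2 : ev $74 t2 = CJ by rewrite /= /t2 /t1 !updE /= he.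
have e3 : ev ($21 * $0) t3 = g * n.
  by apply: evMul; [| |exact: lM]; rewrite /= /t3 /t2 /t1 !updE /= he // sb_env.
have e4 : ev $36 t4 = LL by rewrite /= /t4 /t3 /t2 /t1 !updE /= he // sb_env.
have e5 : ev (($21 + $36) * $0) t5 = (g + LL) * n.
  apply: evMul; [apply: evAdd| |exact: lM].
  - by rewrite /= /t5 /t4 /t3 /t2 /t1 !updE /= he // sb_env.
  - by rewrite /= /t5 /t4 /t3 /t2 /t1 !updE /= he // sb_env.
  - by apply: leq_ltn_trans hBM; apply: leq_trans gLn; rewrite leq_pmulr.
  - by rewrite /= /t5 /t4 /t3 /t2 /t1 !updE /= he // sb_env.
have E6 : senv t6 by do !apply: senv_upd.
have e22 : ev $22 t6 = K by rewrite /= E6 // sb_env.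
have r6 : rep t6 cur by move: hr; rewrite /rep /t6 /t5 /t4 /t3 /t2 /t1 !updE.
have loop k : k <= K -> exists s' cur' PI PJ, [/\ iter k (sem level_body) t6 = s',
   senv s' /\ rep s' cur',
   forall Pd, best_of cur Pd -> best_of cur' (fun x => Pd x || has (fun k => lev P k x) (iota 0 k)),
   [/\ s' 80 = P, s' 81 = PI, s' 82 = PJ, s' 83 = g * n + k * (g * n) & s' 84 = LL - k * g] &
   [/\ s' 85 = (g + LL) * n + k * (r * n), PI <= PJ <= n &
    slice PI PJ (level_order k) =i
    [pred x | (x \in CL) && (yy x %/ 2 ^ (LL - k * g) == P %/ 2 ^ (LL - k * g))]]].
  elim: k => [|k IH] hk.
    exists t6, cur, CI, CJ; split=> //.
    - by move=> Pd; apply: best_of_ext => x; rewrite orbF.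
    - by split; rewrite /t6 /t5 /t4 /t3 /t2 /t1 !updE ?mul0n ?addn0 ?subn0.
    - split=> //; first by rewrite mul0n addn0.
      by move=> x; rewrite level_order0 hCL mul0n subn0 !inE !divn_small // andbT.
  have [s3 [c3 [PI [PJ [q3 [E3 r3] B3 [h80 h81 h82 h83 h84] [h85 hPP hsl]]]]]] := IH (ltnW hk).
  have [s4 [c4 [PI' [PJ' [q4 E4 B4 H4 H5]]]]] :=
    level_bodyP hk E3 PM h80 h81 h82 h83 h84 h85 hPP hsl r3.
  exists s4, c4, PI', PJ'; split; [by rewrite iterS q3|exact: E4| |exact: H4|exact: H5].
  move=> Pd h; have := B4 _ (B3 Pd h); apply: best_of_ext => x.
  by rewrite -(addn1 k) iotaD has_cat /= orbF orbA.
have [s3 [c3 [PI [PJ [q3 E3 B3 _ _]]]]] := loop K (leqnn K).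
exists s3, c3; split=> //.
rewrite /search_path (semSeq _ _ (Asn 80 _)) (semAsn _ _ 80) hp -/t1.
rewrite (semSeq _ _ (Asn 81 _)) (semAsn _ _ 81) e1 -/t2.
rewrite (semSeq _ _ (Asn 82 _)) (semAsn _ _ 82) e2 -/t3.
rewrite (semSeq _ _ (Asn 83 _)) (semAsn _ _ 83) e3 -/t4.
rewrite (semSeq _ _ (Asn 84 _)) (semAsn _ _ 84) e4 -/t5.
rewrite (semSeq _ _ (Asn 85 _)) (semAsn _ _ 85) e5 -/t6 semRep.
by rewrite e22; exact: q3.
Qed.

(** A row strictly between the bounds agrees with them on 0 digits and with neither on all [K]
    digits. Where agreement with the last of them is lost, its prefix lies strictly between the
    prefixes of the bounds. *)
Lemma levels_cover x : (has (fun k => lev A k x) (iota 0 K) || has (fun k => lev Bq k x) (iota 0 K))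
  = [&& x \in CL, A < yy x & yy x < Bq].
Proof.
apply/idP/idP.
  have aux P : has (fun k => lev P k x) (iota 0 K) -> [&& x \in CL, A < yy x & yy x < Bq].
    case/hasP => k _ /and4P[-> _ h1 h2] /=; apply/andP; split.
      by rewrite ltnNge; apply: contraL h1 => h; rewrite -leqNgt leq_div2r.
    by rewrite ltnNge; apply: contraL h2 => h; rewrite -leqNgt leq_div2r.
  by case/orP; apply: aux.
case/and3P => xC h1 h2.
pose D k := (yy x %/ 2 ^ (LL - k * g) == A %/ 2 ^ (LL - k * g)) ||
            (yy x %/ 2 ^ (LL - k * g) == Bq %/ 2 ^ (LL - k * g)).
have D0 : D 0 by rewrite /D mul0n subn0 !divn_small.
have DK : ~~ D K by rewrite /D subnn expn0 !divn1; clear -h1 h2; lia.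
have [k [hk Dk Dk1]] : exists k, [/\ k < K, D k & ~~ D k.+1].
  move: DK; elim: (K) => [|j IH]; first by rewrite D0.
  by case E : (D j) => h; [exists j|have [k [? ? ?]] := IH (negbT E); exists k; split=> //; apply: ltnW].
set sh := LL - k.+1 * g in Dk1 *.
have a1 : A %/ 2 ^ sh < yy x %/ 2 ^ sh.
  rewrite ltn_neqAle leq_div2r ?(ltnW h1) // andbT eq_sym.
  by apply: contra Dk1 => e; rewrite /D -/sh e.
have a2 : yy x %/ 2 ^ sh < Bq %/ 2 ^ sh.
  rewrite ltn_neqAle leq_div2r ?(ltnW h2) // andbT.
  by apply: contra Dk1 => e; rewrite /D -/sh e orbT.
have kin : k \in iota 0 K by rewrite mem_iota.
by case/orP: Dk => Dk; apply/orP; [left|right]; apply/hasP; exists k; rewrite // /lev xC Dk -/sh a1 a2.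
Qed.

Lemma searchP st : senv st ->
  exists s' cur, [/\ sem search st = s', senv s' /\ rep s' cur &
   best_of cur (fun x => [&& x \in CL, A < yy x & yy x < Bq])].
Proof.
move=> he; pose t2 := upd (upd st 75 0) 76 0.
have E2 : senv t2 by do !apply: senv_upd.
have r2 : rep t2 None by [].
have e78 : ev $78 t2 = A by rewrite /= E2.
have [s3 [c3 [q3 [E3 r3] B3]]] := search_pathP E2 e78 AM A_lt r2.
have e79 : ev $79 s3 = Bq by rewrite /= E3.
have [s4 [c4 [q4 E4 B4]]] := search_pathP E3 e79 BM Bq_lt r3.
exists s4, c4; split=> //.
  rewrite /search (semSeq _ _ (Asn 75 _)) (semAsn _ _ 75) (semSeq _ _ (Asn 76 _)) (semAsn _ _ 76).
  rewrite !evCst; try by clear -hM; lia.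
  by rewrite -/t2 (semSeq _ _ (search_path _)) q3.
have n00 : best_of None (fun x => false) by [].
have := B4 _ (B3 _ n00); apply: best_of_ext => x.
by rewrite orFb levels_cover.
Qed.

End SearchProg.

(** * A query in one direction *)

Definition bs_body :=
  If ($9 < $92 + $65) Skip
     (66 ::= Ld ($92 + $65 - #1);;
      If $70 (If ($7 < $66) Skip (92 ::= $92 + $65))
             (If ($66 < $7) (92 ::= $92 + $65) Skip));;
  65 ::= $65 >>> #1.

(** The strides are the powers of two below [2 ^ (g + r)], a number larger than the table. Register
    92 ends as the number of table values less than [w], or at most [w] for a predecessor. *)
Definition bsearch := 92 ::= #0;; 65 ::= #1 <<< ($21 + $23 - #1);; Rep ($21 + $23) bs_body.

(** Stepping down from class 0 wraps to a huge number, which the range test rejects. Once a class is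
    found, the remaining rounds leave the state alone. *)
Definition find_body :=
  If $93 Skip
    (If $70 (72 ::= $72 - #1) (72 ::= $72 + #1);;
     If ($72 < #1 <<< $21) (classIv;; nonempty) Skip).

Definition dir_main :=
  bsearch;; 72 ::= $92 >>> $23;; 77 ::= $92 %% (#1 <<< $23);; 71 ::= #1;;
  classIv;; search;;
  If $75 Skip
    (71 ::= #0;; 93 ::= #0;; Rep (#1 <<< $21) find_body;; If $93 search Skip).

Section DirProg.
Variables (b n : nat) (me : nat -> nat) (B : seq bool) (s0 : state).
Local Notation M := (2 ^ b).
Local Notation sem := (sem b me).
Local Notation ev e s := (eval b me e s).
Local Notation env := (env s0).
Hypothesis rank_ok : forall st p, env st -> st 40 = p -> p <= size B ->
  sem rankc st 41 = rank B p.
Hypotheses (hn : s0 0 = n) (hBM : size B < M) (hM : 4 < M) (hnB : n <= size B).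

Variables (T : eqType) (pts : seq T) (cl yy rm : T -> nat) (g K r : nat).
Local Notation LL := (K * g).
Hypotheses (p21 : s0 21 = g) (p22 : s0 22 = K) (p23 : s0 23 = r) (p36 : s0 36 = LL).
Hypothesis (size_pts : size pts = n).
Hypotheses (cl_lt : forall x, cl x < 2 ^ g) (yy_lt : forall x, yy x < 2 ^ LL)
  (rm_lt : forall x, rm x < 2 ^ r).
Local Notation class_order := (class_order pts cl g).
Local Notation level_order := (level_order pts cl yy g K).
Hypothesis seg1 : take (g * n) (drop 0 B) = bitmaps (digits cl g) pts.
Hypothesis seg2 : take (LL * n) (drop (g * n) B) = bitmaps (digits yy LL) class_order.
Hypothesis seg3 : forall k, k < K ->
  take (r * n) (drop ((g + LL) * n + k * (r * n)) B) = bitmaps (digits rm r) (level_order k.+1).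
Hypothesis sizeB : (g + LL) * n + K * (r * n) = size B.
Hypothesis n0 : 0 < n.
Hypotheses (rM : 2 ^ r < M) (LM : LL < M) (gM : 2 * 2 ^ g < M).

Variables (XI XJ A Bq : nat) (dir : bool).
Hypotheses (hX : XI <= XJ <= n) (A_lt : A.+1 < 2 ^ LL) (Bq_lt : Bq < 2 ^ LL)
   (AM : A + 2 * 2 ^ g < M) (BM : Bq + 2 * 2 ^ g < M).

Let gltM : g < M.
Proof. by apply: leq_trans (ltn_expl g (isT : 1 < 2)) _; clear -gM; lia. Qed.
Let gM1 : 2 ^ g < M. Proof. by clear -gM; lia. Qed.
Let lM x : x <= size B -> x < M. Proof. by move=> h; apply: leq_ltn_trans hBM. Qed.
Let h1M : 1 < M. Proof. exact: leq_trans hM. Qed.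

Definition inQ x := [&& x \in slice XI XJ pts, A < yy x & yy x < Bq].

Definition denv (st : state) := env st /\
  [/\ st 63 = XI, st 64 = XJ, st 70 = dir, st 78 = A & st 79 = Bq].

Lemma denv_frame st s' : denv st -> env s' ->
  (forall x, x \in [:: 63; 64; 70; 78; 79] -> s' x = st x) -> denv s'.
Proof. by case=> h [h1 h2 h3 h4 h5] e f; split=> //; split; rewrite f. Qed.

Lemma denv_upd st x v : denv st -> 40 <= x -> x \notin [:: 63; 64; 70; 78; 79] -> denv (upd st x v).
Proof.
case=> h [h1 h2 h3 h4 h5] hx; rewrite !inE !negb_or => hx'.
split; first exact: env_upd.
by split; rewrite updE ifN //; clear -hx'; lia.
Qed.

Definition class_pts c := [seq x <- slice XI XJ pts | cl x == c].

Lemma classIvP st c : denv st -> st 72 = c -> c < 2 ^ g ->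
  exists CI CJ s', [/\ sem classIv st = s', denv s', s' 73 = CI, s' 74 = CJ &
   [/\ CI <= CJ <= n, slice CI CJ class_order = class_pts c &
    forall x, (59 < x) && (x != 73) && (x != 74) -> s' x = st x]].
Proof.
move=> hd h72 hc; have [he [h63 h64 h70 h78 h79]] := hd.
have e0 : ev #0 (upd (upd st 50 XI) 51 XJ) = 0 by apply: evCst; clear -hM; lia.
have e72 : ev $72 (upd (upd (upd (upd st 50 XI) 51 XJ) 52 0) 53 0) = c by rewrite /= !updE.
have e21 : ev $21 (upd (upd (upd (upd (upd st 50 XI) 51 XJ) 52 0) 53 0) 54 c) = g.
  by rewrite /= !updE /= he.
have hO : 0 + g * n <= size B by rewrite add0n -sizeB mulnDl -addnA leq_addr.
have [I' [J' [s1 [q1 [e1 F1] h50 h51 [hIJ hsl _ _]]]]] := walkAtP rank_ok hn hBM hM hnB he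
  (h63 : ev $63 st = XI) (h64 : ev $64 (upd st 50 XI) = XJ) e0 e72 e21 hX size_pts hO seg1
  (ltn_trans hc gM1) gltM.
exists I', J', (upd (upd s1 73 I') 74 J'); split=> //.
- rewrite /classIv (semSeq _ _ (walkAt _ _ _ _ _)) q1 (semSeq _ _ (Asn 73 _)) (semAsn _ _ 73).
  by rewrite [ev $50 s1]h50 semAsn [ev $51 _](_ : _ = J') //= updE.
- apply: denv_upd => //; apply: denv_upd => //; apply: denv_frame hd e1 _ => x hx.
  by apply: F1; move: hx; rewrite !inE; clear; lia.
- split=> //; first by rewrite hsl; apply: eq_filter => x; rewrite !modn_small.
  move=> x /andP[/andP[h1 h2] h3]; rewrite !updE !ifN //.
  by apply: F1; rewrite h1 orbT.
Qed.

Lemma count_between (L : seq T) :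
  (count (fun x => yy x < A.+1) L < count (fun x => yy x < Bq) L) =
  has (fun x => (A < yy x) && (yy x < Bq)) L.
Proof.
have [h|h] := leqP Bq A.+1.
  rewrite [RHS](_ : _ = false); last first.
    by apply/negP => /hasP[x _ /andP[h1 h2]]; clear -h h1 h2; lia.
  by apply/negbTE; rewrite -leqNgt; apply: sub_count => x /= hx; apply: leq_trans hx h.
rewrite has_count; have -> : count (fun x => yy x < Bq) L = count (fun x => yy x < A.+1) L +
    count (fun x => (A < yy x) && (yy x < Bq)) L.
  by elim: L => //= x L ->; clear -h; lia.
by rewrite -{1}[count _ L]addn0 ltn_add2l.
Qed.

Lemma nonemptyP st CI CJ CL : denv st -> st 73 = CI -> st 74 = CJ -> CI <= CJ <= n ->
  slice CI CJ class_order = CL ->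
  exists s', [/\ sem nonempty st = s', denv s',
    s' 93 = has (fun x => (A < yy x) && (yy x < Bq)) CL &
    forall x, (59 < x) && (x != 91) && (x != 93) -> s' x = st x].
Proof.
move=> hd h73 h74 hC hCL; have [he [h63 h64 h70 h78 h79]] := hd.
have gn : g * n <= size B by rewrite -sizeB mulnDl -addnA leq_addr.
have hO : g * n + LL * n <= size B by rewrite -mulnDl -sizeB leq_addr.
have so : size class_order = n by rewrite size_after.
have e36 s a1 a2 a3 a4 a5 : env s ->
    ev $36 (upd (upd (upd (upd (upd s 50 a1) 51 a2) 52 a3) 53 a4) 54 a5) = LL.
  by move=> h; rewrite /= !updE /= h.
have eO s a1 a2 : env s -> ev ($21 * $0) (upd (upd s 50 a1) 51 a2) = g * n.
  by move=> h; apply: evMul; [rewrite /= !updE /= h|rewrite /= !updE /= h|exact: lM].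
have [I1 [J1 [s1 [q1 [e1 F1] _ _ [_ _ h53 _]]]]] := walkAtP rank_ok hn hBM hM hnB he
  (h73 : ev $73 st = CI) (h74 : ev $74 (upd st 50 CI) = CJ)
  (eO st CI CJ he)
  (h79 : ev $79 (upd (upd (upd (upd st 50 CI) 51 CJ) 52 (g * n)) 53 0) = Bq)
  (e36 st CI CJ (g * n) 0 Bq he)
  hC so hO seg2 (leq_ltn_trans (leq_addr _ _) BM) LM.
pose s2 := upd s1 91 (s1 53).
have E2 : env s2 by apply: env_upd.
have e73 : ev $73 s2 = CI by rewrite /= /s2 updE /= F1.
have e74 : ev $74 (upd s2 50 CI) = CJ by rewrite /= /s2 !updE /= F1.
have A1M : A + 1 < M by have := expn_gt0 2 g; clear -AM => h; lia.
have eA : ev ($78 + #1) (upd (upd (upd (upd s2 50 CI) 51 CJ) 52 (g * n)) 53 0) = A + 1.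
  by apply: evAdd => //; [rewrite /= /s2 !updE /= F1|apply: evCst].
have [I3 [J3 [s3 [q3 [e3 F3] _ _ [_ _ k53 _]]]]] := walkAtP rank_ok hn hBM hM hnB E2
  e73 e74 (eO s2 CI CJ E2) eA
  (e36 s2 CI CJ (g * n) 0 (A + 1) E2)
  hC so hO seg2 A1M LM.
exists (upd s3 93 (has (fun x => (A < yy x) && (yy x < Bq)) CL)); split=> //.
- rewrite /nonempty (semSeq _ _ (walkAt _ _ _ _ _)) q1 (semSeq _ _ (Asn 91 _)) (semAsn _ _ 91).
  rewrite -/(s2) (semSeq _ _ (walkAt _ _ _ _ _)) q3 semAsn.
  rewrite (@evLt b me s3 $53 $91 (s3 53) (s1 53)) //; last by rewrite /= F3.
  rewrite k53 h53 hCL -count_between; congr (upd _ _ (nat_of_bool (_ < _))); apply: eq_count => x.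
    by rewrite addn1 !modn_small.
  by rewrite !modn_small.
- apply: denv_upd => //; apply: denv_frame hd e3 _ => x hx.
  rewrite F3; last by move: hx; rewrite !inE; clear; lia.
  rewrite /s2 updE ifN; last by move: hx; rewrite !inE; clear; lia.
  by apply: F1; move: hx; rewrite !inE; clear; lia.
- move=> x /andP[/andP[h1 h2] h3]; rewrite updE ifN // F3 ?h1 ?orbT // /s2 updE ifN //.
  by rewrite F1 ?h1 ?orbT.
Qed.

Lemma search_classP st c (first : bool) rho CI CJ : denv st -> st 72 = c ->
  st 71 = first -> st 77 = rho -> rho < 2 ^ r ->
  st 73 = CI -> st 74 = CJ -> CI <= CJ <= n -> slice CI CJ class_order = class_pts c ->
  exists s' cur, [/\ sem search st = s', denv s', rep s' cur, s' 72 = c /\ s' 77 = rho &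
   best_of rm dir (thr r dir first rho) cur (fun x => inQ x && (cl x == c))].
Proof.
move=> hd h72 h71 h77 hrho h73 h74 hC hCL; have [he [h63 h64 h70 h78 h79]] := hd.
have E : senv st st by [].
have [s' [cur [q [E' r'] B']]] := searchP rank_ok hn hBM hM hnB p21 p22 p23 p36 size_pts
  yy_lt rm_lt seg2 seg3 sizeB he h70 h71 h73 h74 h77 h78 h79 hC hCL hrho (ltnW A_lt) Bq_lt
  AM BM rM LM gM1 n0 E.
exists s', cur; split=> //.
- apply: denv_frame hd _ _; first exact: (senv_env he E').
  by move=> x hx; apply: E'; move: hx; rewrite !inE; clear; lia.
- by split; rewrite E'.
- apply: best_of_ext B' => x; rewrite /inQ mem_filter; case: (cl x == c); rewrite ?andbF ?andbT //.
Qed.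

Definition rk x := cl x * 2 ^ r + rm x.

Lemma lex_le c c' x y : x < 2 ^ r -> y < 2 ^ r ->
  (c * 2 ^ r + x <= c' * 2 ^ r + y) = (c < c') || ((c == c') && (x <= y)).
Proof.
move: (2 ^ r) => R hx hy; case: (ltngtP c c') => [h|h|->] /=; last by rewrite leq_add2l.
  have := leq_mul h (leqnn R); rewrite mulSn; clear -hx; lia.
apply/negbTE; rewrite -ltnNge; have := leq_mul h (leqnn R); rewrite mulSn; clear -hy; lia.
Qed.

Variables (vt : nat -> nat) (kv w : nat).
Hypotheses (p9 : s0 9 = kv) (p7 : s0 7 = w) (kv_lt : kv < 2 ^ (g + r)) (g0 : 0 < g)
  (mxM : 2 * 2 ^ (g + r) < M) (vtM : forall i, i < kv -> vt i < M).
Hypothesis me_vt : forall i, i < kv -> me i = vt i.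
Hypothesis vt_sorted : forall i j, i <= j -> j < kv -> vt i <= vt j.

(** Holds on an initial segment of the sorted table. Its length [E] is the threshold in both
    directions: ranks under [E] are eligible for a predecessor, the others for a successor. *)
Definition below v := if dir then v <= w else v < w.

Lemma below_mono i j : i <= j -> j < kv -> below (vt j) -> below (vt i).
Proof.
move=> ij jk; have := vt_sorted ij jk; rewrite /below; case: (dir) => h1 h2.
  exact: leq_trans h1 h2.
exact: leq_ltn_trans h1 h2.
Qed.

(** The last hypothesis says that the table or the segment of [below] ends fewer than [2 ^ t.+1]
    places after [pos]; one round halves this gap. *)
Lemma bs_bodyP st t pos : denv st -> st 92 = pos -> st 65 = 2 ^ t -> pos + 2 ^ t < M ->
  pos <= kv -> (forall i, i < pos -> below (vt i)) ->
  (pos + 2 ^ t.+1 <= kv -> ~~ below (vt (pos + 2 ^ t.+1).-1)) ->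
  exists s' pos', [/\ sem bs_body st = s', denv s', s' 92 = pos', s' 65 = 2 ^ t %/ 2 &
    [/\ pos' <= pos + 2 ^ t, pos' <= kv, forall i, i < pos' -> below (vt i) &
     pos' + 2 ^ t <= kv -> ~~ below (vt (pos' + 2 ^ t).-1)]].
Proof.
move=> hd h92 h65 hM2 hpk hb hnb; have [he [h63 h64 h70 h78 h79]] := hd.
have t0 : 0 < 2 ^ t by rewrite expn_gt0.
have e9265 s : s 92 = pos -> s 65 = 2 ^ t -> ev ($92 + $65) s = pos + 2 ^ t.
  by move=> a1 a2; apply: evAdd.
have fin s pos' : denv s -> s 92 = pos' -> s 65 = 2 ^ t -> exists s', [/\
   sem (65 ::= $65 >>> #1) s = s', denv s', s' 92 = pos' & s' 65 = 2 ^ t %/ 2].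
  move=> hs a1 a2; exists (upd s 65 (2 ^ t %/ 2)); split=> //; last exact: denv_upd.
  rewrite semAsn (@evShr b me s $65 #1 (2 ^ t) 1) ?expn1 //; first exact: evCst.
  by apply: leq_ltn_trans hM2; apply: leq_addl.
have cnd : ev ($9 < $92 + $65) st = (kv < pos + 2 ^ t).
  by apply: evLt => //; [rewrite /= he|exact: e9265].
rewrite /bs_body (semSeq _ _ (If _ _ _)) semIf cnd.
case: ltnP => hk.
  rewrite (_ : (nat_of_bool true == 0) = false) //.
  have [s' [q1 q2 q3 q4]] := fin st pos hd h92 h65.
  exists s', pos; split=> //; split=> //; first exact: leq_addr.
  by move=> h; exfalso; clear -h hk; lia.
rewrite (_ : (nat_of_bool false == 0) = true) //.
have jk : (pos + 2 ^ t).-1 < kv by clear -hk t0; lia.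
have e66 : ev (Ld ($92 + $65 - #1)) st = vt (pos + 2 ^ t).-1.
  rewrite [LHS]/=; have := @evSub b me st ($92 + $65) #1 (pos + 2 ^ t) 1 (e9265 _ h92 h65) (evCst _ _ _).
  move=> /= -> //; last by clear -t0; lia.
  by rewrite subn1 me_vt // modn_small // vtM.
pose s1 := upd st 66 (vt (pos + 2 ^ t).-1).
have E1 : denv s1 by apply: denv_upd.
have [s2 [q2 E2 v92 v65]] : exists s2, [/\ sem (If $70 (If ($7 < $66) Skip (92 ::= $92 + $65))
             (If ($66 < $7) (92 ::= $92 + $65) Skip)) s1 = s2, denv s2,
     s2 92 = (if below (vt (pos + 2 ^ t).-1) then pos + 2 ^ t else pos) & s2 65 = 2 ^ t].
  have es : sem (92 ::= $92 + $65) s1 = upd s1 92 (pos + 2 ^ t).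
    by rewrite semAsn e9265.
  have c1 : ev ($7 < $66) s1 = (w < vt (pos + 2 ^ t).-1).
    by apply: evLt => //; rewrite /= /s1 updE /= he.
  have c2 : ev ($66 < $7) s1 = (vt (pos + 2 ^ t).-1 < w).
    by apply: evLt => //; rewrite /= /s1 updE /= he.
  have c70 : ev $70 s1 = dir by rewrite /= /s1 updE.
  have case1 : exists s2, [/\ upd s1 92 (pos + 2 ^ t) = s2, denv s2, s2 92 = pos + 2 ^ t & s2 65 = 2 ^ t].
    by exists (upd s1 92 (pos + 2 ^ t)); split=> //; apply: denv_upd.
  have case2 : exists s2, [/\ s1 = s2, denv s2, s2 92 = pos & s2 65 = 2 ^ t] by exists s1.
  rewrite !semIf c70 c1 c2 es /below; case: (dir).
    rewrite (_ : (nat_of_bool true == 0) = false) // [vt _ <= w]leqNgt.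
    by case: (w < _); [exact: case2|exact: case1].
  rewrite (_ : (nat_of_bool false == 0) = true) //.
  by case: (_ < w); [exact: case1|exact: case2].
rewrite (semSeq _ _ (Asn 66 _)) (semAsn _ _ 66) e66 -/s1 q2.
have [s' [r1 r2 r3 r4]] := fin s2 _ E2 v92 v65.
exists s', (if below (vt (pos + 2 ^ t).-1) then pos + 2 ^ t else pos); split=> //.
case hbl : (below _); split=> //.
- move=> i hi; apply: below_mono hbl => //; clear -hi; lia.
- by rewrite -addnA addnn -mul2n -expnS.
- exact: leq_addr.
- by rewrite hbl.
Qed.

Lemma bsearchP st : denv st -> exists s' E, [/\ sem bsearch st = s', denv s', s' 92 = E, E <= kv &
  forall i, i < kv -> (i < E) = below (vt i)].
Proof.
move=> hd; have [he _] := hd.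
have mx0 : 0 < g + r by rewrite addn_gt0 g0.
have mxM1 : g + r < M.
  by apply: leq_trans (ltn_expl (g + r) (isT : 1 < 2)) _; clear -mxM; lia.
have egr s : env s -> ev ($21 + $23) s = g + r.
  by move=> h; apply: evAdd; [rewrite /= h|rewrite /= h|].
pose s1 := upd st 92 0; have E1 : denv s1 by apply: denv_upd.
have half : 2 ^ (g + r - 1) < M.
  by apply: leq_ltn_trans (_ : 2 ^ (g + r) < _); rewrite ?leq_exp2l ?leq_subr //; clear -mxM; lia.
have e65 : ev (#1 <<< ($21 + $23 - #1)) s1 = 2 ^ (g + r - 1).
  rewrite -[RHS]mul1n; apply: evShl; [exact: evCst| |by rewrite mul1n].
  by apply: evSub => //; [apply: egr; case: E1|exact: evCst].
pose s2 := upd s1 65 (2 ^ (g + r - 1)); have E2 : denv s2 by apply: denv_upd.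
have loop j : j <= g + r -> exists s' pos, [/\ iter j (sem bs_body) s2 = s', denv s', s' 92 = pos,
   (j < g + r -> s' 65 = 2 ^ (g + r - j - 1)) &
   [/\ pos + 2 ^ (g + r - j) <= 2 ^ (g + r), pos <= kv, forall i, i < pos -> below (vt i) &
     pos + 2 ^ (g + r - j) <= kv -> ~~ below (vt (pos + 2 ^ (g + r - j)).-1)]].
  elim: j => [|j IH] hj.
    exists s2, 0; split=> //; first by rewrite subn0.
    split=> //; first by rewrite subn0.
    by rewrite subn0 add0n => h; exfalso; clear -h kv_lt; lia.
  have [s3 [pos [q3 E3 h92 h65 [b1 b2 b3 b4]]]] := IH (ltnW hj).
  have e1 : g + r - j = (g + r - j.+1).+1 by clear -hj; lia.
  have e2 : g + r - j - 1 = g + r - j.+1 by clear; lia.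
  rewrite e1 in b1 b4; rewrite e2 in h65.
  have hpM : pos + 2 ^ (g + r - j.+1) < M.
    apply: leq_ltn_trans (_ : 2 ^ (g + r) < _); last by clear -mxM; lia.
    by apply: leq_trans b1; rewrite leq_add2l leq_exp2l.
  have [s4 [pos' [q4 E4 i92 i65 [c1 c2 c3 c4]]]] := bs_bodyP E3 h92 (h65 hj) hpM b2 b3 b4.
  exists s4, pos'; split=> //; first by rewrite iterS q3.
    move=> hj2; rewrite i65; have -> : g + r - j.+1 = (g + r - j.+1 - 1).+1 by clear -hj2; lia.
    by rewrite expnS mulKn // [in RHS]subn1.
  split=> //; apply: leq_trans b1; rewrite expnS mul2n -addnn addnA leq_add2r //.
have [s3 [pos [q3 E3 h92 _ [b1 b2 b3 b4]]]] := loop _ (leqnn _).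
exists s3, pos; split=> //.
  rewrite /bsearch (semSeq _ _ (Asn 92 _)) (semAsn _ _ 92) evCst; last by clear -hM; lia.
  rewrite -/s1 (semSeq _ _ (Asn 65 _)) (semAsn _ _ 65) e65 -/s2 semRep egr //.
  by case: E2.
move=> i hi; apply/idP/idP; first exact: b3.
move=> B1; rewrite ltnNge; apply/negP => le.
have hp : pos + 2 ^ (g + r - (g + r)) <= kv by rewrite subnn expn0; clear -hi le; lia.
have := b4 hp; rewrite subnn expn0 addn1 /= => /negP; apply.
exact: below_mono B1.
Qed.

(** Mirrors the register: past class 0 it holds [M] minus the excess. Within [2 ^ g] steps and with
    [2 * 2 ^ g < M], such a value is never mistaken for a class. *)
Definition class_at c0 i := if dir then (if i <= c0 then c0 - i else M - (i - c0)) else c0 + i.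
Definition empty_class c := forall x, inQ x -> cl x != c.
Definition found_at c0 i st := exists CI CJ, [/\ class_at c0 i < 2 ^ g, st 72 = class_at c0 i,
  st 73 = CI /\ st 74 = CJ, CI <= CJ <= n & slice CI CJ class_order = class_pts (class_at c0 i)]
  /\ exists2 x, inQ x & cl x = class_at c0 i.

Lemma has_inQ c : has (fun x => (A < yy x) && (yy x < Bq)) (class_pts c) = false -> empty_class c.
Proof.
move=> h x /and3P[h1 h2 h3]; apply/eqP => e; move/negP: h; apply.
by apply/hasP; exists x; rewrite ?h2 // mem_filter e eqxx.
Qed.

Lemma find_bodyP st c0 j : denv st -> c0 < 2 ^ g -> j < 2 ^ g -> st 93 = 0 ->
  st 72 = class_at c0 j ->
  exists s', [/\ sem find_body st = s', denv s', s' 71 = st 71 &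
    (s' 93 = 0 /\ s' 72 = class_at c0 j.+1 /\ (class_at c0 j.+1 < 2 ^ g -> empty_class (class_at c0 j.+1)))
    \/ (s' 93 = 1 /\ found_at c0 j.+1 s')].
Proof.
move=> hd hc0 hj h93 h72; have [he [h63 h64 h70 h78 h79]] := hd.
have [s1 [q1 E1 v72 F1]] : exists s1, [/\
   sem (If $70 (72 ::= $72 - #1) (72 ::= $72 + #1)) st = s1, denv s1,
   s1 72 = class_at c0 j.+1 & forall x, x != 72 -> s1 x = st x].
  exists (upd st 72 (class_at c0 j.+1)); split.
  - have e70 : ev $70 st = dir by [].
    rewrite semIf e70 !semAsn; move: h72; rewrite /class_at; case: (dir) => h72.
      rewrite (_ : (nat_of_bool true == 0) = false) //; congr (upd _ _ _).
      rewrite [LHS]/= h72 /opval (@modn_small 1) // (@modn_small 1) //.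
      case: (leqP j c0) => h1; case: (leqP j.+1 c0) => h2.
      + have -> : c0 - j + (M - 1) = M + (c0 - j.+1) by clear -h2 h1M; lia.
        by rewrite modnDl modn_small //; clear -hc0 gM; lia.
      + have -> : c0 - j + (M - 1) = M - (j.+1 - c0) by clear -h1 h2 h1M; lia.
        by rewrite modn_small //; clear -h1 h2 h1M; lia.
      + by exfalso; clear -h1 h2; lia.
      + have -> : M - (j - c0) + (M - 1) = M + (M - (j.+1 - c0)) by clear -h1 hj gM; lia.
        by rewrite modnDl modn_small //; clear -h1 h2 h1M; lia.
    rewrite (_ : (nat_of_bool false == 0) = true) //; congr (upd _ _ _).
    rewrite [LHS]/= h72 /opval (@modn_small 1) // modn_small addn1 ?addnS //.
    by clear -hj hc0 gM; lia.
  - exact: denv_upd.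
  - by rewrite updE.
  - by move=> x hx; rewrite updE ifN.
rewrite /find_body semIf [ev $93 st]h93 eqxx (semSeq _ _ (If _ _ _)) q1 semIf.
have cnd : ev ($72 < #1 <<< $21) s1 = (class_at c0 j.+1 < 2 ^ g).
  apply: evLt => //; rewrite -[RHS]mul1n; apply: evShl; [exact: evCst| |by rewrite mul1n].
  by case: E1 => E1 _; rewrite /= E1.
rewrite cnd; case hc : (_ < 2 ^ g); last first.
  rewrite (_ : (nat_of_bool false == 0) = true) //.
  by exists s1; split=> //; [rewrite F1|left; rewrite F1].
rewrite (_ : (nat_of_bool true == 0) = false) //.
have [CI [CJ [s2 [q2 E2 h73 h74 [hC hCL F2]]]]] := classIvP E1 v72 hc.
have [s3 [q3 E3 v93 F3]] := nonemptyP E2 h73 h74 hC hCL.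
exists s3; split=> //; first by rewrite (semSeq _ _ classIv) q2.
  by rewrite F3 // F2 // F1.
move: v93; case hh : (has _ _) => v93; [right|left]; split=> //.
  exists CI, CJ; split.
    by split=> //; [rewrite F3 // F2|split; rewrite F3].
  move/hasP: hh => [x hx /andP[h1 h2]]; move: hx; rewrite mem_filter => /andP[/eqP e hx].
  by exists x => //; rewrite /inQ hx h1.
by split; [rewrite F3 // F2|move=> _; apply: has_inQ].
Qed.

Lemma find_loopP st c0 : denv st -> c0 < 2 ^ g -> st 93 = 0 -> st 72 = c0 ->
  exists s', [/\ iter (2 ^ g) (sem find_body) st = s', denv s', s' 71 = st 71 &
    (s' 93 = 0 /\ forall i, 0 < i <= 2 ^ g -> class_at c0 i < 2 ^ g -> empty_class (class_at c0 i))
    \/ (s' 93 = 1 /\ exists i, [/\ 0 < i <= 2 ^ g, found_at c0 i s' &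
         forall i', 0 < i' < i -> class_at c0 i' < 2 ^ g -> empty_class (class_at c0 i')])].
Proof.
move=> hd hc0 h93 h72.
have loop j : j <= 2 ^ g -> exists s', [/\ iter j (sem find_body) st = s', denv s', s' 71 = st 71 &
    (s' 93 = 0 /\ s' 72 = class_at c0 j /\
      forall i, 0 < i <= j -> class_at c0 i < 2 ^ g -> empty_class (class_at c0 i))
    \/ (s' 93 = 1 /\ exists i, [/\ 0 < i <= j, found_at c0 i s' &
         forall i', 0 < i' < i -> class_at c0 i' < 2 ^ g -> empty_class (class_at c0 i')])].
  elim: j => [|j IH] hj.
    exists st; split=> //; left; split=> //; split; last by move=> i; clear; lia.
    by rewrite h72 /class_at; case: (dir); rewrite ?leq0n ?subn0 ?addn0.
  have [s3 [q3 E3 h71 [[i93 [i72 he]]|[i93 hf]]]] := IH (ltnW hj).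
    have [s4 [q4 E4 j71 H4]] := find_bodyP E3 hc0 hj i93 i72.
    exists s4; split=> //; [by rewrite iterS q3|by rewrite j71|].
    case: H4 => [[j93 [j72 je]]|[j93 jf]]; [left|right]; split=> //.
      split=> // i /andP[i0 ij]; case: (ltngtP i j.+1) ij => // [ij _|-> _]; last exact: je.
      by apply: he; rewrite i0 -ltnS.
    exists j.+1; split=> //; first by rewrite ltn0Sn leqnn.
  exists s3; split=> //.
    by rewrite iterS q3 /find_body semIf [ev $93 s3]i93.
  right; split=> //; case: hf => i [h1 h2 h3]; exists i; split=> //.
  by clear -h1; lia.
have [s3 [q3 E3 h71 H]] := loop _ (leqnn _).
exists s3; split=> //; case: H => [[i93 [_ he]]|[i93 hf]]; [left|right]; split=> //.
Qed.

Definition result (st : state) (cur : option nat) : Prop :=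
  if cur is Some v then [/\ st 75 = 1, st 72 * 2 ^ r + st 76 = v & v < 2 ^ (g + r)] else st 75 = 0.

Lemma rk_lt c y : c < 2 ^ g -> y < 2 ^ r -> c * 2 ^ r + y < 2 ^ (g + r).
Proof.
move=> hc hy; rewrite expnD; move: (2 ^ r) (2 ^ g) hc hy => R G hc hy.
have := leq_mul hc (leqnn R); rewrite mulSn; clear -hy; lia.
Qed.

Lemma dir_mainP st : denv st -> exists s' cur E, [/\ sem dir_main st = s', env s', result s' cur,
   E <= kv /\ (forall i, i < kv -> (i < E) = below (vt i)) &
   best_of rk dir E cur inQ].
Proof.
move=> hd.
have [s1 [E [q1 E1 h92 Ek hE]]] := bsearchP hd.
(* Since [kv < 2 ^ (g + r)] is strict, the threshold has a class of its own even when every table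
   value is below the query. *)
have Emx : E < 2 ^ (g + r) by apply: leq_ltn_trans kv_lt.
have EM : E < M by clear -Emx mxM; lia.
pose c0 := E %/ 2 ^ r; pose rho := E %% 2 ^ r.
have EE : E = c0 * 2 ^ r + rho by apply: divn_eq.
have hc0 : c0 < 2 ^ g by rewrite ltn_divLR ?expn_gt0 // -expnD.
have hrho : rho < 2 ^ r by rewrite ltn_mod expn_gt0.
have r23 s : denv s -> ev $23 s = r by case=> h _; rewrite /= h.
pose s2 := upd s1 72 c0; have E2 : denv s2 by apply: denv_upd.
have e72 : ev ($92 >>> $23) s1 = c0 by apply: evShr => //; apply: r23.
pose s3 := upd s2 77 rho; have E3 : denv s3 by apply: denv_upd.
have e77 : ev ($92 %% (#1 <<< $23)) s2 = rho.
  apply: evMod => //; rewrite -[RHS]mul1n; apply: evShl; [exact: evCst|exact: r23|].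
  by rewrite mul1n.
pose s4 := upd s3 71 1; have E4 : denv s4 by apply: denv_upd.
have v72 : s4 72 = c0 by [].
have [CI [CJ [s5 [q5 E5 h73 h74 [hC hCL F5]]]]] := classIvP E4 v72 hc0.
have i72 : s5 72 = c0 by rewrite F5.
have i71 : s5 71 = true by rewrite F5.
have i77 : s5 77 = rho by rewrite F5.
have [s6 [cur0 [q6 E6 r6 [j72 j77] B6]]] := search_classP E5 i72 i71 i77 hrho h73 h74 hC hCL.
rewrite /thr in B6.
have start : sem dir_main st = sem (If $75 Skip
    (71 ::= #0;; 93 ::= #0;; Rep (#1 <<< $21) find_body;; If $93 search Skip)) s6.
  rewrite /dir_main (semSeq _ _ bsearch) q1 (semSeq _ _ (Asn 72 _)) (semAsn _ _ 72) e72 -/s2.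
  rewrite (semSeq _ _ (Asn 77 _)) (semAsn _ _ 77) e77 -/s3.
  rewrite (semSeq _ _ (Asn 71 _)) (semAsn _ _ 71) (evCst _ _ h1M) -/s4.
  by rewrite (semSeq _ _ classIv) q5 (semSeq _ _ search) q6.
(* Comparing ranks means comparing the pairs of class and remainder lexicographically with
   [(c0, rho)]. *)
have elig x : eligible dir E (rk x) = if dir then (cl x < c0) || ((cl x == c0) && (rm x < rho))
    else (c0 < cl x) || ((cl x == c0) && (rho <= rm x)).
  rewrite /eligible /rk EE; case: (dir); last by rewrite lex_le // eq_sym.
  by rewrite ltnNge lex_le // [c0 == _]eq_sym; case: (ltngtP (cl x) c0) => //= _; rewrite ltnNge.
rewrite start semIf.
case: cur0 r6 B6 => [y|] r6 B6.
  have [r75 r76] := r6.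
  exists s6, (Some (c0 * 2 ^ r + y)), E; split=> //.
  - by rewrite [ev $75 s6]r75.
  - by case: E6.
  - case: B6 => [[x /andP[_ _] e] _]; split=> //; first by rewrite j72 r76.
    by apply: rk_lt => //; rewrite -e.
  case: B6 => [[x /andP[hx /eqP hcx] e] [hel hb]]; split; [by exists x; rewrite // /rk hcx e|split].
    have := elig x; rewrite /rk hcx e => ->; rewrite eqxx ltnn /=.
    by move: hel; rewrite /eligible.
  move=> z hz; rewrite elig => hez.
  have hyr : y < 2 ^ r by rewrite -e.
  have hb' := hb z; move: hez hb'; rewrite hz /eligible /better /rk; case: (dir) => /=.
    case/orP => [h _|/andP[/eqP h1 h2] /(_ _ h2)].
      by rewrite lex_le // h.
    by rewrite h1 eqxx lex_le // eqxx => -> //; rewrite orbT.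
  case/orP => [h _|/andP[/eqP h1 h2] /(_ _ h2)].
    by rewrite lex_le // h.
  by rewrite h1 eqxx lex_le // eqxx => -> //; rewrite orbT.
have r75 : s6 75 = 0 by [].
rewrite [ev $75 s6]r75 eqxx.
pose s7 := upd (upd s6 71 0) 93 0.
have E7 : denv s7 by apply: denv_upd => //; apply: denv_upd.
have k72 : s7 72 = c0 by rewrite /s7 !updE.
have [s8 [q8 E8 h71 H8]] := find_loopP E7 hc0 (erefl : s7 93 = 0) k72.
have g21 : ev (#1 <<< $21) s7 = 2 ^ g.
  rewrite -[RHS]mul1n; apply: evShl; [exact: evCst| |by rewrite mul1n].
  by case: E7 => h _; rewrite /= h.
have body : sem (71 ::= #0;; 93 ::= #0;; Rep (#1 <<< $21) find_body;; If $93 search Skip) s6 =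
   sem (If $93 search Skip) s8.
  rewrite (semSeq _ _ (Asn 71 _)) (semAsn _ _ 71) (semSeq _ _ (Asn 93 _)) (semAsn _ _ 93).
  rewrite !evCst; try by clear -hM; lia.
  by rewrite -/s7 (semSeq _ _ (Rep _ _)) semRep g21 q8.
have fr x : x \notin mods (Rep (#1 <<< $21) find_body) -> s8 x = s7 x.
  by move=> hx; rewrite -q8 -g21 -(semRep b me) sem_frame.
have b0 x : inQ x -> cl x = c0 -> ~~ eligible dir rho (rm x).
  by move=> hx hc; apply: (B6 x); rewrite hx hc eqxx.
(* As class [c0] contains no eligible point, every eligible point lies in a class strictly beyond
   it, where no bound on the remainder applies. *)
have no0 x : inQ x -> eligible dir E (rk x) -> if dir then cl x < c0 else c0 < cl x.
  move=> hx; rewrite elig; have := b0 x hx; rewrite /eligible; case: (dir).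
    by case: (ltngtP (cl x) c0) => //= e1 /(_ e1) /negPf->.
  by case: (ltngtP (cl x) c0) => //= e1 /(_ e1) /negPf->.
have reach_class c : c < 2 ^ g -> (if dir then c < c0 else c0 < c) ->
    exists2 i, 0 < i <= 2 ^ g & class_at c0 i = c /\ (if dir then i = c0 - c else i = c - c0).
  rewrite /class_at; case: (dir) => h1 h2.
    exists (c0 - c); first by clear -h2 hc0; lia.
    by split=> //; rewrite ifT; clear -h2; lia.
  exists (c - c0); first by clear -h1 h2; lia.
  by split=> //; clear -h2; lia.
rewrite body semIf; case: H8 => [[i93 he]|[i93 [i [hi [DI [DJ [[hci l72 [l73 l74] hD hDL] [x0 hx0 hcx0]]]] hmin]]]].
  exists s8, None, E; split=> //.
  - by rewrite [ev $93 s8]i93.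
  - by case: E8.
  - by rewrite /= fr.
  - move=> x hx; apply/negP => hel; have hcl := no0 x hx hel.
    have [i hi [e _]] := reach_class _ (cl_lt x) hcl.
    have := he i hi; rewrite e => /(_ (cl_lt x)) /(_ x hx); by rewrite eqxx.
rewrite [ev $93 s8]i93 (_ : (1 == 0) = false) //.
set c := class_at c0 i in hci l72 hcx0 hDL.
have l71 : s8 71 = false by rewrite h71.
have l77 : s8 77 = rho by rewrite fr.
have [s9 [cur1 [q9 E9 r9 [m72 m77] B9]]] := search_classP E8 l72 l71 l77 hrho l73 l74 hD hDL.
rewrite /thr in B9.
have alle v : v < 2 ^ r -> eligible dir (if dir then 2 ^ r else 0) v.
  by rewrite /eligible; case: (dir).
(* A class number in range, reached after at least one step, has not wrapped and so lies strictly on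
   the proper side of [c0]. *)
have dirc : if dir then c < c0 else c0 < c.
  rewrite /c /class_at in hci *; move: hci hi; case: (dir); [case: (leqP i c0)|]; clear -gM hc0; lia.
case: cur1 r9 B9 => [y|] r9 B9; last first.
  by have := B9 x0; rewrite hx0 hcx0 eqxx alle // => /(_ isT).
have [r95 r96] := r9; case: B9 => [[x1 /andP[hx1 /eqP hc1] e1] [_ hb]].
have hy : y < 2 ^ r by rewrite -e1.
exists s9, (Some (c * 2 ^ r + y)), E; split=> //.
- by case: E9.
- by split=> //; [rewrite m72 r96|apply: rk_lt].
split; first by exists x1; rewrite // /rk hc1 e1.
split.
  have := elig x1; rewrite /rk hc1 e1 => ->.
  by move: dirc; case: (dir) => ->.
move=> z hz hel; have hcl := no0 z hz hel.
have [i' /andP[hi0 hi1] [ei di]] := reach_class _ (cl_lt z) hcl.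
(* A nearer class with a point of the query would have stopped the loop earlier. *)
have nlt : ~~ (i' < i).
  apply/negP => lt; have := hmin i'; rewrite hi0 lt ei => /(_ isT (cl_lt z)) /(_ z hz).
  by rewrite eqxx.
have hzy : cl z = c -> better dir y (rm z).
  by move=> e; apply: hb; [rewrite hz e eqxx|apply: alle].
have ic : if dir then i = c0 - c else i = c - c0.
  move: hci hi; rewrite /c /class_at; case: (dir); [case: (leqP i c0)|]; clear -gM hc0; lia.
move: hzy ic di nlt dirc hcl; rewrite /better /rk; case: (dir) => hzy ic di nlt dirc hcl.
  rewrite lex_le //; case: (ltngtP (cl z) c) => //= lt.
  by exfalso; clear -lt ic di nlt dirc hcl; lia.
rewrite lex_le //; case: (ltngtP c (cl z)) => //= [lt|eq]; last exact: hzy.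
by exfalso; clear -lt ic di nlt dirc hcl; lia.
Qed.

End DirProg.

(* [F] is a function of the parameters [g], [K] and [r] held in registers 21, 22 and 23. *)
Definition bounded (c : cmd) (F : nat -> nat -> nat -> nat) : Prop :=
  exists C, forall b me s0 g K r s, s0 21 = g -> s0 22 = K -> s0 23 = r -> s0 36 = K * g ->
    env s0 s -> cost b me c s <= C * F g K r.

Definition high (c : cmd) := all (fun x => 40 <= x) (mods c).

(** * Composing bounds on the running time *)

Section Bounded.
Variables (F G : nat -> nat -> nat -> nat).
Hypothesis F1 : forall g K r, 0 < F g K r.

Lemma bounded_static c : norep c -> bounded c F.
Proof.
move=> h; exists (cmax c) => b me s0 g K r s _ _ _ _ _.
apply: cmaxP => //; exact: leq_pmulr.
Qed.

Lemma bounded_seq c1 c2 : high c1 -> bounded c1 F -> bounded c2 F -> bounded (Seq c1 c2) F.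
Proof.
move=> h [C1 h1] [C2 h2]; exists (C1 + C2) => b me s0 g K r s e1 e2 e3 e4 he /=.
by rewrite mulnDl leq_add ?(h1 _ _ s0) // (h2 _ _ s0) //; apply: env_sem.
Qed.

Lemma bounded_if e c1 c2 : bounded c1 F -> bounded c2 F -> bounded (If e c1 c2) F.
Proof.
move=> [C1 h1] [C2 h2]; exists (ecost e + 2 + C1 + C2) => b me s0 g K r s e1 e2 e3 e4 he /=.
have l1 := h1 b me s0 g K r s e1 e2 e3 e4 he; have l2 := h2 b me s0 g K r s e1 e2 e3 e4 he.
have := F1 g K r; move: (F g K r) l1 l2 => f; case: ifP => _; nia.
Qed.

Lemma bounded_weak c : (forall g K r, F g K r <= G g K r) -> bounded c F -> bounded c G.
Proof.
move=> h [C hC]; exists C => b me s0 g K r s e1 e2 e3 e4 he.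
by apply: leq_trans (hC _ _ s0 g K r s _ _ _ _ _) _ => //; rewrite leq_mul2l h orbT.
Qed.

Lemma bounded_rep e c (N : nat -> nat -> nat -> nat) : high c ->
  (forall b me s0 g K r s, s0 21 = g -> s0 22 = K -> s0 23 = r -> s0 36 = K * g -> env s0 s ->
     eval b me e s <= N g K r) ->
  (forall g K r, N g K r * F g K r <= G g K r) -> (forall g K r, 0 < G g K r) ->
  bounded c F -> bounded (Rep e c) G.
Proof.
move=> h hN NFG G1 [C hC]; exists (ecost e + 1 + (C + 4)) => b me s0 g K r s e1 e2 e3 e4 he.
apply: leq_trans (_ : ecost e + 1 + N g K r * ((C + 4) * F g K r) <= _).
  rewrite [cost _ _ _ _]/= leq_add2l.
  apply: leq_trans (_ : \sum_(i < eval b me e s) ((C + 4) * F g K r) <= _).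
    apply: leq_sum => i _; rewrite mulnDl leq_add ?leq_pmulr //.
    apply: (hC _ _ s0) => //; elim: (nat_of_ord i) => //= j IH; exact: env_sem.
  rewrite sum_nat_const card_ord leq_mul2r; apply/orP; right.
  exact: (hN b me s0 g K r s e1 e2 e3 e4 he).
have := NFG g K r; have := G1 g K r.
move: (F g K r) (G g K r) (N g K r) => f x y h1 h2.
rewrite mulnCA [X in _ <= X]mulnDl leq_add //; first by rewrite leq_pmulr.
by rewrite leq_mul2l h2 orbT.
Qed.

End Bounded.

Lemma walkc_bounded nb (N : nat -> nat -> nat -> nat) :
  (forall b me s0 g K r s, s0 21 = g -> s0 22 = K -> s0 23 = r -> s0 36 = K * g -> env s0 s ->
     eval b me nb s <= N g K r) ->
  bounded (walkc nb) (fun g K r => N g K r + 1).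
Proof.
move=> hN; pose c := cmax walk_body.
have hc b me s : cost b me walk_body s <= c by apply: cmaxP.
exists (ecost nb + 3 + (c + 4)) => b me s0 g K r s e1 e2 e3 e4 he.
have h0 := hN b me s0 g K r s e1 e2 e3 e4 he.
have h1 := @cost_Rep b me $55 walk_body (upd s 55 (eval b me nb s)) c (hc b me).
have -> : cost b me (walkc nb) s = ecost nb + 1 +
  cost b me (Rep $55 walk_body) (upd s 55 (eval b me nb s)) by [].
move: h1; have -> : eval b me $55 (upd s 55 (eval b me nb s)) = eval b me nb s by rewrite /= updE.
move: (cost b me _ _) => x; move: (eval b me nb s) (N g K r) h0 => y z h0.
have -> : ecost $55 = 1 by [].
clear hc; move: (ecost nb) c h0 => u v h0 h1; nia.
Qed.

Lemma quantc_bounded : bounded (quantc $23) (fun g K r => r + 1).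
Proof.
pose c := cmax quant_body.
have hc b me s : cost b me quant_body s <= c by apply: cmaxP.
exists (4 + (c + 4)) => b me s0 g K r s e1 e2 e3 e4 he.
have h1 := @cost_Rep b me $23 quant_body (upd s 61 (eval b me #0 s)) c (hc b me).
have -> : cost b me (quantc $23) s = 2 + cost b me (Rep $23 quant_body) (upd s 61 (eval b me #0 s)) by [].
move: h1; have -> : eval b me $23 (upd s 61 (eval b me #0 s)) = r by rewrite /= updE /= he.
move: (cost b me _ _) => x; have -> : ecost $23 = 1 by [].
clear hc; move: c => v h1; nia.
Qed.

(** Orders of the cost of one sibling, of one super-level and of one direction of the query. The
    factor [2 ^ g] counts the children of a node, and in [Fall] also the classes tried. *)
Definition Fgr (g K r : nat) := g + r + 1.
Definition Flev (g K r : nat) := 2 ^ g * (g + r + 1).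
Definition Fall (g K r : nat) := 2 ^ g * ((K + 1) * (g + r + 1)).

Lemma Fgr_gt0 g K r : 0 < Fgr g K r. Proof. by rewrite /Fgr addn1. Qed.
Lemma Flev_gt0 g K r : 0 < Flev g K r. Proof. by rewrite /Flev muln_gt0 expn_gt0 addn1. Qed.
Lemma Fall_gt0 g K r : 0 < Fall g K r.
Proof. by rewrite /Fall !muln_gt0 expn_gt0 !addn1. Qed.

Lemma Fgr_Flev g K r : Fgr g K r <= Flev g K r.
Proof. by rewrite /Fgr /Flev leq_pmull ?expn_gt0. Qed.

Lemma Flev_Fall g K r : Flev g K r <= Fall g K r.
Proof. by rewrite /Flev /Fall leq_mul2l leq_pmull ?orbT // addn1. Qed.

Section WalkAt.
Variable F : nat -> nat -> nat -> nat.
Hypothesis F1 : forall g K r, 0 < F g K r.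
Lemma walkAt_bounded eI eJ eO ek nb : bounded (walkc nb) F -> bounded (walkAt eI eJ eO ek nb) F.
Proof.
by move=> h; rewrite /walkAt; do 5!(apply: bounded_seq => //; first exact: bounded_static).
Qed.
End WalkAt.

Lemma walk21 eI eJ eO ek : bounded (walkAt eI eJ eO ek $21) Fgr.
Proof.
apply: (walkAt_bounded Fgr_gt0).
apply: (@bounded_weak (fun g K r => g + 1)); first by move=> g K r; rewrite /Fgr; lia.
by apply: walkc_bounded => b me s0 g K r s e1 e2 e3 e4 he; rewrite /= he // e1.
Qed.

Lemma walk23 eI eJ eO ek : bounded (walkAt eI eJ eO ek $23) Fgr.
Proof.
apply: (walkAt_bounded Fgr_gt0).
apply: (@bounded_weak (fun g K r => r + 1)); first by move=> g K r; rewrite /Fgr; lia.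
by apply: walkc_bounded => b me s0 g K r s e1 e2 e3 e4 he; rewrite /= he // e3.
Qed.

(** Bounds the test of one class, whose walks read all [K * g] row bits. *)
Definition Fnon (g K r : nat) := (K + 1) * (g + r + 1).
Lemma Fnon_gt0 g K r : 0 < Fnon g K r. Proof. by rewrite /Fnon muln_gt0 !addn1. Qed.

Lemma walk36 eI eJ eO ek : bounded (walkAt eI eJ eO ek $36) Fnon.
Proof.
apply: (walkAt_bounded Fnon_gt0).
apply: (@bounded_weak (fun g K r => K * g + 1)); first by move=> g K r; rewrite /Fnon; nia.
by apply: walkc_bounded => b me s0 g K r s e1 e2 e3 e4 he; rewrite /= he // e4.
Qed.

Lemma node_proc_bounded : bounded node_proc Fgr.
Proof.
have st c : norep c -> bounded c Fgr by apply: bounded_static Fgr_gt0 _.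
rewrite /node_proc; do 2!(apply: bounded_seq => //; first exact: st).
apply: bounded_seq => //.
  apply: bounded_if; [exact: Fgr_gt0| |exact: st].
  by apply: bounded_seq => //; [exact: walk23|exact: st].
apply: bounded_seq => //; first exact: st.
apply: bounded_if; [exact: Fgr_gt0| |exact: st].
do 3!(apply: bounded_seq => //; first exact: st).
apply: bounded_seq => //; last exact: st.
by apply: bounded_weak quantc_bounded => g K r; rewrite /Fgr; lia.
Qed.

Lemma digit_body_bounded : bounded digit_body Fgr.
Proof.
have st c : norep c -> bounded c Fgr by apply: bounded_static Fgr_gt0 _.
apply: bounded_seq => //; last exact: st.
apply: bounded_if; [exact: Fgr_gt0| |exact: st].
apply: bounded_if; [exact: Fgr_gt0| |exact: st].
by apply: bounded_seq => //; [exact: walk21|exact: node_proc_bounded].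
Qed.

(** Reduction to a word can only lower a loop count, so the time bounds hold without any assumption
    that [2 ^ g] fits in a word. *)
Lemma pow21 b me (s0 : state) g s : s0 21 = g -> env s0 s -> eval b me (#1 <<< $21) s <= 2 ^ g.
Proof.
move=> e h; rewrite /= /opval; apply: leq_trans (leq_mod _ _) _.
by rewrite h // e -[X in _ <= X]mul1n leq_mul2r leq_mod orbT.
Qed.

Lemma level_body_bounded : bounded level_body Flev.
Proof.
have st c : norep c -> bounded c Flev by apply: bounded_static Flev_gt0 _.
do 2!(apply: bounded_seq => //; first exact: st).
apply: bounded_seq => //.
  apply: (@bounded_rep Fgr Flev Fgr_gt0 _ _ (fun g K r => 2 ^ g)) => //.
  - by move=> b me s0 g K r s e1 *; apply: pow21 e1 _.
  - exact: Flev_gt0.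
  - exact: digit_body_bounded.
apply: bounded_seq => //; first exact: bounded_weak Fgr_Flev (walk21 _ _ _ _).
exact: st.
Qed.

Lemma search_path_bounded p : bounded (search_path p) Fall.
Proof.
have st c : norep c -> bounded c Fall by apply: bounded_static Fall_gt0 _.
rewrite /search_path; do 6!(apply: bounded_seq => //; first exact: st).
apply: (@bounded_rep Flev Fall Flev_gt0 _ _ (fun g K r => K)) => //.
- by move=> b me s0 g K r s e1 e2 e3 e4 he; rewrite /= he // e2.
- by move=> g K r; rewrite /Flev /Fall; nia.
- exact: Fall_gt0.
- exact: level_body_bounded.
Qed.

Lemma search_bounded : bounded search Fall.
Proof.
have st c : norep c -> bounded c Fall by apply: bounded_static Fall_gt0 _.
do 2!(apply: bounded_seq => //; first exact: st).
by apply: bounded_seq => //; apply: search_path_bounded.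
Qed.

Lemma classIv_bounded : bounded classIv Fgr.
Proof.
apply: bounded_seq => //; first exact: walk21.
by apply: bounded_static; [exact: Fgr_gt0|].
Qed.

Lemma nonempty_bounded : bounded nonempty Fnon.
Proof.
have st c : norep c -> bounded c Fnon by apply: bounded_static Fnon_gt0 _.
apply: bounded_seq => //; first exact: walk36.
apply: bounded_seq => //; first exact: st.
by apply: bounded_seq => //; [exact: walk36|exact: st].
Qed.

Lemma find_body_bounded : bounded find_body Fnon.
Proof.
have st c : norep c -> bounded c Fnon by apply: bounded_static Fnon_gt0 _.
apply: bounded_if; [exact: Fnon_gt0|exact: st|].
apply: bounded_seq => //; first exact: st.
apply: bounded_if; [exact: Fnon_gt0| |exact: st].
apply: bounded_seq => //; last exact: nonempty_bounded.
by apply: bounded_weak classIv_bounded => g K r; rewrite /Fnon leq_pmull // addn1.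
Qed.

Lemma bsearch_bounded : bounded bsearch Fgr.
Proof.
have st c : norep c -> bounded c Fgr by apply: bounded_static Fgr_gt0 _.
do 2!(apply: bounded_seq => //; first exact: st).
apply: (@bounded_rep (fun _ _ _ => 1) Fgr _ _ _ (fun g K r => g + r)) => //.
- move=> b me s0 g K r s e1 e2 e3 e4 he; rewrite /= /opval; apply: leq_trans (leq_mod _ _) _.
  by rewrite !he // e1 e3.
- by move=> g K r; rewrite /Fgr; lia.
- exact: Fgr_gt0.
- exact: bounded_static.
Qed.

Lemma dir_main_bounded : bounded dir_main Fall.
Proof.
have st c : norep c -> bounded c Fall by apply: bounded_static Fall_gt0 _.
have FF g K r : Fgr g K r <= Fall g K r by apply: leq_trans (Fgr_Flev g K r) (Flev_Fall g K r).
apply: bounded_seq => //; first exact: bounded_weak FF bsearch_bounded.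
do 3!(apply: bounded_seq => //; first exact: st).
apply: bounded_seq => //; first exact: bounded_weak FF classIv_bounded.
apply: bounded_seq => //; first exact: search_bounded.
apply: bounded_if; [exact: Fall_gt0|exact: st|].
do 2!(apply: bounded_seq => //; first exact: st).
apply: bounded_seq => //.
  apply: (@bounded_rep Fnon Fall Fnon_gt0 _ _ (fun g K r => 2 ^ g)) => //.
  - by move=> b me s0 g K r s e1 *; apply: pow21 e1 _.
  - exact: Fall_gt0.
  - exact: find_body_bounded.
apply: bounded_if; [exact: Fall_gt0|exact: search_bounded|exact: st].
Qed.

(** * Loading the parameters *)

(** Two numbers that add up to [k] ones are bitwise complements: in each position exactly one has a
    1, by induction from the lowest bit. *)
Lemma land_compl k a c : a + c = 2 ^ k - 1 -> Nat.land a c = 0.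
Proof.
elim: k a c => [|k IH] a c; first by rewrite expn0 => h; have [-> ->] : a = 0 /\ c = 0 by lia.
rewrite expnS => h; have := expn_gt0 2 k => /= k0.
have ea := odd_double_half a; have ec := odd_double_half c.
rewrite -ea -ec; move: h; rewrite -{1}ea -{1}ec.
case: (odd a); case: (odd c); rewrite ?add1n ?add0n -!mul2n => h.
- by exfalso; move: h k0; clear; lia.
- rewrite -addn1 Nat.land_odd_even IH //; move: h k0; clear; lia.
- rewrite -[in X in Nat.land _ X]addn1 Nat.land_even_odd IH //; move: h k0; clear; lia.
- by exfalso; move: h k0; clear; lia.
Qed.

(** Above the lowest set bit a number and its negative are complementary, below it both are zero,
    and the bit itself is shared. *)
Lemma land_lowbit b j Y : 2 ^ j * (2 * Y + 1) < 2 ^ b ->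
  Nat.land (2 ^ j * (2 * Y + 1)) (2 ^ b - 2 ^ j * (2 * Y + 1)) = 2 ^ j.
Proof.
elim: j b => [|j IH] b h.
  rewrite expn0 !mul1n in h *; case: b h => [|b]; first by rewrite expn0; lia.
  rewrite expnS => h; have := expn_gt0 2 b => /= b0.
  have -> : 2 * 2 ^ b - (2 * Y + 1) = 2 * (2 ^ b - 1 - Y) + 1 by move: h b0; clear; lia.
  by rewrite Nat.land_odd_odd (@land_compl b) //; move: h b0; clear; lia.
case: b h => [|b]; first by rewrite expn0 expnS; have := expn_gt0 2 j => /=; nia.
rewrite !expnS -!mulnA ltn_pmul2l // => h.
by rewrite -mulnBr Nat.land_even_even IH.
Qed.

(* The width of the fields is itself unknown to the program: the lowest set bit
   of the first word, isolated by [x land (-x)], gives the length [j] of its code. *)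
Definition header (j lam : nat) : seq bool :=
  nseq j false ++ true :: enc j lam ++ nseq (lam - (2 * j + 1)) false.

Lemma size_header j lam : 2 * j + 1 <= lam -> size (header j lam) = lam.
Proof.
by move=> h; rewrite size_cat /= size_cat !size_nseq size_enc; lia.
Qed.

(** [Z] collects the bits after the code of [lam]. In this form the lowest set bit reveals [j], and
    dividing by its double and reducing modulo [2 ^ j] gives [lam]. *)
Lemma header_word j lam rest w : 2 * j + 1 <= lam -> lam < 2 ^ j -> 2 * j + 1 <= w ->
  exists Z, bval (header j lam ++ rest) 0 w = 2 ^ j * (2 * (lam + 2 ^ j * Z) + 1).
Proof.
move=> h1 h2 h3; set bits := header j lam ++ rest.
exists (bval bits (j + 1 + j) (w - (2 * j + 1))).
have -> : w = j + (1 + (j + (w - (2 * j + 1)))) by lia.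
rewrite bval_split bval_split bval_split !add0n.
have -> : bval bits 0 j = 0.
  apply: big1 => i _; rewrite add0n /bits /header -catA nth_cat size_nseq ltn_ord nth_nseq.
  by rewrite ltn_ord.
have -> : bval bits j 1 = 1.
  rewrite /bval big_ord1 addn0 muln1 /bits /header -catA nth_cat size_nseq ltnn subnn /=.
  by [].
have -> : bval bits (j + 1) j = lam.
  have -> : bits = (nseq j false ++ [:: true]) ++ enc j lam ++ (nseq (lam - (2 * j + 1)) false ++ rest).
    by rewrite /bits /header -!catA /= -!catA.
  have := @bval_cat (nseq j false ++ [:: true]) (enc j lam) (nseq (lam - (2 * j + 1)) false ++ rest) 0 j.
  by rewrite size_cat size_nseq /= addn0 size_enc => ->; rewrite ?bval_enc.
have -> : j + (1 + (j + (w - (2 * j + 1)))) - (2 * j + 1) = w - (2 * j + 1) by lia.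
by rewrite expn1 add0n [1 + _]addnC -[j + 1 + j]addnA.
Qed.

Definition read_width :=
  90 ::= Ld $10;; 91 ::= Bin OAnd $90 (#0 - $90);; 20 ::= ($90 %/ ($91 + $91)) %% $91.

Fixpoint loads (k : nat) : cmd :=
  if k is k'.+1 then loads k';; 21 + k' ::= rd (#(k'.+1) * $20) $20 else Skip.

(** The final load turns the rank found into its value. If none was found, the address is arbitrary,
    and the flag 0 tells that the value is not an answer. *)
Definition dir_run (d : nat) :=
  70 ::= #d;; dir_main;; 94 + 2 * d ::= $75;; 95 + 2 * d ::= Ld (($72 <<< $23) + $76).

Definition load_params := read_width;; loads 16.

(** The columns become a half-open interval, made empty rather than reversed if [x1 < x0]. Rows are
    stored increased by 1, so the exclusive bounds are [y0] and [y1 + 2] and no subtraction can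
    underflow. *)
Definition load_query :=
  63 ::= $3;; 64 ::= $4 + #1;; If ($64 < $63) (64 ::= $63) Skip;;
  78 ::= $5;; 79 ::= $6 + #2.

Definition big := load_params;; load_query;; dir_run 0;; dir_run 1.

Section Load.
Variables (b n : nat) (me : nat -> nat) (j lam : nat) (ps : seq nat) (rest : seq bool).
Local Notation M := (2 ^ b).
Local Notation sem := (sem b me).
Local Notation ev e s := (eval b me e s).
Local Notation pre := (header j lam ++ fields lam ps).
Local Notation bits := (pre ++ rest).
Hypotheses (hb : 0 < b) (hbM : b < M).
Hypothesis hme : forall j, j < nwords b bits -> me (n + j) = word_at b bits j.
Hypothesis hadr : n + nwords b bits <= M.
Hypotheses (hj : 2 * j + 1 <= lam) (hlj : lam < 2 ^ j) (hlb : lam <= b) (j0 : 0 < j).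
Hypothesis hps : forall i, i < size ps -> nth 0 ps i < 2 ^ lam.
Hypothesis hbits : size bits < M.

Lemma read_widthP s : s 10 = n -> sem read_width s 20 = lam.
Proof.
move=> h10.
have w0 : 0 < nwords b bits.
  rewrite /nwords leq_divRL // mul1n size_cat size_cat size_header //; clear -hj j0 hb; lia.
have [Z hZ] := @header_word j lam (fields lam ps ++ rest) b hj hlj (leq_trans hj hlb).
set X := 2 ^ j * _ in hZ.
have hX : me n = X.
  by rewrite -[n]addn0 hme // word_atE mul0n -hZ catA.
have XM : X < M by rewrite -hZ; apply: bval_lt.
have nM : n < M by clear -w0 hadr; lia.
have p1 : ev (Ld $10) s = X by rewrite /= h10 hX modn_small.
pose s1 := upd s 90 X; have s90 : s1 90 = X by [].
have X0 : 0 < X by rewrite /X muln_gt0 expn_gt0 addn1.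
have p2 : ev (Bin OAnd $90 (#0 - $90)) s1 = 2 ^ j.
  have e1 : ev $90 s1 = X by [].
  have e2 : ev (#0 - $90) s1 = M - X.
    rewrite /= /opval mod0n add0n s90 (@modn_small X) // modn_small //.
    by clear -X0 XM; lia.
  rewrite /= in e2; rewrite /= e2 s90 /opval land_lowbit // modn_small //.
  by apply: leq_ltn_trans XM; rewrite /X leq_pmulr // addn1.
pose s2 := upd s1 91 (2 ^ j).
have jM : 2 ^ j + 2 ^ j < M.
  rewrite addnn -mul2n -expnS ltn_exp2l //; clear -hj hlb j0; lia.
have p3 : ev (($90 %/ ($91 + $91)) %% $91) s2 = lam.
  have -> : lam = X %/ (2 ^ j + 2 ^ j) %% 2 ^ j.
    rewrite addnn -muln2 divnMA /X mulKn ?expn_gt0 // divn2 addn1 mul2n /=.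
    by rewrite uphalf_double addnC mulnC modnMDl modn_small.
  apply: evMod => //; last by apply: leq_ltn_trans (leq_div _ _) XM.
  by apply: evDiv => //; apply: evAdd.
rewrite /read_width (semSeq _ _ (Asn 90 _)) (semAsn _ _ 90) p1 -/s1.
by rewrite (semSeq _ _ (Asn 91 _)) (semAsn _ _ 91) p2 -/s2 semAsn p3 updE.
Qed.

Lemma loadsP s k : s 8 = b -> s 10 = n -> s 20 = lam -> k <= size ps ->
  (forall i, i < k -> sem (loads k) s (21 + i) = nth 0 ps i) /\
  (forall x, (x < 21) || (21 + k <= x) -> sem (loads k) s x = s x).
Proof.
move=> h8 h10 h20; elim: k => [|k IH] hk; first by split.
have [I1 I2] := IH (ltnW hk).
set t := sem (loads k) s in I1 I2 *.
have t8 : t 8 = b by rewrite I2.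
have t10 : t 10 = n by rewrite I2.
have t20 : t 20 = lam by rewrite I2.
have sz : k.+1 * lam + lam <= size bits.
  rewrite size_cat size_cat size_header // size_fields.
  by apply: leq_trans (leq_addr _ _); rewrite mulSn -addnA leq_add2l addnC -mulSn leq_mul2r hk orbT.
have lam0 : 0 < lam by clear -hj; lia.
have kM : k.+1 * lam < M by clear -sz hbits; lia.
have e : ev (rd (#(k.+1) * $20) $20) t = nth 0 ps k.
  rewrite (eval_rdE hb hbM hme hadr t8 (t10 : ev $10 t = n) (p := k.+1 * lam) (w := lam)) //.
  - have := @bval_cat (header j lam) (fields lam ps) rest (k * lam) lam.
    rewrite size_header // -mulSn catA => ->; last by rewrite size_fields addnC -mulSn leq_mul2r hk orbT.
    by rewrite bval_fields // hps.
  - apply: evMul => //; apply: evCst; apply: leq_ltn_trans kM; exact: leq_pmulr.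
have -> : sem (loads k.+1) s = upd t (21 + k) (nth 0 ps k).
  by rewrite [loads k.+1]/= semSeq semAsn -/t e.
split.
  move=> i; rewrite ltnS leq_eqVlt => /orP[/eqP->|hi]; first by rewrite updE eqxx.
  by rewrite updE ifN ?I1 //; clear -hi; lia.
move=> x hx; rewrite updE ifN; last by clear -hx; lia.
by apply: I2; clear -hx; lia.
Qed.

End Load.

(** * Layout of the structure and ranks of values *)

Section Levels.
Variables (T : eqType) (pts : seq T) (cl yy rm : T -> nat) (g K r : nat).
Local Notation LL := (K * g).
Local Notation n := (size pts).
Local Notation o1 := (class_order pts cl g).
Local Notation ord := (level_order pts cl yy g K).

(** The remainders of super-level [k] are taken in the order after [k + 1] digits, because the
    search examines children: in this order each child of a node, within a class, is a contiguous
    slice. *)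
Definition rem_levels := flatten [seq bitmaps (digits rm r) (ord k.+1) | k <- iota 0 K].
Definition level_bits := bitmaps (digits cl g) pts ++ bitmaps (digits yy LL) o1 ++ rem_levels.

Lemma size_o1 : size o1 = n. Proof. exact: size_after. Qed.
Lemma size_ord k : size (ord k) = n. Proof. by rewrite size_after size_o1. Qed.

Lemma size_rem_levels : size rem_levels = K * (r * n).
Proof.
rewrite (@size_flatten_const _ _ (r * n)) ?size_map ?size_iota // => j hj.
by rewrite (nth_map 0) ?size_iota // size_bitmaps size_digits size_ord.
Qed.

Lemma size_level_bits : (g + LL) * n + K * (r * n) = size level_bits.
Proof.
by rewrite !size_cat size_rem_levels !size_bitmaps !size_digits size_o1 mulnDl addnA.
Qed.

Lemma level_seg1 : take (g * n) (drop 0 level_bits) = bitmaps (digits cl g) pts.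
Proof. by rewrite drop0 take_size_cat // size_bitmaps size_digits. Qed.

Lemma level_seg2 : take (LL * n) (drop (g * n) level_bits) = bitmaps (digits yy LL) o1.
Proof.
rewrite drop_size_cat ?size_bitmaps ?size_digits // take_size_cat //.
by rewrite size_bitmaps size_digits size_o1.
Qed.

Lemma level_seg3 k : k < K ->
  take (r * n) (drop ((g + LL) * n + k * (r * n)) level_bits) = bitmaps (digits rm r) (ord k.+1).
Proof.
move=> hk; rewrite addnC -drop_drop /level_bits catA drop_size_cat; last first.
  by rewrite size_cat !size_bitmaps !size_digits size_o1 mulnDl.
have hk' : k < size [seq bitmaps (digits rm r) (ord k.+1) | k <- iota 0 K] by rewrite size_map size_iota.
have [|A [C [e sA]]] := flatten_nth_cat hk' (w := r * n).
  move=> j; rewrite size_map size_iota => hj.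
  by rewrite (nth_map 0) ?size_iota // size_bitmaps size_digits size_ord.
rewrite /rem_levels e drop_size_cat // (nth_map 0) ?size_iota // nth_iota // add0n.
by rewrite take_size_cat // size_bitmaps size_digits size_ord.
Qed.

End Levels.

Section Values.
Variables (n : nat) (pi : {perm 'I_n}) (wv : 'I_n -> nat).
Local Notation vt := (value_table wv).

Lemma mem_vt x : wv x \in vt.
Proof. by rewrite mem_sort mem_undup map_f // mem_enum. Qed.

Lemma vt_mono i j : i <= j -> j < size vt -> nth 0 vt i <= nth 0 vt j.
Proof.
move=> ij hj; apply: (sorted_leq_nth leq_trans leqnn) => //.
- exact: (sort_sorted leq_total).
- by rewrite inE (leq_ltn_trans ij).
Qed.

Lemma vt_mem i : i < size vt -> exists x, wv x = nth 0 vt i.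
Proof.
move=> h; have : nth 0 vt i \in vt by rewrite mem_nth.
by rewrite mem_sort mem_undup => /mapP[x _ ->]; exists x.
Qed.

Definition vrank x := index (wv x) vt.

Lemma vrank_lt x : vrank x < size vt. Proof. by rewrite index_mem mem_vt. Qed.
Lemma nth_vrank x : nth 0 vt (vrank x) = wv x. Proof. by rewrite nth_index // mem_vt. Qed.

Lemma vrank_le x y : vrank x <= vrank y -> wv x <= wv y.
Proof. by move=> h; rewrite -(nth_vrank x) -(nth_vrank y) vt_mono // vrank_lt. Qed.

Lemma size_vt_n : size vt <= n.
Proof.
by rewrite size_sort (leq_trans (size_undup _)) // size_map size_enum_ord.
Qed.

Lemma size_vt_W W : (forall x, wv x < W) -> size vt <= W.
Proof.
move=> h; rewrite size_sort -(size_iota 0 W); apply: uniq_leq_size; first exact: undup_uniq.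
by move=> v; rewrite mem_undup mem_iota => /mapP[x _ ->]; rewrite h.
Qed.

Lemma mem_slice_enum i j (x : 'I_n) : i <= j <= n ->
  (x \in slice i j (enum 'I_n)) = (i <= x < j).
Proof.
move=> /andP[ij jn].
have u : uniq (enum 'I_n) by apply: enum_uniq.
have -> : slice i j (enum 'I_n) = [seq z <- enum 'I_n | i <= val z < j].
  (* Generalised to a run of columns starting at [m], so that the induction can drop the first
     column. *)
  have e : forall (s : seq 'I_n) m, map val s = iota m (size s) ->
     drop (i - m) (take (j - m) s) = [seq z <- s | i <= val z < j].
    elim=> [|z s IH] m //= [ez es]; case: (ltnP m j) => mj; last first.
      have -> : j - m = 0 by lia.
      rewrite /= ez [m < j]ltnNge mj andbF -(IH m.+1) //.
      have j0 : j - m.+1 = 0 by lia.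
      by rewrite j0 take0.
    have -> : j - m = (j - m.+1).+1 by lia.
    rewrite ez mj andbT /=; case: (leqP i m) => im.
      have -> : i - m = 0 by lia.
      have i0 : i - m.+1 = 0 by lia.
      by rewrite -(IH m.+1) // i0 !drop0.
    have -> : i - m = (i - m.+1).+1 by lia.
    by rewrite /= -(IH m.+1).
  have := e (enum 'I_n) 0; rewrite !subn0 => <- //.
  by rewrite val_enum_ord size_enum_ord.
by rewrite mem_filter mem_enum andbT.
Qed.

Lemma foldr_minn v s : foldr minn v s \in v :: s /\ forall z, z \in v :: s -> foldr minn v s <= z.
Proof.
elim: s => [|a s [IH1 IH2]] /=; first by split=> [|z]; rewrite ?inE // => /eqP->.
split.
  rewrite /minn; case: ifP => _; first by rewrite !inE eqxx orbT.
  by move: IH1; rewrite !inE => /orP[->|->]; rewrite ?orbT.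
move=> z; rewrite !inE orbCA => /orP[/eqP->|h]; first exact: geq_minl.
by apply: leq_trans (geq_minr _ _) _; apply: IH2; rewrite inE.
Qed.

Lemma foldr_maxn v s : foldr maxn v s \in v :: s /\ forall z, z \in v :: s -> z <= foldr maxn v s.
Proof.
elim: s => [|a s [IH1 IH2]] /=; first by split=> [|z]; rewrite ?inE // => /eqP->.
split.
  rewrite /maxn; case: ifP => _; last by rewrite !inE eqxx orbT.
  by move: IH1; rewrite !inE => /orP[->|->]; rewrite ?orbT.
move=> z; rewrite !inE orbCA => /orP[/eqP->|h]; first exact: leq_maxl.
by apply: leq_trans (IH2 z _) (leq_maxr _ _); rewrite inE.
Qed.

Variables (w x0 x1 y0 y1 : nat).
Local Notation R := (in_rect pi x0 x1 y0 y1).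

Lemma mem_vals (p : pred nat) v : (v \in [seq v <- vals_in pi wv x0 x1 y0 y1 | p v]) =
  [exists x, [&& R x, p (wv x) & wv x == v]].
Proof.
rewrite mem_filter; apply/andP/existsP.
  case=> hp /mapP[x]; rewrite mem_filter => /andP[h1 h2] e; exists x.
  by rewrite h1 -e hp eqxx.
case=> x /and3P[h1 h2 /eqP <-]; split=> //; apply: map_f.
by rewrite mem_filter h1 mem_enum.
Qed.

Lemma Succ_some x : R x -> w <= wv x -> (forall z, R z -> w <= wv z -> wv x <= wv z) ->
  Succ pi wv w x0 x1 y0 y1 = Some (wv x).
Proof.
move=> h1 h2 h3; have m := mem_vals (fun v => w <= v).
rewrite /Succ; case E : [seq _ <- _ | _] m => [|v s] m.
  by have := m (wv x); rewrite in_nil => /esym/existsP[]; exists x; rewrite h1 h2 eqxx.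
congr Some; have [q1 q2] := foldr_minn v s; apply/eqP; rewrite eqn_leq; apply/andP; split.
  by apply: q2; rewrite m; apply/existsP; exists x; rewrite h1 h2 eqxx.
by move: q1; rewrite m => /existsP[z /and3P[z1 z2 /eqP <-]]; apply: h3.
Qed.

Lemma Succ_none : (forall z, R z -> ~~ (w <= wv z)) -> Succ pi wv w x0 x1 y0 y1 = None.
Proof.
move=> h; have m := mem_vals (fun v => w <= v).
rewrite /Succ; case E : [seq _ <- _ | _] m => [|v s] m //.
have := m v; rewrite inE eqxx /= => /esym/existsP[x /and3P[h1 h2 _]].
by have := h x h1; rewrite h2.
Qed.

Lemma Pred_some x : R x -> wv x <= w -> (forall z, R z -> wv z <= w -> wv z <= wv x) ->
  Pred pi wv w x0 x1 y0 y1 = Some (wv x).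
Proof.
move=> h1 h2 h3; have m := mem_vals (fun v => v <= w).
rewrite /Pred; case E : [seq _ <- _ | _] m => [|v s] m.
  by have := m (wv x); rewrite in_nil => /esym/existsP[]; exists x; rewrite h1 h2 eqxx.
congr Some; have [q1 q2] := foldr_maxn v s; apply/eqP; rewrite eqn_leq; apply/andP; split.
  by move: q1; rewrite m => /existsP[z /and3P[z1 z2 /eqP <-]]; apply: h3.
by apply: q2; rewrite m; apply/existsP; exists x; rewrite h1 h2 eqxx.
Qed.

Lemma Pred_none : (forall z, R z -> ~~ (wv z <= w)) -> Pred pi wv w x0 x1 y0 y1 = None.
Proof.
move=> h; have m := mem_vals (fun v => v <= w).
rewrite /Pred; case E : [seq _ <- _ | _] m => [|v s] m //.
have := m v; rewrite inE eqxx /= => /esym/existsP[x /and3P[h1 h2 _]].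
by have := h x h1; rewrite h2.
Qed.

Definition answer (dir : bool) := if dir then Pred pi wv w x0 x1 y0 y1 else Succ pi wv w x0 x1 y0 y1.

(** Transfers an optimum over ranks to values: [E] separates the ranks as the query value separates
    the values, and the table is monotone. *)
Lemma answerP dir E cur :
  (forall i, i < size vt -> (i < E) = below dir w (nth 0 vt i)) ->
  best_of vrank dir E cur R ->
  answer dir = omap (nth 0 vt) cur.
Proof.
move=> hE; have el z : eligible dir E (vrank z) = if dir then wv z <= w else w <= wv z.
  have := hE _ (vrank_lt z); rewrite nth_vrank /eligible /below.
  by case: dir hE => hE // h; rewrite leqNgt h -leqNgt.
case: cur => [v|] /=.
  case=> [[x hx <-] [hel hb]]; rewrite nth_vrank; move: hel; rewrite el /answer => hel.
  case: dir hE el hb hel => hE el hb hel; [apply: Pred_some|apply: Succ_some] => // z hz hw;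
    by apply: vrank_le; apply: (hb z hz); rewrite el.
move=> h; rewrite /answer; case: dir hE el h => hE el h; [apply: Pred_none|apply: Succ_none];
  by move=> z hz; have := h z hz; rewrite el.
Qed.

End Values.

(** * Correctness for large grids *)

Section Structure.
Variables (n : nat) (pi : {perm 'I_n}) (wv : 'I_n -> nat).
Variables (j lam rho u q H g K r : nat).
Local Notation G := (cellw u q).
Local Notation sb := (lam + 16 * lam).

Definition wavelet : seq bool :=
  level_bits (enum 'I_n) (fun x => vrank wv x %/ 2 ^ r) (fun x => (pi x).+1)
    (fun x => vrank wv x %% 2 ^ r) g K r.
(** The order is that of the registers: entry [i] is loaded into register [21 + i], where [rank_env]
    and the searches expect it. *)
Definition params : seq nat :=
  [:: g; K; r; u; q; q * u; q * (q * u); G; G - H; H; rho; sb; relbase wavelet lam u q sb;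
      cellbase wavelet lam rho u q sb; tabAbase wavelet lam rho u q sb; K * g].
Definition structure : seq bool :=
  (header j lam ++ fields lam params) ++ rank_bits wavelet lam rho u q H sb.

Lemma size_wavelet : size wavelet = (g + K * g) * n + K * (r * n).
Proof. by rewrite -size_level_bits size_enum_ord. Qed.

End Structure.

Section Big.
Variables (n : nat) (pi : {perm 'I_n}) (wv : 'I_n -> nat).
Variables (j lam rho u q H g K r : nat).
Variables (b : nat) (me : nat -> nat) (x0 x1 y0 y1 w : nat) (st : state).
Local Notation G := (cellw u q).
Local Notation sb := (lam + 16 * lam).
Local Notation M := (2 ^ b).
Local Notation B := (wavelet pi wv g K r).
Local Notation ps := (params pi wv lam rho u q H g K r).
Local Notation pre := (header j lam ++ fields lam ps).
Local Notation bits := (structure pi wv j lam rho u q H g K r).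
Local Notation vt := (value_table wv).
Local Notation sem := (sem b me).
Hypotheses (hb : 0 < b) (hbM : b < M) (hM : 4 < M).
Hypothesis hme : forall i, i < nwords b bits -> me (n + i) = word_at b bits i.
Hypothesis hadr : n + nwords b bits <= M.
Hypothesis me_vt : forall i, i < size vt -> me i = nth 0 vt i.
Hypothesis vtM : forall x, wv x < M.
Hypotheses (u0 : 0 < u) (q0 : 0 < q) (hH : u.+1 ^ q * 4 <= 2 ^ H) (hHG : H <= G).
Hypotheses (hlam : size bits < 2 ^ lam) (hrho : q * (q * u) < 2 ^ rho).
Hypotheses (hlb : lam <= b) (hrb : rho <= lam) (hHb : H <= lam) (hub : u <= lam) (lam4 : 3 < lam).
Hypotheses (j0 : 0 < j) (hj : 2 * j + 1 <= lam) (hlj : lam < 2 ^ j).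
Hypotheses (n0 : 0 < n) (g0 : 0 < g) (K0 : 0 < K).
Hypotheses (vt_lt : size vt < 2 ^ (g + r)) (nLL : n.+1 < 2 ^ (K * g)).
Hypotheses (mxM : 2 * 2 ^ (g + r) < M) (ngM : n.+1 + 2 * 2 ^ g < M).
Hypotheses (s0 : st 0 = n) (s3 : st 3 = x0) (s4 : st 4 = x1) (s5 : st 5 = y0) (s6 : st 6 = y1)
  (s7 : st 7 = w) (s8 : st 8 = b) (s9 : st 9 = size vt) (s10 : st 10 = n).
Hypotheses (x0n : x0 < n) (x1n : x1 < n) (y0n : y0 < n) (y1n : y1 < n).

Let size_pre : size pre = sb.
Proof. by rewrite size_cat size_header // size_fields. Qed.

Let bitsE : bits = pre ++ rank_bits B lam rho u q H (size pre).
Proof. by rewrite size_pre. Qed.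

Let hlam' : size (pre ++ rank_bits B lam rho u q H (size pre)) < 2 ^ lam.
Proof. by rewrite -bitsE. Qed.

Let sizeE : size bits = tabDbase B lam rho u q H sb + u.+1 * 2 ^ u * u * lam.
Proof. by rewrite bitsE size_bitsE // size_pre. Qed.

Let tabA_le : tabAbase B lam rho u q sb <= size bits.
Proof. by rewrite sizeE /tabDbase -addnA leq_addr. Qed.

Let size_B : size B < 2 ^ lam.
Proof. exact: (sizeB_bits u0 q0 hH hHG hlam' hrho). Qed.

Lemma params_lt i : i < size ps -> nth 0 ps i < 2 ^ lam.
Proof.
have tA : tabAbase B lam rho u q sb < 2 ^ lam by apply: leq_ltn_trans hlam.
have cB : cellbase B lam rho u q sb <= tabAbase B lam rho u q sb by apply: leq_addr.
have rB : relbase B lam u q sb <= cellbase B lam rho u q sb by apply: leq_addr.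
have sB : sb <= relbase B lam u q sb by apply: leq_addr.
have GA : G <= tabAbase B lam rho u q sb.
  by apply: leq_trans (leq_addl _ _); apply: leq_pmull.
have SU : q * (q * u) < 2 ^ lam by apply: leq_trans hrho _; rewrite leq_exp2l.
have qu : q * u <= q * (q * u) by apply: leq_pmull.
have uu : u <= q * u by apply: leq_pmull.
have qq : q <= q * u by apply: leq_pmulr.
have SB := size_B; rewrite size_wavelet in SB.
have KL : K * g <= (g + K * g) * n + K * (r * n).
  apply: leq_trans (leq_addr _ _); apply: leq_trans (leq_pmulr _ n0); exact: leq_addl.
have gL : g <= (g + K * g) * n + K * (r * n).
  apply: leq_trans (leq_addr _ _); apply: leq_trans (leq_pmulr _ n0); exact: leq_addr.
have KK : K <= K * g by apply: leq_pmulr.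
have rr : r <= (g + K * g) * n + K * (r * n).
  apply: leq_trans (leq_addl _ _); apply: leq_trans (leq_pmull _ K0); exact: leq_pmulr.
have ll : lam < 2 ^ lam by apply: ltn_expl.
rewrite /params; move: (tabAbase _ _ _ _ _ _) (cellbase _ _ _ _ _ _) (relbase _ _ _ _ _) tA cB rB sB GA => tA cB rB.
move: SB KL gL rr; move: (_ + K * (r * n)) => N.
move: hrb hHb hub hHG; move: (2 ^ lam) ll SU => X ll SU.
move: (K * g) KK (q * (q * u)) SU qu => LL KK S SU qu; move: (q * u) uu qq qu => qu uu qq quS.
move: (cellw u q) => GG; clear -ll uu qq quS SU KK.
by case: i => [|[|[|[|[|[|[|[|[|[|[|[|[|[|[|[|[|i]]]]]]]]]]]]]]]]] //=; lia.
Qed.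

Let loads_ok : sem read_width st 20 = lam /\
  forall i, i < 16 -> sem load_params st (21 + i) = nth 0 ps i.
Proof.
have h20 : sem read_width st 20 = lam.
  exact: (read_widthP (ps := ps) (rest := rank_bits B lam rho u q H sb) hb hme hadr hj hlj hlb j0 s10).
split=> // i hi; rewrite semSeq.
have h1 k : k < 20 -> sem read_width st k = st k.
  by move=> hk; apply: sem_frame; rewrite !inE; clear -hk; lia.
have bl : size bits < M by apply: leq_trans hlam _; rewrite leq_exp2l.
have e8 : sem read_width st 8 = b by rewrite h1.
have e10 : sem read_width st 10 = n by rewrite h1.
have [|E _] := loadsP (k := 16) hb hbM hme hadr hj hlb params_lt bl e8 e10 h20; first by [].
exact: E.
Qed.

Lemma big_loadP : exists s, [/\ sem load_params st = s,
  forall i, i < 20 -> s i = st i, s 20 = lam & forall i, i < 16 -> s (21 + i) = nth 0 ps i].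
Proof.
exists (sem load_params st); split=> //.
- move=> i hi; apply: sem_frame; rewrite !inE; clear -hi; lia.
- have [h20 _] := loads_ok; rewrite semSeq sem_frame //.
- by have [_ h] := loads_ok.
Qed.

Section Stage.
Variable s1 : state.
Hypotheses (s1_st : forall i, i < 20 -> s1 i = st i) (s1_20 : s1 20 = lam)
  (s1_ps : forall i, i < 16 -> s1 (21 + i) = nth 0 ps i).

Lemma big_rank_ok s p : env s1 s -> s 40 = p -> p <= size B -> sem rankc s 41 = rank B p.
Proof.
move=> he h40 hp.
have hme' i : i < nwords b (pre ++ rank_bits B lam rho u q H (size pre)) ->
  me (n + i) = word_at b (pre ++ rank_bits B lam rho u q H (size pre)) i.
  by rewrite -bitsE; apply: hme.
have hadr' : n + nwords b (pre ++ rank_bits B lam rho u q H (size pre)) <= M by rewrite -bitsE.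
have hrb' : rho <= b by apply: leq_trans hlb.
have hHb' : H <= b by apply: leq_trans hlb.
have hub' : u <= b by apply: leq_trans hlb.
apply: (rankcP hb hbM hme' hadr' u0 q0 hH hHG hlam' hrho hlb hrb' hHb' hub' lam4 _ h40 hp).
have P i : i < 16 -> s (21 + i) = nth 0 ps i by move=> hi; rewrite he ?s1_ps // -[40]/(21 + 19) ltn_add2l; clear -hi; lia.
rewrite /rank_env size_pre; split; [split; [| | |split]|split; [| | |split; [| | |split]]].
- by rewrite he // s1_st // s8.
- by rewrite he // s1_st // s10.
- by rewrite he // s1_20.
- exact: (P 3).
- exact: (P 4).
- exact: (P 5).
- exact: (P 6).
- exact: (P 7).
- exact: (P 8).
- exact: (P 9).
- exact: (P 10).
- exact: (P 11).
- exact: (P 12).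
- exact: (P 13).
- exact: (P 14).
Qed.

Local Notation XI := x0.
Local Notation XJ := (maxn x0 x1.+1).
Definition xenv (s : state) := env s1 s /\ [/\ s 63 = XI, s 64 = XJ, s 78 = y0 & s 79 = y1 + 2].

Lemma prepP : exists s, sem load_query s1 = s /\ xenv s.
Proof.
exists (sem load_query s1).
have nM : n + 2 < M.
  have := expn_gt0 2 g; move: (2 ^ g) ngM; clear => X; lia.
split=> //; split; first exact: env_sem.
have e3 : s1 3 = x0 by rewrite s1_st.
have e4 : s1 4 = x1 by rewrite s1_st.
have e5 : s1 5 = y0 by rewrite s1_st.
have e6 : s1 6 = y1 by rewrite s1_st.
rewrite /load_query (semSeq _ _ (Asn 63 _)) (semAsn _ _ 63) [eval _ _ _ _]/= e3.
set t1 := upd s1 63 x0.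
rewrite (semSeq _ _ (Asn 64 _)) (semAsn _ _ 64).
have -> : eval b me ($4 + #1) t1 = x1.+1.
  rewrite -(addn1 x1); apply: evAdd => //; last by clear -x1n nM; lia.
  by apply: evCst; clear -hM; lia.
set t2 := upd t1 64 x1.+1.
rewrite (semSeq _ _ (If _ _ _)) semIf.
have -> : eval b me ($64 < $63) t2 = (x1.+1 < x0).
  by apply: evLt => //; clear -hM; lia.
set t3 := if _ then _ else _.
have [t64 tt] : t3 64 = XJ /\ forall i, i != 64 -> t3 i = t2 i.
  rewrite /t3; case: ltnP => h /=.
    split=> [|i hi]; last by rewrite updE (negbTE hi).
    rewrite updE eqxx /t2 updE /t1 updE /=; clear -h; lia.
  by split=> //; rewrite /t2 updE eqxx; clear -h; lia.
rewrite (semSeq _ _ (Asn 78 _)) (semAsn _ _ 78) (_ : eval b me ($5) t3 = y0); last by rewrite /= tt.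
rewrite semAsn.
have -> : eval b me ($6 + #2) (upd t3 78 y0) = y1 + 2.
  apply: evAdd; [by rewrite /= updE /= tt| |by clear -y1n nM; lia].
  by apply: evCst; clear -hM; lia.
split; rewrite !updE //=; first by rewrite tt.
Qed.

Lemma slice_rect x : (x \in slice XI XJ (enum 'I_n)) && ((y0 < (pi x).+1) && ((pi x).+1 < y1 + 2))
  = in_rect pi x0 x1 y0 y1 x.
Proof.
have h : x0 <= XJ <= n by rewrite leq_maxl geq_max x1n (ltnW x0n).
rewrite (mem_slice_enum _ h) /in_rect addn2 !ltnS leq_max.
by case: (leqP x0 x) => //= h1; rewrite ltnS ltnNge h1.
Qed.

Lemma dir_main_mods : all (fun x => x \notin mods dir_main) [:: 63; 64; 78; 79; 94; 95; 96; 97].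
Proof. by vm_compute. Qed.

(** The last clause protects the answer of the other direction, so that the two runs can be
    composed. *)
Lemma dir_runP (d : bool) s : xenv s -> exists s', [/\ sem (dir_run d) s = s', xenv s',
  correct_output (answer pi wv w x0 x1 y0 y1 d) (s' (94 + 2 * d)) (s' (95 + 2 * d)) &
  s' (94 + 2 * ~~ d) = s (94 + 2 * ~~ d) /\ s' (95 + 2 * ~~ d) = s (95 + 2 * ~~ d)].
Proof.
move=> [he [h63 h64 h78 h79]].
have dM : d < M by clear -hM; case: (d) => /=; lia.
set t := upd s 70 d.
have et : sem (70 ::= #d) s = t by rewrite semAsn /= modn_small.
have ht : denv s1 x0 XJ y0 (y1 + 2) d t.
  by split; first exact: env_upd.
have size_B_M : size B < M by apply: leq_trans size_B _; rewrite leq_exp2l.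
have vkv i : i < size vt -> nth 0 vt i < M.
  by move=> hi; have [x <-] := vt_mem hi; apply: vtM.
have hv x : vrank wv x < 2 ^ (g + r) by apply: leq_trans (ltnW vt_lt); exact: vrank_lt.
have LLn : K * g <= size B.
  rewrite size_wavelet; apply: leq_trans (leq_addr _ _); apply: leq_trans (leq_pmulr _ n0).
  exact: leq_addl.
have rM : 2 ^ r < M.
  apply: leq_ltn_trans mxM; rewrite mul2n -addnn; apply: leq_trans (leq_addr _ _).
  by rewrite leq_exp2l // leq_addl.
have gM : 2 * 2 ^ g < M by apply: leq_ltn_trans ngM; exact: leq_addl.
have nB : n <= size B.
  by rewrite size_wavelet; apply: leq_trans (leq_addr _ _); rewrite leq_pmull // addn_gt0 g0.
have hX : x0 <= XJ <= n by rewrite leq_maxl geq_max x1n (ltnW x0n).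
have P i : i < 16 -> s1 (21 + i) = nth 0 ps i by exact: s1_ps.
have e0 : s1 0 = n by rewrite s1_st.
have e9 : s1 9 = size vt by rewrite s1_st.
have e7 : s1 7 = w by rewrite s1_st.
have clh (x : 'I_n) : vrank wv x %/ 2 ^ r < 2 ^ g by rewrite ltn_divLR ?expn_gt0 // -expnD.
have yyh (x : 'I_n) : (pi x).+1 < 2 ^ (K * g) by apply: leq_ltn_trans nLL; apply: leqW; apply: ltn_ord.
have rmh (x : 'I_n) : vrank wv x %% 2 ^ r < 2 ^ r by rewrite ltn_mod expn_gt0.
have sE : size (enum 'I_n) = n by apply: size_enum_ord.
have seg1 := level_seg1 (enum 'I_n) (fun x => vrank wv x %/ 2 ^ r) (fun x => (pi x).+1)
    (fun x => vrank wv x %% 2 ^ r) g K r.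
have seg2 := level_seg2 (enum 'I_n) (fun x => vrank wv x %/ 2 ^ r) (fun x => (pi x).+1)
    (fun x => vrank wv x %% 2 ^ r) g K r.
have seg3 := @level_seg3 _ (enum 'I_n) (fun x => vrank wv x %/ 2 ^ r) (fun x => (pi x).+1)
    (fun x => vrank wv x %% 2 ^ r) g K r.
rewrite !sE -/(wavelet pi wv g K r) in seg1 seg2 seg3.
have yA : y0.+1 < 2 ^ (K * g) by apply: leq_ltn_trans nLL; apply: leqW.
have yB : y1 + 2 < 2 ^ (K * g) by apply: leq_ltn_trans nLL; rewrite addn2.
have AM : y0 + 2 * 2 ^ g < M by apply: leq_ltn_trans ngM; rewrite leq_add2r; apply: leqW; apply: ltnW.
have BM : y1 + 2 + 2 * 2 ^ g < M by apply: leq_ltn_trans ngM; rewrite leq_add2r addn2.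
have mono i k : i <= k -> k < size vt -> nth 0 vt i <= nth 0 vt k by exact: vt_mono.
have [s' [cur [E [q1 E1 hres [_ hE] hb1]]]] := dir_mainP big_rank_ok e0 size_B_M hM nB
  (P 0 isT) (P 1 isT) (P 2 isT) (P 15 isT) sE clh yyh rmh seg1 seg2 seg3 (esym (size_wavelet pi wv g K r)) n0 rM
  (leq_ltn_trans LLn size_B_M) gM hX yA yB AM BM e9 e7 vt_lt g0 mxM vkv me_vt mono ht.
(* Class and remainder recombine to the rank by division with remainder, and the slice with the two
   row bounds is the rectangle. *)
have hb2 : best_of (vrank wv) d E cur (in_rect pi x0 x1 y0 y1).
  move: hb1; rewrite (_ : rk _ _ _ = vrank wv); last first.
    by apply: functional_extensionality => x; rewrite /rk -divn_eq.
  by apply: best_of_ext => x; exact: slice_rect.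
have fr x : x \in [:: 63; 64; 78; 79; 94; 95; 96; 97] -> s' x = s x.
  move=> hx; have /allP/(_ x hx) hm := dir_main_mods.
  rewrite -q1 (sem_frame _ _ _ hm) /t updE; move: hx; clear; case: eqP => // ->.
  by [].
set V := eval b me (Ld (($72 <<< $23) + $76)) (upd s' (94 + 2 * d) (s' 75)).
exists (upd (upd s' (94 + 2 * d) (s' 75)) (95 + 2 * d) V); split.
- rewrite /dir_run (semSeq _ _ (Asn 70 _)) et (semSeq _ _ dir_main) q1.
  by rewrite (semSeq _ _ (Asn (94 + 2 * d) _)) (semAsn _ _ (94 + 2 * d)) semAsn.
- split; first by do 2!(apply: env_upd; last by []).
  by rewrite !updE; clear -fr h63 h64 h78 h79; case: (d) => /=; rewrite !fr.
- rewrite !updE (answerP _ hb2); last exact: hE.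
  have -> : (94 + 2 * d == 95 + 2 * d) = false by rewrite eqn_add2r.
  rewrite !eqxx /correct_output; case: cur hres hb1 hb2 => [v|] //= [r1 r2 r3] _ [[x _ hx] _].
  split=> //; rewrite /V.
  have vk : v < size vt by rewrite -hx; apply: vrank_lt.
  have e72 : upd s' (94 + 2 * d) (s' 75) 72 = s' 72 by rewrite updE; case: (d).
  have e76 : upd s' (94 + 2 * d) (s' 75) 76 = s' 76 by rewrite updE; case: (d).
  have e23 : upd s' (94 + 2 * d) (s' 75) 23 = r.
    by rewrite updE (_ : (23 == 94 + 2 * d) = false) ?E1 //; exact: (P 2 isT).
  move: (upd s' _ _) e72 e76 e23 => z e72 e76 e23.
  have vM : v < M by apply: ltn_trans r3 (leq_ltn_trans _ mxM); rewrite mul2n -addnn leq_addr.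
  have ea : eval b me (($72 <<< $23) + $76) z = v.
    rewrite -r2; apply: evAdd; [apply: evShl; [exact: e72|exact: e23|]|exact: e76|by rewrite r2].
    by apply: leq_ltn_trans vM; rewrite -r2 leq_addr.
  rewrite [eval _ _ _ _]/= /= in ea *; rewrite ea me_vt // modn_small //; exact: vkv.
- rewrite !updE; clear -fr; case: (d); rewrite [94 + _]/= [95 + _]/= /=; split; exact: fr.
Qed.

End Stage.

Lemma bigP : exists t s, [/\ sem load_params st = t, [/\ t 21 = g, t 22 = K, t 23 = r & t 36 = K * g],
  sem big st = s,
  correct_output (Succ pi wv w x0 x1 y0 y1) (s 94) (s 95) &
  correct_output (Pred pi wv w x0 x1 y0 y1) (s 96) (s 97)].
Proof.
have [t1 [q1 h1 h20 hps]] := big_loadP.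
have [t2 [q2 h2]] := prepP h1.
have [t3 [q3 h3 c3 _]] := dir_runP h1 h20 hps false h2.
have [t5 [q5 h5 c5 [f1 f2]]] := dir_runP h1 h20 hps true h3.
exists t1, t5; split.
- exact: q1.
- split; [exact: (hps 0)|exact: (hps 1)|exact: (hps 2)|exact: (hps 15)].
- rewrite /big (semSeq _ _ load_params) q1 (semSeq _ _ load_query) q2 (semSeq _ _ (dir_run 0)) q3; exact: q5.
- by rewrite f1 f2; exact: c3.
- exact: c5.
Qed.

End Big.

Lemma costSeq b me c1 c2 s : cost b me (Seq c1 c2) s = cost b me c1 s + cost b me c2 (sem b me c1 s).
Proof. by []. Qed.

Lemma queries_bounded : bounded (load_query;; dir_run 0;; dir_run 1) Fall.
Proof.
have st c : norep c -> bounded c Fall by apply: bounded_static Fall_gt0 _.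
have dr d : bounded (dir_run d) Fall.
  apply: bounded_seq => //; first exact: st.
  by apply: bounded_seq => //; [exact: dir_main_bounded|exact: st].
apply: bounded_seq => //; first exact: st.
by apply: bounded_seq => //; exact: dr.
Qed.

Lemma load_params_norep : norep load_params. Proof. by vm_compute. Qed.

(** The state after loading serves as its own reference state [s0], so the only fact needed about it
    is [s 36 = s 22 * s 21]. *)
Lemma big_bounded : exists C, forall b me st s, sem b me load_params st = s ->
  s 36 = s 22 * s 21 -> cost b me big st <= C * Fall (s 21) (s 22) (s 23).
Proof.
have [C hC] := queries_bounded.
exists ((cmax load_params) + C + 1) => b me st s e h36.
have hc := hC b me s (s 21) (s 22) (s 23) s erefl erefl erefl h36 (fun i _ => erefl).
rewrite /big (costSeq _ _ load_params) e; set Cl := cmax load_params in hc *.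
have hl : cost b me load_params st <= Cl by apply: cmaxP; [exact: load_params_norep|].
apply: leq_trans (leq_add hl hc) _.
rewrite -addnA mulnDl leq_add ?leq_pmulr ?Fall_gt0 // leq_mul2r leq_addr orbT //.
Qed.

(** * Small grids: a linear scan *)

Definition offer (d : bool) (a : nat) (fv : nat * nat) (w : nat) :=
  if (if d then w < a else a < w) then fv else
  if fv.1 == 0 then (1, a) else
  if (if d then fv.2 < a else a < fv.2) then (fv.1, a) else fv.

Definition offerc (d : bool) :=
  If (if d then Bin OLt ($7) ($26) else Bin OLt ($26) ($7)) Skip
  (If ($(94 + 2 * d)) (If (if d then Bin OLt ($(95 + 2 * d)) ($26) else Bin OLt ($26) ($(95 + 2 * d)))
      (95 + 2 * d ::= $26) Skip)
    (94 + 2 * d ::= #1;; 95 + 2 * d ::= $26)).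

(** There is no instruction for logarithms, so the field width is found by doubling; [n] rounds
    suffice because the width is at most [n]. *)
Definition width_body := If ($21 < $0) (21 ::= $21 + $21;; 20 ::= $20 + #1) Skip.
Definition scan_read := 25 ::= rd $23 $20;; 26 ::= Ld (rd $24 $20).
Definition scan_offer :=
  If ($22 < $3) Skip (If ($4 < $22) Skip (If ($25 < $5) Skip (If ($6 < $25) Skip
    (offerc false;; offerc true)))).
Definition scan_next := 22 ::= $22 + #1;; 23 ::= $23 + $20;; 24 ::= $24 + $20.
Definition scan_body := scan_read;; scan_offer;; scan_next.
Definition naive :=
  20 ::= #0;; 21 ::= #1;; Rep $0 width_body;;
  22 ::= #0;; 23 ::= #0;; 24 ::= $0 * $20;; 94 ::= #0;; 96 ::= #0;;
  Rep $0 scan_body.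

Section Naive.
Variables (n : nat) (pi : {perm 'I_n}) (wv : 'I_n -> nat) (b : nat) (me : nat -> nat).
Variables (x0 x1 y0 y1 w : nat).
Local Notation M := (2 ^ b).
Local Notation vt := (value_table wv).
Local Notation sem := (sem b me).
Local Notation kap := (up_log 2 n).
Definition naive_keys := [seq nat_of_ord (pi x) | x <- enum 'I_n] ++ [seq vrank wv x | x <- enum 'I_n].
Definition naive_bits := fields kap naive_keys.
Local Notation bits := naive_bits.
Hypothesis n1 : 1 < n.
Hypothesis nM : n ^ 2 <= M.
Hypothesis hbM : b < M.
Hypothesis hme : forall i, i < nwords b bits -> me (n + i) = word_at b bits i.
Hypothesis me_vt : forall i, i < size vt -> me i = nth 0 vt i.
Hypothesis vtM : forall x, wv x < M.
Hypothesis wM : w < M.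

Definition statics (s : state) :=
  [/\ s 0 = n, s 8 = b, s 10 = n & [/\ s 3 = x0, s 4 = x1, s 5 = y0 & s 6 = y1 /\ s 7 = w]].

Lemma statics_frame s s' : statics s -> (forall i, i < 20 -> s' i = s i) -> statics s'.
Proof. by move=> [h1 h2 h3 [h4 h5 h6 [h7 h8]]] e; split; [..|split; [..|split]]; rewrite e. Qed.

Let h4M : 4 <= M.
Proof. by apply: leq_trans nM; rewrite -[4]/(2 ^ 2) leq_sqr. Qed.

Let hb : 0 < b.
Proof. by clear -h4M; case: b h4M. Qed.

Let kap0 : 0 < kap.
Proof. by rewrite up_log_gt0. Qed.

Let kap_n : n <= 2 ^ kap. Proof. exact: up_logP. Qed.

(** Guarantees that all bit addresses fit in a word. With [k] the width, [2 * k <= 2 ^ k] settles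
    the case [2 * k <= b]. Otherwise [n ^ 2 <= 2 ^ b] forces [b = 2 * k - 1]; then a stronger
    inequality serves for large [k], and the few small ones are checked directly. *)
Lemma naive_room : 2 * (n * kap) <= M.
Proof.
have h1 : 2 ^ kap.-1 < n by apply: up_log_gtn.
have hk := kap_n; have k0 := kap0; move: kap h1 hk k0 => k h1 hk k0.
have [kb|bk] := leqP (2 * k) b.
  apply: leq_trans (_ : 2 ^ (2 * k) <= _); last by rewrite leq_exp2l.
  have k2 : 2 * k <= 2 ^ k.
    case: k k0 {h1 hk kb} => // k _; rewrite expnS leq_mul2l /=; exact: ltn_expl.
  rewrite (mul2n k) -addnn expnD; apply: leq_trans (leq_mul hk k2).
  by rewrite mulnCA.
have eb : b = k.-1 + k.-1 + 1.
  have : 2 ^ (k.-1 + k.-1) < 2 ^ b.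
    by apply: leq_trans nM; rewrite expnD mulnn ltn_sqr.
  by rewrite ltn_exp2l //; clear -bk k0; lia.
move: nM; rewrite eb; case: k {bk eb} k0 h1 hk => // k _; rewrite [k.+1.-1]/= => h1 hk.
have [k3|k3] := leqP 3 k.
  move=> _; have k2 : 2 * k.+1 <= 2 ^ k.
    elim: k k3 {h1 hk} => // k IH; rewrite leq_eqVlt => /orP[/eqP<-//|/IH]; rewrite expnS; lia.
  rewrite -addnA addn1 expnD; rewrite (_ : 2 * (n * k.+1) = (2 * k.+1) * n); last by rewrite mulnCA mulnC.
  exact: leq_mul.
case: k k3 h1 hk => [|[|[|//]]] _; rewrite /= => h1 hk; nia.
Qed.

Let size_keys : size naive_keys = 2 * n.
Proof. by rewrite /naive_keys size_cat 2!size_map size_enum_ord addnn mul2n. Qed.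

Let keyE i : i < 2 * n -> nth 0 naive_keys i < 2 ^ kap.
Proof.
move=> hi; have : nth 0 naive_keys i \in naive_keys.
  by rewrite mem_nth // size_keys.
rewrite mem_cat => /orP[] /mapP[x _ ->]; apply: leq_trans kap_n; first exact: ltn_ord.
exact: leq_trans (vrank_lt wv x) (size_vt_n wv).
Qed.

Let size_bits : size bits = 2 * n * kap.
Proof. by rewrite size_fields size_keys. Qed.

Lemma key_pi (x : 'I_n) : nth 0 naive_keys x = pi x.
Proof.
rewrite nth_cat size_map size_enum_ord ltn_ord (nth_map x) ?size_enum_ord //.
by rewrite nth_ord_enum.
Qed.

Lemma key_rank (x : 'I_n) : nth 0 naive_keys (n + x) = vrank wv x.
Proof.
rewrite nth_cat size_map size_enum_ord ltnNge leq_addr /= addKn (nth_map x) ?size_enum_ord //.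
by rewrite nth_ord_enum.
Qed.

Let b1 : 1 < b.
Proof. by rewrite -(ltn_exp2l _ _ (isT : 1 < 2)) expn1; apply: leq_trans h4M. Qed.

Let hadr : n + nwords b bits <= M.
Proof.
apply: leq_trans naive_room; rewrite mul2n -addnn leq_add ?leq_pmulr //.
rewrite -ltnS /nwords size_bits ltn_divLR // -mulnA.
have : 0 < n * kap by rewrite muln_gt0 kap0 (ltnW n1).
move: (n * kap) => Q; clear -b1; nia.
Qed.

Lemma widthP s : s 0 = n -> s 20 = 0 -> s 21 = 1 ->
  sem (Rep $0 width_body) s 20 = kap /\ forall i, i \notin [:: 20; 21] -> sem (Rep $0 width_body) s i = s i.
Proof.
move=> h0 h20 h21; split; last by move=> i hi; apply: sem_frame; move: hi; rewrite !inE; clear; lia.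
rewrite semRep [eval _ _ _ _]/= h0.
have kn : kap <= n by apply: up_log_min => //; apply: ltnW; apply: ltn_expl.
have L i : i <= n -> exists t, iter i (sem width_body) s = t /\
    [/\ t 0 = n, t 20 = minn i kap & t 21 = 2 ^ minn i kap].
  elim: i => [|i IH] hi; first by exists s; rewrite min0n.
  have [t [et [t0 t20 t21]]] := IH (ltnW hi).
  exists (sem width_body t); rewrite iterS et; split=> //.
  rewrite /width_body semIf.
  have -> : eval b me ($21 < $0) t = (2 ^ minn i kap < n).
    by apply: evLt; rewrite //= ?t0 ?t21 //; apply: leq_trans h4M.
  have [ik|ki] := ltnP i kap.
    have hlt : 2 ^ i < n.
      apply: leq_ltn_trans (up_log_gtn (isT : 1 < 2) n1); rewrite leq_exp2l //; clear -ik; lia.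
    rewrite hlt (_ : (nat_of_bool true == 0) = false) //.
    rewrite (minn_idPl (ltnW ik)) in t20 t21; rewrite (minn_idPl ik) (semSeq _ _ (Asn 21 _)) !semAsn.
    have dM : 2 ^ i.+1 < M.
      apply: leq_trans nM; rewrite expnS -mulnn; clear -hlt n1; nia.
    have -> : eval b me ($21 + $21) t = 2 ^ i.+1.
      rewrite expnS mul2n -addnn; apply: evAdd; rewrite /= ?t21 //.
      by rewrite addnn -mul2n -expnS.
    have -> : eval b me ($20 + #1) (upd t 21 (2 ^ i.+1)) = i.+1.
      rewrite -(addn1 i); apply: evAdd; rewrite /= ?t20 //.
        by apply: modn_small; apply: leq_trans h4M.
      by rewrite addn1; apply: leq_ltn_trans dM; apply: ltnW; apply: ltn_expl.
    by rewrite !updE /= t0.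
  rewrite ltnNge kap_n /= (minn_idPr (leqW ki)).
  by rewrite (minn_idPr ki) in t20 t21.
have [t [-> [_ -> _]]] := L n (leqnn n); exact/minn_idPr.
Qed.

Local Notation inR := (in_rect pi x0 x1 y0 y1).
Definition elig (d : bool) a := if d then a <= w else w <= a.
Definition upto (d : bool) (i : nat) (fv : nat * nat) :=
  (fv.1 = 0 /\ forall z : 'I_n, z < i -> inR z -> ~~ elig d (wv z)) \/
  (fv.1 = 1 /\ exists x : 'I_n, [/\ inR x, elig d (wv x), fv.2 = wv x &
    forall z : 'I_n, z < i -> inR z -> elig d (wv z) -> if d then wv z <= wv x else wv x <= wv z]).

Lemma upto_step d (x : 'I_n) fv : upto d x fv ->
  upto d x.+1 (if inR x then offer d (wv x) fv w else fv).
Proof.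
have zx (z : 'I_n) : z < x.+1 -> z = x \/ z < x.
  rewrite ltnS leq_eqVlt => /orP[/eqP e|]; [left; exact: val_inj|by right].
case: (boolP (inR x)) => hx; last first.
  case=> [[h1 h2]|[h1 [y [h2 h3 h4 h5]]]]; [left|right]; split=> //; last exists y; last split=> //;
  by move=> z /zx[->|]; [rewrite (negbTE hx)|auto].
rewrite /offer; have -> : (if d then w < wv x else wv x < w) = ~~ elig d (wv x).
  by rewrite /elig; case: (d); rewrite ltnNge.
case: (boolP (elig d (wv x))) => hel /=; last first.
  case=> [[h1 h2]|[h1 [y [h2 h3 h4 h5]]]]; [left|right]; split=> //; last exists y; last split=> //;
  by move=> z /zx[->|]; [rewrite ?(negbTE hel)|auto].
case=> [[h1 h2]|[h1 [y [h2 h3 h4 h5]]]].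
  rewrite h1 /=; right; split=> //; exists x; split=> // z /zx[->|h]; first by case: (d).
  by move=> hz; rewrite (negbTE (h2 z h hz)).
rewrite h1 /=; right; case: ifP => hb2; split=> //; [exists x|exists y]; split=> // z /zx[->|h] hz he.
- by case: (d).
- have := h5 z h hz he; clear -h4 hb2; rewrite h4 in hb2; case: (d) hb2 => h h'.
    by apply: leq_trans h' (ltnW h).
  by apply: leq_trans (ltnW h) h'.
- move: hb2; rewrite h4; case: (d); rewrite ltnNge => /negbFE //.
- exact: h5.
Qed.

Lemma upto_answer d fv : upto d n fv -> correct_output (answer pi wv w x0 x1 y0 y1 d) fv.1 fv.2.
Proof.
rewrite /answer /upto /elig; case: d => -[[-> h]|[-> [x [h1 h2 -> h3]]]].
- by rewrite (Pred_none (fun z hz => h z (ltn_ord z) hz)).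
- by rewrite (Pred_some h1 h2) // => z; apply: h3.
- by rewrite (Succ_none (fun z hz => h z (ltn_ord z) hz)).
- by rewrite (Succ_some h1 h2) // => z; apply: h3.
Qed.

Lemma offercP (d : bool) s a f v : s 7 = w -> s 26 = a -> s (94 + 2 * d) = f -> s (95 + 2 * d) = v ->
  (sem (offerc d) s (94 + 2 * d), sem (offerc d) s (95 + 2 * d)) = offer d a (f, v) w /\
  forall i, i \notin [:: 94 + 2 * d; 95 + 2 * d] -> sem (offerc d) s i = s i.
Proof.
move=> h7 h26 hf hv; split; last first.
  by move=> i hi; apply: sem_frame; move: hi; case: (d); rewrite !inE; clear; lia.
have h1M : 1 < M by apply: leq_trans h4M.
rewrite /offerc /offer semIf.
have -> : eval b me (if d then Bin OLt ($7) ($26) else Bin OLt ($26) ($7)) s = (if d then w < a else a < w).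
  by case: (d); apply: evLt.
case: (if d then w < a else a < w) => /=; first by rewrite hf hv.
rewrite hf; case: eqP => [f0|/eqP f0].
  by rewrite /upd /= h26 modn_small //; case: (d).
have -> : eval b me (if d then Bin OLt ($(95 + 2 * d)) ($26) else Bin OLt ($26) ($(95 + 2 * d))) s =
   (if d then v < a else a < v).
  by case: (d) hv => hv; apply: evLt.
case: (if d then v < a else a < v) => /=; last by rewrite hf hv.
by rewrite /upd h26 -hf; case: (d).
Qed.

(** Register 24 is described modulo [M], since after the last point its value [2 * n * kap] may
    equal [M]. *)
Definition scan_inv (i : nat) (s : state) := statics s /\
  [/\ s 20 = kap, s 22 = i, s 23 = i * kap, s 24 = (n * kap + i * kap) %% M &
    upto false i (s 94, s 95) /\ upto true i (s 96, s 97)].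

Lemma scan_readP s (x : 'I_n) : scan_inv x s -> exists s', [/\ sem scan_read s = s',
  s' 25 = pi x, s' 26 = wv x & forall i, i \notin [:: 25; 26] -> s' i = s i].
Proof.
move=> [[h0 h8 h10 [h3 h4 h5 [h6 h7]]] [h20 h22 h23 h24 _]].
have xn := ltn_ord x.
have kb : kap <= b.
  by apply: up_log_min => //; apply: leq_trans nM; rewrite -mulnn leq_pmulr // ltnW.
have room := naive_room.
have rdk ep i t : t 8 = b -> t 10 = n -> t 20 = kap -> eval b me ep t = i * kap -> i < 2 * n ->
    eval b me (rd ep ($20)) t = nth 0 naive_keys i.
  move=> t8 t10 t20 he hi.
  rewrite (eval_rdE hb hbM hme hadr t8 (t10 : eval b me ($10) t = n) he (t20 : eval b me ($20) t = kap) kb).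
    by rewrite bval_fields ?size_keys ?keyE.
  by rewrite size_bits addnC -mulSn leq_mul2r hi orbT.
have x2 : x < 2 * n by clear -xn; lia.
have nx2 : n + x < 2 * n by clear -xn; lia.
have e24 : s 24 = (n + x) * kap.
  rewrite h24 -mulnDl modn_small //; apply: leq_trans room; rewrite mulnA ltn_mul2r kap0 //.
pose s1 := upd s 25 (pi x).
exists (upd s1 26 (wv x)); split=> //.
- rewrite /scan_read (semSeq _ _ (Asn 25 _)) (semAsn _ _ 25) (rdk _ x) // key_pi -/s1 semAsn; congr upd.
  have e1 : eval b me (rd ($24) ($20)) s1 = vrank wv x by rewrite (rdk _ (n + x)) // key_rank.
  have -> : eval b me (Ld (rd ($24) ($20))) s1 = me (eval b me (rd ($24) ($20)) s1) %% M by [].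
  by rewrite e1 me_vt ?vrank_lt // nth_vrank modn_small.
- by move=> i; rewrite !inE negb_or => /andP[i1 i2]; rewrite /s1 !updE (negbTE i1) (negbTE i2).
Qed.

Lemma scan_offerP s (x : 'I_n) : statics s -> s 22 = x -> s 25 = pi x -> s 26 = wv x ->
  exists s', [/\ sem scan_offer s = s',
   (s' 94, s' 95) = (if inR x then offer false (wv x) (s 94, s 95) w else (s 94, s 95)),
   (s' 96, s' 97) = (if inR x then offer true (wv x) (s 96, s 97) w else (s 96, s 97)) &
   forall i, i \notin [:: 94; 95; 96; 97] -> s' i = s i].
Proof.
move=> [h0 h8 h10 [h3 h4 h5 [h6 h7]]] h22 h25 h26.
have h1M : 1 < M by apply: leq_trans h4M.
rewrite /scan_offer !semIf.
have -> : eval b me ($22 < $3) s = (x < x0) by apply: evLt.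
have -> : eval b me ($4 < $22) s = (x1 < x) by apply: evLt.
have -> : eval b me ($25 < $5) s = (pi x < y0) by apply: evLt.
have -> : eval b me ($6 < $25) s = (y1 < pi x) by apply: evLt.
rewrite /in_rect.
case: (leqP x0 x) => _ /=; last by exists s.
case: (leqP x x1) => _ /=; last by exists s.
case: (leqP y0 (pi x)) => _ /=; last by exists s.
case: (leqP (pi x) y1) => _ /=; last by exists s.
have [e1 f1] := offercP (d := false) h7 h26 erefl erefl.
set s1 := sem (offerc false) s in e1 f1 *.
have g7 : s1 7 = w by rewrite f1.
have g26 : s1 26 = wv x by rewrite f1.
have [e2 f2] := offercP (d := true) g7 g26 (f1 96 isT) (f1 97 isT).
set s2 := sem (offerc true) s1 in e2 f2 *.
exists s2; split=> //.
- by rewrite -e1 !f2.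
- by move=> i; rewrite !inE !negb_or => /and4P[i1 i2 i3 i4]; rewrite f2 ?f1 // !inE negb_or ?i1 ?i2 ?i3 ?i4.
Qed.

Lemma scan_bodyP s (x : 'I_n) : scan_inv x s -> scan_inv x.+1 (sem scan_body s).
Proof.
move=> hs; have [s1 [q1 h25 h26 f1]] := scan_readP hs.
case: hs => hst [h20 h22 h23 h24 [hu1 hu2]].
have st1 : statics s1 by apply: statics_frame hst _ => i hi; rewrite f1 // !inE; clear -hi; lia.
have a22 : s1 22 = x by rewrite f1.
have [s2 [q2 u1 u2 f2]] := scan_offerP st1 a22 h25 h26.
have st2 : statics s2 by apply: statics_frame st1 _ => i hi; rewrite f2 // !inE; clear -hi; lia.
have e20 : s2 20 = kap by rewrite f2 // f1.
have e22 : s2 22 = x by rewrite f2 // f1.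
have e23 : s2 23 = x * kap by rewrite f2 // f1.
have e24 : s2 24 = (n * kap + x * kap) %% M by rewrite f2 // f1.
have xn := ltn_ord x.
have room := naive_room.
rewrite /scan_body (semSeq _ _ scan_read) q1 (semSeq _ _ scan_offer) q2.
have n_M : n < M by apply: leq_trans nM; rewrite -mulnn ltn_Pmull // ltnW.
have p22 : eval b me ($22 + #1) s2 = x.+1.
  rewrite -(addn1 x); apply: evAdd; [exact: e22|apply: evCst|rewrite addn1].
    by apply: leq_trans h4M.
  exact: leq_ltn_trans n_M.
have p23 : eval b me ($23 + $20) (upd s2 22 x.+1) = x.+1 * kap.
  rewrite mulSn addnC; apply: evAdd; [exact: e23|exact: e20|].
  rewrite addnC -mulSn; apply: leq_trans room; rewrite mulnA ltn_mul2r kap0 //; clear -xn; lia.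
have p24 : eval b me ($24 + $20) (upd (upd s2 22 x.+1) 23 (x.+1 * kap)) = (n * kap + x.+1 * kap) %% M.
  by rewrite /= /upd /= e24 e20 /opval modnDml -addnA [x * kap + kap]addnC -mulSn.
rewrite /scan_next (semSeq _ _ (Asn 22 _)) (semAsn _ _ 22) p22 (semSeq _ _ (Asn 23 _)) (semAsn _ _ 23) p23.
rewrite semAsn p24; split.
  apply: statics_frame st2 _ => i hi; rewrite !updE !ifN //; clear -hi; lia.
split; rewrite !updE //=.
by rewrite u1 u2 !f1 //; split; apply: upto_step.
Qed.

Lemma naiveP s : statics s -> exists s', [/\ sem naive s = s',
  correct_output (Succ pi wv w x0 x1 y0 y1) (s' 94) (s' 95) &
  correct_output (Pred pi wv w x0 x1 y0 y1) (s' 96) (s' 97)].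
Proof.
move=> hst; have [h0 _] := hst.
set s1 := upd (upd s 20 0) 21 1.
have [w20 wf] := @widthP s1 h0 erefl erefl.
set s2 := sem (Rep $0 width_body) s1 in w20 wf *.
have n_M : n < M by apply: leq_trans nM; rewrite -mulnn ltn_Pmull // ltnW.
have i1 : scan_inv 0 (upd (upd (upd (upd (upd s2 22 0) 23 0) 24 (n * kap %% M)) 94 0) 96 0).
  split; last first.
    by split; rewrite ?updE //= ?mul0n ?addn0 //; split; left; split.
  apply: statics_frame hst _ => i hi; rewrite !updE !ifN ?wf /s1 ?updE ?ifN // ?inE; clear -hi; lia.
set s3 := upd _ 96 _ in i1.
have it i : i <= n -> scan_inv i (iter i (sem scan_body) s3).
  elim: i => [|i IH] hi //; rewrite iterS.
  exact: (@scan_bodyP _ (Ordinal hi) (IH (ltnW hi))).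
have [_ [_ _ _ _ [u1 u2]]] := it n (leqnn n).
exists (iter n (sem scan_body) s3); split.
- rewrite /naive (semSeq _ _ (Asn 20 _)) (semSeq _ _ (Asn 21 _)) (semAsn _ _ 20) (semAsn _ _ 21).
  rewrite (_ : eval b me #0 s = 0); last exact: mod0n.
  rewrite (_ : eval b me #1 _ = 1); last by apply: evCst; apply: leq_trans h4M.
  rewrite -/s1 (semSeq _ _ (Rep _ _)) -/s2.
  rewrite (semSeq _ _ (Asn 22 _)) (semAsn _ _ 22) (_ : eval b me #0 _ = 0); last exact: mod0n.
  rewrite (semSeq _ _ (Asn 23 _)) (semAsn _ _ 23) (_ : eval b me #0 _ = 0); last exact: mod0n.
  rewrite (semSeq _ _ (Asn 24 _)) (semAsn _ _ 24).
  rewrite (_ : eval b me ($0 * $20) _ = n * kap %% M); last first.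
    by rewrite /= /upd /= w20 wf // /s1 /upd /= h0.
  rewrite (semSeq _ _ (Asn 94 _)) (semAsn _ _ 94) (_ : eval b me #0 _ = 0); last exact: mod0n.
  rewrite (semSeq _ _ (Asn 96 _)) (semAsn _ _ 96) (_ : eval b me #0 _ = 0); last exact: mod0n.
  rewrite -/s3 semRep (_ : eval b me $0 s3 = n) //.
  by rewrite /s3 /= /upd /= wf // /s1 /upd /= h0.
- exact: upto_answer u1.
- exact: upto_answer u2.
Qed.

End Naive.

Lemma rep0_cost b me c s : norep c -> cost b me (Rep $0 c) s <= (cmax c + 6) * (s 0).+1.
Proof.
move=> h; have hk t : cost b me c t <= cmax c by apply: cmaxP.
apply: leq_trans (cost_Rep (Var 0) s hk) _.
rewrite [ecost _]/= [eval _ _ _ _]/=; move: (cmax c) (s 0) => K x; clear; nia.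
Qed.

Lemma naive_cost : exists C, forall b me s, cost b me naive s <= C * (s 0).+1.
Proof.
pose c1 := 20 ::= #0;; 21 ::= #1.
pose c2 := 22 ::= #0;; 23 ::= #0;; 24 ::= $0 * $20;; 94 ::= #0;; 96 ::= #0.
have st c b me s : norep c -> cost b me c s <= cmax c * (s 0).+1.
  by move=> h; apply: cmaxP => //; apply: leq_pmulr.
have n1 : norep c1 by [].
have n2 : norep c2 by [].
have nw : norep width_body by [].
have ns : norep scan_body by vm_compute.
exists (cmax c1 + (cmax width_body + 6) + cmax c2 + (cmax scan_body + 6)) => b me s.
set s1 := sem b me c1 s; set s2 := sem b me (Rep $0 width_body) s1; set s3 := sem b me c2 s2.
have e1 : s1 0 = s 0 by apply: sem_frame.
have e2 : s2 0 = s 0 by rewrite -e1; apply: sem_frame.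
have e3 : s3 0 = s 0 by rewrite -e2; apply: sem_frame.
have -> : cost b me naive s = cost b me c1 s + cost b me (Rep $0 width_body) s1 + cost b me c2 s2
    + cost b me (Rep $0 scan_body) s3.
  rewrite /naive !costSeq !addnA; reflexivity.
have h1 := st _ b me s n1.
have h2 := rep0_cost b me s1 nw.
have h3 := st _ b me s2 n2.
have h4 := rep0_cost b me s3 ns.
rewrite e1 in h2; rewrite e2 in h3; rewrite e3 in h4.
by rewrite 3!mulnDl; apply: leq_add => //; apply: leq_add => //; apply: leq_add.
Qed.

(** * Parameters *)

Lemma exp2_ge_lin h : 5 <= h -> 6 * h + 2 <= 2 ^ h.
Proof.
elim: h => // h IH; rewrite leq_eqVlt => /orP[/eqP <-|]; first by [].
rewrite ltnS => h5; have := IH h5; rewrite expnS; move: (2 ^ h) => X; clear -h5; lia.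
Qed.

(** The left side is the exponent in the bound for [tableA], with [e] about [log lam]; the right
    side is the lower bound [2 ^ e.-1] for [lam]. It holds from 9 on, which is why large grids need
    [lam >= 256]. *)
Lemma table_exponent e : 9 <= e -> e * 2 ^ (e %/ 2) + 5 + 2 * e <= 2 ^ e.-1.
Proof.
move=> he; have := divn_eq e 2; have := ltn_pmod e (isT : 0 < 2).
move: (e %/ 2) (e %% 2) => h o; case: o => [|[|//]] _ eh; rewrite eh in he *.
  have h5 : 5 <= h by clear -he; lia.
  have E := exp2_ge_lin h5.
  rewrite addn0; case: h h5 E {eh he} => // h h5; rewrite (_ : (h.+1 * 2).-1 = h + h.+1); last by clear; lia.
  rewrite expnD expnS; move: (2 ^ h) => X E; clear -E h5; nia.
have h4 : 4 <= h by clear -he; lia.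
have E : 3 * h + 4 <= 2 ^ h.
  have := h4; rewrite leq_eqVlt => /orP[/eqP<- //|h5].
  have := exp2_ge_lin h5; move: (2 ^ h) => X; clear -h5; lia.
rewrite addn1 /= muln2 -addnn expnD; move: (2 ^ h) E => X E; clear -E h4; nia.
Qed.

(** A relative count takes [O(q)] bits for a cell of [q] blocks, hence [O(1)] bits per block. *)
Lemma relative_width e : 2 * e + 1 <= 6 * 2 ^ (e %/ 2).
Proof.
have := divn_eq e 2; have := ltn_pmod e (isT : 0 < 2).
move: (e %/ 2) (e %% 2) => h o ho ->; have : h < 2 ^ h by apply: ltn_expl.
move: (2 ^ h) => X; clear -ho; lia.
Qed.

Section Tuning.
Variables (n m ell lam : nat).
Hypotheses (lam_big : 256 <= lam) (n_lo : 2 ^ lam <= n) (n_hi : n < 2 ^ lam.+1).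
Hypotheses (m2 : 1 < m) (mn : m <= n) (ell2 : 1 < ell) (ell_m : ell <= m).
Definition bits_of_rank := (trunc_log 2 m).+1.
(** Adding 2 gives [g >= log ell + 1], the margin that absorbs rounding in [mx_g], while
    [2 ^ g <= 4 * ell] still holds. *)
Definition digit_width := trunc_log 2 ell + 2.
Local Notation M' := bits_of_rank.
Local Notation g := digit_width.
(** The maximum with [g] keeps the subtraction in the remainder width [mx - g] exact. *)
Definition key_width := maxn M' g.
Local Notation mx := key_width.
(** Enough digits for the shifted row bounds, which reach [n + 1]. The super-level added for
    rounding costs [n * mx], that is, [O(n log m)] bits. *)
Definition levels := (lam + 2) %/ g + 1.
Local Notation K := levels.
Local Notation r := (mx - g).
Local Notation e := (trunc_log 2 lam).+1.
(** Blocks of a quarter of [lam] keep [tableD] below [n] bits. With [q] near [sqrt(lam)], the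
    [q * q] blocks of a superblock pay for one absolute count, while the [H] bits of a class vector
    stay far enough below [lam] for [tableA]. *)
Local Notation u := (lam %/ 4).
Local Notation q := (2 ^ (e %/ 2)).
Local Notation H := (e * q + 2).
Local Notation rho := (2 * e + 1).
Local Notation j := e.+1.

Lemma lam_lo : 2 ^ e.-1 <= lam. Proof. by apply: trunc_logP => //; clear -lam_big; lia. Qed.
Lemma lam_hi : lam < 2 ^ e. Proof. by apply: trunc_log_ltn. Qed.
Lemma e9 : 9 <= e.
Proof. by rewrite ltnS -[8]/(trunc_log 2 256); apply: leq_trunc_log. Qed.
Lemma texp : e * q + 5 + 2 * e <= lam.
Proof. exact: leq_trans (table_exponent e9) lam_lo. Qed.

Lemma M'_lam : M' <= lam + 1.
Proof.
rewrite addn1 ltnS -ltnS -(ltn_exp2l _ _ (isT : 1 < 2)); apply: leq_ltn_trans n_hi.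
by apply: leq_trans mn; apply: trunc_logP => //; apply: ltnW.
Qed.

Lemma g_M' : g <= M' + 1.
Proof. by rewrite /g /M' addn2 addn1 !ltnS leq_trunc_log. Qed.

Lemma mx_M' : mx <= M' + 1.
Proof. by rewrite geq_max leq_addr g_M'. Qed.

Lemma g_r : g + r = mx. Proof. by rewrite subnKC // leq_maxr. Qed.

Lemma g_pos : 0 < g. Proof. by rewrite /g addn2. Qed.

Lemma vt_room : m < 2 ^ (g + r).
Proof.
apply: leq_trans (trunc_log_ltn m (isT : 1 < 2)) _; rewrite leq_exp2l // g_r; exact: leq_maxl.
Qed.

Lemma row_room : n.+1 < 2 ^ (K * g).
Proof.
apply: (leq_trans (_ : _ < 2 ^ (lam + 2))).
  have : 0 < 2 ^ lam by rewrite expn_gt0.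
  by move: n_hi; rewrite addn2 !expnS; move: (2 ^ lam) => X; clear; lia.
by rewrite leq_exp2l // /levels addn1 ltnW // ltn_ceil // g_pos.
Qed.

Lemma key_room : 2 * 2 ^ (g + r) < 2 ^ (2 * lam).
Proof.
rewrite -expnS ltn_exp2l // g_r; have := mx_M'; have := M'_lam; move: mx M' => a c; clear -lam_big; lia.
Qed.

Lemma class_room : n.+1 + 2 * 2 ^ g < 2 ^ (2 * lam).
Proof.
have h1 : 2 * 2 ^ g <= 2 ^ (lam + 3).
  rewrite -expnS leq_exp2l //; have := g_M'; have := M'_lam; move: g M' => a c; clear; lia.
have h2 : 2 ^ (lam + 3) * 2 <= 2 ^ (2 * lam).
  by rewrite mulnC -expnS leq_exp2l //; clear -lam_big; lia.
have h3 : 2 ^ lam.+1 * 4 = 2 ^ (lam + 3) by rewrite -[4]/(2 ^ 2) -expnD; congr (2 ^ _); clear; lia.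
have h4 : 0 < 2 ^ lam.+1 by rewrite expn_gt0.
move: (2 ^ g) (2 ^ (lam + 3)) (2 ^ (2 * lam)) (2 ^ lam.+1) n_hi h1 h2 h3 h4 => a c d f; clear; lia.
Qed.

Lemma u_pos : 0 < u. Proof. by rewrite divn_gt0 //; clear -lam_big; lia. Qed.
Lemma u_lam : lam <= 8 * u.
Proof. by have := divn_eq lam 4; have := ltn_pmod lam (isT : 0 < 4); clear -lam_big; lia. Qed.
Lemma u_e : u < 2 ^ e. Proof. by apply: leq_ltn_trans lam_hi; apply: leq_div. Qed.
Lemma q_pos : 0 < q. Proof. by rewrite expn_gt0. Qed.
Lemma q_sq_hi : q * q <= 2 ^ e.
Proof. by rewrite -expnD leq_exp2l // addnn -muln2 leq_divM. Qed.
Lemma q_sq_lo : lam <= 2 * (q * q).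
Proof.
apply: leq_trans (ltnW lam_hi) _; rewrite -expnD -expnS leq_exp2l //.
have := divn_eq e 2; have := ltn_pmod e (isT : 0 < 2); clear; lia.
Qed.
Lemma class_window : u.+1 ^ q * 4 <= 2 ^ H.
Proof. by rewrite expnD leq_mul2r expnM leq_exp2r ?u_e ?orbT ?q_pos. Qed.
Lemma window_cell : H <= cellw u q.
Proof.
rewrite /cellw leq_add2r leq_mul2r; apply/orP; right.
have h8 := e9; have q8 : 8 <= q.
  by rewrite -[8]/(2 ^ 3) leq_exp2l // leq_divRL //; apply: leq_trans h8.
have : e * 8 <= e * q by rewrite leq_mul2l q8 orbT.
have := texp; have := u_lam; clear; lia.
Qed.
Lemma super_width : q * (q * u) < 2 ^ rho.
Proof.
rewrite addn1 mulnA (_ : 2 * e = e + e); last by rewrite mul2n addnn.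
rewrite expnS expnD; apply: (leq_ltn_trans (leq_mul q_sq_hi (ltnW u_e))).
have := expn_gt0 2 e; move: (2 ^ e) => X /=; clear; nia.
Qed.

Definition wavelet_size := (g + K * g) * n + K * (r * n).
Local Notation N := wavelet_size.

Lemma wavelet_sizeE : N = n * (g + K * mx).
Proof. by rewrite /wavelet_size -g_r mulnC mulnDr; move: K g r; clear; nia. Qed.

Lemma wavelet_size_le : N <= 8 * (n * (lam * M')).
Proof.
rewrite wavelet_sizeE mulnCA leq_mul2l; apply/orP; right.
have K_le : K <= lam + 3.
  by rewrite /levels -[3]/(2 + 1) addnA leq_add2r; apply: leq_div.
have := leq_mul K_le mx_M'; have := g_M'; have : 0 < M' by [].
move: (K * _) g M' => a c d d0 h1 h2; apply: leq_trans (leq_add h1 h2) _.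
clear -lam_big d0; nia.
Qed.

Lemma blocks_le : N %/ u <= 64 * (n * M').
Proof.
have h := u_lam; have u0 := u_pos; apply: leq_trans (leq_div2r u wavelet_size_le) _.
rewrite -ltnS ltn_divLR //; have : n * (lam * M') <= 8 * u * (n * M').
  by rewrite mulnCA leq_mul2r h orbT.
move: (n * (lam * M')) (n * M') u0 => a c; clear; nia.
Qed.

(** Here [N] keeps coefficient 1: the codes cost 2 bits per block and 2 bits per cell beyond the raw
    bits. *)
Lemma cells_le : (N %/ (q * u)).+1 * cellw u q <= N + 4 * (N %/ u) + cellw u q.
Proof.
rewrite mulSn addnC leq_add2r /cellw.
have q0 := q_pos; have u0 := u_pos; have hq : N %/ (q * u) * q <= N %/ u by rewrite [X in N %/ X]mulnC divnMA leq_divM.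
have hqu : N %/ (q * u) * (q * u) <= N by apply: leq_divM.
move: q0 hq hqu; move: (N %/ (q * u)) => Y; move: (N %/ u) (q) => V Q q0 hq hqu.
have -> : Y * ((u + 2) * Q + 2) = Y * (Q * u) + 2 * (Y * Q) + 2 * Y by clear; nia.
have : Y <= Y * Q by rewrite leq_pmulr.
move: (Y * Q) (Y * (Q * u)) hq hqu => A B; clear; lia.
Qed.

Lemma rels_le : (N %/ (q * u)).+1 * rho <= 6 * (N %/ u) + rho.
Proof.
rewrite mulSn addnC leq_add2r; apply: leq_trans (leq_mul (leqnn _) (relative_width e)) _.
by rewrite mulnCA leq_mul2l /= [X in N %/ X]mulnC divnMA leq_divM.
Qed.

Lemma supers_le : (N %/ (q * (q * u))).+1 * (2 * lam) <= 4 * (N %/ u) + 2 * lam.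
Proof.
rewrite mulSn addnC leq_add2r.
apply: (@leq_trans (N %/ (q * (q * u)) * (4 * (q * q)))).
  by rewrite leq_mul2l; apply/orP; right; have := q_sq_lo; move: (q * q) => X; clear; lia.
by rewrite mulnCA leq_mul2l /= [X in N %/ X]mulnA [X in N %/ X]mulnC divnMA leq_divM.
Qed.

(** The exponent is [H], plus [e] for each of [q] and [lam], plus 3 for the factors 4 and 2; it
    equals the left side of [table_exponent]. *)
Lemma table_le : 2 ^ H * q * 4 * (2 * lam) <= n.
Proof.
apply: leq_trans n_lo; apply: leq_trans (_ : 2 ^ (H + e + 2 + 1 + e) <= _).
  rewrite !expnD -!mulnA !leq_mul2l; apply/orP; right; apply/orP; right.
  apply: leq_mul; first by rewrite leq_exp2l // leq_div.
  by have := lam_hi; move: (2 ^ e) => X; clear; lia.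
rewrite leq_exp2l //; have := texp; clear; lia.
Qed.

(** The exponent is [u + 3 * e + 1], and [u] is only a quarter of [lam]. *)
Lemma popcount_table_le : u.+1 * 2 ^ u * u * (2 * lam) <= n.
Proof.
apply: leq_trans n_lo; apply: leq_trans (_ : 2 ^ (e + u + e + 1 + e) <= _).
  rewrite !expnD -!mulnA; apply: leq_mul; first exact: u_e.
  rewrite leq_mul2l; apply/orP; right; apply: leq_mul; first exact: ltnW u_e.
  by apply: leq_mul => //; exact: ltnW lam_hi.
rewrite leq_exp2l //; have := texp; have := leq_divM lam 4.
have : 2 * e <= e * q.
  rewrite mulnC leq_mul2l -[2]/(2 ^ 1) leq_exp2l // leq_divRL //; apply/orP; right.
  by apply: leq_trans e9.
have := e9; move: (e * q) => X; move: (e) (u) => E U; clear -lam_big; lia.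
Qed.

Lemma lam_sq_n : 100 * (lam * lam) <= n.
Proof.
apply: leq_trans n_lo; apply: leq_trans (_ : 2 ^ (7 + (e + e)) <= _).
  by rewrite !expnD; apply: leq_mul => //; apply: leq_mul; exact: ltnW lam_hi.
rewrite leq_exp2l //; have := texp; have := e9.
have : e <= e * q by rewrite leq_pmulr // q_pos.
clear; lia.
Qed.

Lemma cellw_le : cellw u q <= n.
Proof.
apply: leq_trans lam_sq_n; rewrite /cellw.
have ql : q <= lam.
  have eq : q <= e * q by rewrite leq_pmull.
  have := texp; clear -eq; lia.
have ul : u + 2 <= lam by have := u_lam; have := leq_divM lam 4; clear -lam_big; lia.
have := leq_mul ul ql; move: (_ * q) => X; clear -lam_big; nia.
Qed.

Variables (pi : {perm 'I_n}) (wv : 'I_n -> nat).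
Local Notation bits := (structure pi wv j (2 * lam) rho u q H g K r).
Local Notation pre := (header j (2 * lam) ++ fields (2 * lam) (params pi wv (2 * lam) rho u q H g K r)).

Lemma header_room : 2 * j + 1 <= 2 * lam.
Proof. by have := texp; clear; lia. Qed.

(** Cells, relative and absolute counts cost 4, 6 and 4 extra bits per block, hence at most
    [14 * 64 = 896] times [n * M']. The tables, the parameters and the boundary terms fit in the
    remaining 6. *)
Lemma structure_size_le : size bits <= N + 902 * (n * M').
Proof.
have sp : size pre = 2 * lam + 16 * (2 * lam) by rewrite size_cat size_header ?header_room // size_fields.
rewrite size_cat sp.
rewrite (size_rank_bits _ _ _ class_window window_cell).
rewrite /tabDbase /tabAbase /cellbase /relbase size_wavelet -/N.
have := cells_le; have := rels_le; have := supers_le; have := table_le; have := popcount_table_le.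
have := cellw_le; have := lam_sq_n; have := blocks_le.
have : n <= n * M' by rewrite leq_pmulr.
have : rho <= 2 * lam by have := header_room; clear; lia.
have : lam * 256 <= lam * lam by rewrite leq_mul2l lam_big orbT.
move: (cellw u q) (_ * cellw u q) (_ * rho) ((N %/ _).+1 * (2 * lam)) (2 ^ H * _ * 4 * _) (u.+1 * _ * u * _).
move=> A1 A2 A3 A4 A5 A6.
move: rho (n * M') N (N %/ u) => B1 B2 B3 B4.
clear; lia.
Qed.

(** Makes bit addresses fit in fields of [2 * lam] bits and, as [n ^ 2 <= 2 ^ b], also in words. *)
Lemma structure_size_lt : n + size bits < 2 ^ (2 * lam).
Proof.
have h1 := structure_size_le; have h2 := wavelet_size_le; have h3 := M'_lam.
have h5 : M' <= 2 ^ e by apply: leq_trans h3 _; rewrite addn1; exact: lam_hi.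
have h : n + size bits <= n * (16 * (2 ^ e * 2 ^ e)).
  have a1 : M' <= 2 ^ e * 1 by rewrite muln1.
  have a2 : lam * M' <= 2 ^ e * 2 ^ e by apply: leq_mul => //; exact: ltnW lam_hi.
  have a3 : 256 * M' <= lam * M' by rewrite leq_mul2r lam_big orbT.
  have a4 : 0 < M' by [].
  apply: leq_trans (leq_add (leqnn n) (leq_trans h1 (leq_add h2 (leqnn _)))) _.
  rewrite (_ : n + _ = n * (1 + (8 * (lam * M') + 902 * M'))); last by clear; nia.
  rewrite leq_mul2l; apply/orP; right.
  move: (lam * M') M' (2 ^ e * 2 ^ e) a2 a3 a4 => x y z; clear; lia.
apply: leq_ltn_trans h _.
apply: leq_trans (_ : 2 ^ lam.+1 * (2 ^ 4 * (2 ^ e * 2 ^ e)) <= _).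
  by rewrite ltn_pmul2r // !muln_gt0 expn_gt0.
rewrite -!expnD leq_exp2l //; have := texp.
have : e <= e * q by rewrite leq_pmulr // q_pos.
have := e9; clear; lia.
Qed.

End Tuning.

(** * Space and time bounds *)

Lemma INR_add a c : INR (a + c) = Rplus (INR a) (INR c). Proof. exact: plus_INR. Qed.
Lemma INR_mul a c : INR (a * c) = Rmult (INR a) (INR c). Proof. exact: mult_INR. Qed.
Lemma INR_le a c : a <= c -> Rle (INR a) (INR c). Proof. by move/leP; apply: le_INR. Qed.

Lemma ln2_pos : Rlt 0 (ln 2).
Proof. by rewrite -ln_1; apply: ln_increasing; lra. Qed.

Lemma ln_le_mono x y : Rlt 0 x -> Rle x y -> Rle (ln x) (ln y).
Proof. by move=> h [h'|->]; [left; apply: ln_increasing|right]. Qed.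

Lemma log2R_exp k : log2R (INR (2 ^ k)) = INR k.
Proof.
have l2 := ln2_pos.
have -> : INR (2 ^ k) = pow 2 k.
  elim: k => [|k IH]; first by rewrite expn0.
  by rewrite expnS INR_mul IH.
by rewrite /log2R ln_pow; [field|]; lra.
Qed.

Lemma log2R_mono x y : 0 < x -> x <= y -> Rle (log2R (INR x)) (log2R (INR y)).
Proof.
move=> x0 xy; have l2 := ln2_pos; rewrite /= in l2; apply: Rmult_le_compat_r.
  by left; apply: Rinv_0_lt_compat.
by apply: ln_le_mono; [apply: lt_0_INR; apply/ltP|apply: INR_le].
Qed.

Lemma log2R_ge1 x : 1 < x -> Rle 1 (log2R (INR x)).
Proof. by move=> h; rewrite -[IZR 1]/(INR 1) -(log2R_exp 1); apply: log2R_mono. Qed.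

Lemma log2R_trunc x : 0 < x -> Rle (INR (trunc_log 2 x)) (log2R (INR x)) /\
  Rle (log2R (INR x)) (Rplus (INR (trunc_log 2 x)) 1).
Proof.
move=> x0; split.
  by rewrite -(log2R_exp (trunc_log 2 x)); apply: log2R_mono; [rewrite expn_gt0|apply: trunc_logP].
rewrite -[IZR 1]/(INR 1) -INR_add -(log2R_exp (_ + 1)); apply: log2R_mono => //.
by rewrite addn1 ltnW // trunc_log_ltn.
Qed.

Lemma logbR_ratio ell m : 1 < ell ->
  Rmult (logbR (INR ell) (INR m)) (log2R (INR ell)) = log2R (INR m).
Proof.
move=> h; have l2 := ln2_pos.
have : Rlt 0 (ln (INR ell)).
  by rewrite -ln_1; apply: ln_increasing; [lra|]; rewrite -[IZR 1]/(INR 1); apply: lt_INR; apply/ltP.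
by rewrite /logbR /log2R => h'; field; split; lra.
Qed.

Section RealBounds.
Variables (n m ell lam : nat).
Hypotheses (n_lo : 2 ^ lam <= n) (lam1 : 0 < lam).
Hypotheses (m2 : 1 < m) (mn : m <= n) (ell2 : 1 < ell) (ell_m : ell <= m).
Local Notation A := (log2R (INR n)).
Local Notation B := (log2R (INR ell)).
Local Notation Lm := (log2R (INR m)).
Local Notation rho := (logbR (INR ell) (INR m)).
Local Open Scope R_scope.

Lemma rho_ge1 : 1 <= rho.
Proof.
have hB := log2R_ge1 ell2; have hr := logbR_ratio m ell2.
have hm : B <= Lm by apply: log2R_mono => //; apply: ltnW.
case: (Rle_lt_dec 1 rho) => // h; exfalso; rewrite -hr in hm; nra.
Qed.

Lemma rho_Lm : rho <= Lm.
Proof. have hB := log2R_ge1 ell2; have hr := logbR_ratio m ell2; have := rho_ge1; nra. Qed.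

Lemma Lm_Arho : Lm <= A * rho.
Proof.
have hr := logbR_ratio m ell2; have h1 := rho_ge1.
have hm : B <= A by apply: log2R_mono; [apply: ltnW|apply: leq_trans mn].
nra.
Qed.

Local Notation M' := (bits_of_rank m).
Local Notation g := (digit_width ell).
Local Notation mx := (key_width m ell).
Local Notation K := (levels ell lam).

Lemma lam_A : INR lam <= A.
Proof. by rewrite -(log2R_exp lam); apply: log2R_mono => //; rewrite expn_gt0. Qed.

Lemma M'_Lm : INR M' <= Lm + 1.
Proof.
have [h _] := @log2R_trunc m (ltnW m2); rewrite /bits_of_rank S_INR; lra.
Qed.

(** Rounding is absorbed without losing the leading constant: [M' <= log m + 1 = rho * log ell + 1
    <= rho * (log ell + 1)], because [rho >= 1]. *)
Lemma mx_g : INR mx <= INR g * rho.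
Proof.
have h1 := rho_ge1; have hr := logbR_ratio m ell2; have hM := M'_Lm.
have hg : B + 1 <= INR g.
  have [_ h] := @log2R_trunc ell (ltnW ell2); rewrite /digit_width INR_add /=; lra.
have gp := pos_INR g.
rewrite /key_width; case: leqP => _; first nra.
nra.
Qed.

(** The source of the leading term: the digits of all super-levels but one span at most [lam + 2]
    bits, and storing [mx] instead of [g] bits per digit stretches this by at most [rho]. *)
Lemma super_levels : INR ((lam + 2) %/ g * mx) <= (A + 2) * rho.
Proof.
have h := mx_g; have h1 := rho_ge1; have hA := lam_A.
have hL : INR ((lam + 2) %/ g) * INR g <= INR lam + 2.
  by rewrite -INR_mul -[2]/(INR 2) -INR_add; apply: INR_le; apply: leq_divM.
have p1 := pos_INR ((lam + 2) %/ g).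
rewrite INR_mul; apply: (Rle_trans _ (INR ((lam + 2) %/ g) * (INR g * rho))).
  exact: Rmult_le_compat_l.
rewrite -Rmult_assoc; nra.
Qed.

Lemma mx_3Lm : INR mx <= 3 * Lm.
Proof.
have h1 := log2R_ge1 m2; have := M'_Lm.
have := INR_le (mx_M' ell_m); rewrite INR_add /=; lra.
Qed.

Lemma g_3Lm : INR g <= 3 * Lm.
Proof.
have := mx_3Lm; have : INR g <= INR mx by apply: INR_le; exact: leq_maxr.
lra.
Qed.

Lemma space_bound s c : (s <= wavelet_size n m ell lam + c * (n * M'))%N ->
  INR s <= INR n * A * rho + (8 + 2 * INR c) * INR n * Lm.
Proof.
rewrite wavelet_sizeE => /INR_le; rewrite /levels mulnDl mul1n.
rewrite INR_add INR_mul !INR_add !(INR_mul c) !(INR_mul n).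
have h1 := super_levels; have h2 := mx_3Lm; have h3 := g_3Lm; have h4 := M'_Lm.
have h5 := rho_Lm; have n0 := pos_INR n; have c0 := pos_INR c; have h6 := log2R_ge1 m2.
move=> h; apply: Rle_trans h _.
have : INR g + (INR ((lam + 2) %/ g * mx) + INR mx) + INR c * INR M' <= A * rho + (8 + 2 * INR c) * Lm.
  have : INR c * INR M' <= INR c * (2 * Lm) by apply: Rmult_le_compat_l => //; lra.
  lra.
move=> h; have := Rmult_le_compat_l _ _ _ n0 h; rewrite -(INR_add (trunc_log 2 ell)) -/g; lra.
Qed.

Lemma time_bound : INR (Fall g K (mx - g)) <= 72 * (INR ell * A * rho).
Proof.
have [c4 e4] : exists c, c = 4%N by exists 4%N.
have [c2 e2] : exists c, c = 2%N by exists 2%N.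
have hF : (Fall g K (mx - g) <= c4 * ell * (c2 * ((lam + 2) %/ g * mx) + c4 * mx))%N.
  rewrite e4 e2.
  rewrite /Fall g_r; apply: leq_mul.
    by rewrite /digit_width addn2 !expnS mulnA leq_mul2l /= trunc_logP // ltnW.
  rewrite /levels; have : (0 < mx)%N by rewrite /key_width leq_max.
  move: mx (_ %/ _)%N => x y; clear; nia.
apply: Rle_trans (INR_le hF) _.
rewrite INR_mul INR_mul INR_add !INR_mul.
rewrite e4 e2; have -> : INR 4 = 4 by rewrite INR_IZR_INZ.
have -> : INR 2 = 2 by rewrite INR_IZR_INZ.
have h1 := super_levels; rewrite INR_mul in h1.
have h2 := mx_3Lm; have h3 := Lm_Arho; have h4 := rho_ge1.
have h5 := @log2R_ge1 n (leq_trans m2 mn); have e0 := pos_INR ell.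
have : 2 * (INR ((lam + 2) %/ g) * INR mx) + 4 * INR mx <= 18 * (A * rho) by nra.
move=> h; nra.
Qed.

End RealBounds.

(** * Assembling the program *)

(* Comparing n with 2^k by halving: the constant 2^k need not fit in a word. *)
Definition halve_body := 90 ::= $90 %/ #2.
Fixpoint halves (k : nat) : cmd := if k is k'.+1 then halves k';; halve_body else Skip.
Definition branch := If $90 big naive.
Definition copy_out := 0 ::= $94;; 1 ::= $95;; 2 ::= $96;; 3 ::= $97.
Definition top (k : nat) := (90 ::= $0;; halves k);; branch;; copy_out.

Lemma halvesP b me k s : 2 < 2 ^ b -> s 90 < 2 ^ b -> sem b me (halves k) s = upd s 90 (s 90 %/ 2 ^ k).
Proof.
move=> h2 h90; elim: k => [|k IH].
  by apply: functional_extensionality => i; rewrite /= updE expn0 divn1; case: eqP => [->|].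
rewrite (_ : halves k.+1 = Seq (halves k) halve_body) // semSeq IH /halve_body semAsn.
have -> : eval b me ($90 %/ #2) (upd s 90 (s 90 %/ 2 ^ k)) = s 90 %/ 2 ^ k.+1.
  rewrite expnSr divnMA; apply: evDiv => //; first exact: evCst.
  by apply: leq_ltn_trans (leq_div _ _) h90.
by apply: functional_extensionality => i; rewrite !updE; case: eqP.
Qed.

Lemma halves_cost b me k s : cost b me (halves k) s <= k * cmax halve_body.
Proof.
elim: k s => // k IH s; rewrite (_ : halves k.+1 = Seq (halves k) halve_body) // costSeq.
by rewrite mulSn addnC; apply: leq_add; [apply: cmaxP|apply: IH].
Qed.

Lemma halves_wf k : cwf 100 (halves k).
Proof. by elim: k => // k IH; rewrite (_ : halves k.+1 = Seq (halves k) halve_body) //= IH. Qed.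

Lemma big_wf : cwf 100 big. Proof. by vm_compute. Qed.
Lemma naive_wf : cwf 100 naive. Proof. by vm_compute. Qed.

Lemma top_wf k : cwf 100 (top k).
Proof.
have -> : cwf 100 (top k) = [&& true && cwf 100 (halves k), [&& true, cwf 100 big & cwf 100 naive] & cwf 100 copy_out] by [].
by rewrite halves_wf big_wf naive_wf.
Qed.

Lemma costIf b me e c1 c2 s : cost b me (If e c1 c2) s =
  ecost e + 1 + (if eval b me e s == 0 then cost b me c2 s else cost b me c1 s + 1).
Proof. by []. Qed.

Section Top.
Variables (b : nat) (me : nat -> nat) (k : nat) (st : state).
Hypotheses (hM : 2 < 2 ^ b) (h0 : st 0 < 2 ^ b).
Local Notation s1 := (upd st 90 (st 0 %/ 2 ^ k)).

Lemma sem_test : sem b me (90 ::= $0;; halves k) st = s1.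
Proof.
rewrite semSeq semAsn (_ : eval b me $0 st = st 0) // halvesP //.
by apply: functional_extensionality => i; rewrite !updE /=; case: eqP.
Qed.

Definition branch_of (small : bool) := if small then naive else big.

Lemma test_small : (st 0 %/ 2 ^ k == 0) = (st 0 < 2 ^ k).
Proof. by rewrite -leqn0 leqNgt divn_gt0 ?expn_gt0 // ltnNge. Qed.

Lemma sem_branch : sem b me branch s1 = sem b me (branch_of (st 0 < 2 ^ k)) s1.
Proof.
rewrite /branch semIf (_ : eval b me $90 s1 = st 0 %/ 2 ^ k) // test_small.
by case: ltnP.
Qed.

Lemma sem_top s2 : sem b me (branch_of (st 0 < 2 ^ k)) s1 = s2 ->
  [/\ sem b me (top k) st 0 = s2 94, sem b me (top k) st 1 = s2 95,
      sem b me (top k) st 2 = s2 96 & sem b me (top k) st 3 = s2 97].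
Proof.
move=> e; rewrite /top (semSeq _ _ (Seq _ _)) sem_test (semSeq _ _ branch) sem_branch e.
by move: s2 {e} => s2; split.
Qed.

Lemma cost_top : cost b me (top k) st <=
  (k * cmax halve_body + 200) + cost b me (branch_of (st 0 < 2 ^ k)) s1.
Proof.
rewrite /top (costSeq _ _ (Seq _ _)) (costSeq _ _ branch) sem_test sem_branch.
have -> : cost b me (90 ::= $0;; halves k) st = ecost $0 + 1 + cost b me (halves k) (upd st 90 (st 0)) by [].
have h1 := halves_cost b me k (upd st 90 (st 0)).
have h2 : cost b me copy_out (sem b me (branch_of (st 0 < 2 ^ k)) s1) <= 100 by apply: cmaxP.
have h3 : cost b me branch s1 <= 10 + cost b me (branch_of (st 0 < 2 ^ k)) s1.
  rewrite /branch costIf (_ : eval b me $90 s1 = st 0 %/ 2 ^ k) // test_small.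
  case: (st 0 < 2 ^ k); rewrite [branch_of _]/= [ecost _]/=; move: (cost _ _ _ _) => x; clear; lia.
move: h1 h2 h3; move: (cost b me (halves k) _) (cost b me copy_out _) (cost b me branch _) (cost b me (branch_of _) _).
rewrite [ecost _]/=; clear; lia.
Qed.

End Top.

Local Delimit Scope R_scope with Re.

Section Run.
Variables (n W ell : nat) (pi : {perm 'I_n}) (wv : 'I_n -> nat).
Variables (b : nat) (bits : seq bool) (x0 x1 y0 y1 w : nat).
Local Notation M := (2 ^ b).
Local Notation st := (init_regs wv W ell x0 x1 y0 y1 w b).
Local Notation me := (init_mem wv b bits).
Local Notation vt := (value_table wv).
Hypotheses (hv : forall x, wv x < W) (n2 : 1 < n) (ell_n : ell <= n).
Hypothesis hb2 : maxn n W ^ 2 <= 2 ^ b.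
Hypotheses (x0n : x0 < n) (x1n : x1 < n) (y0n : y0 < n) (y1n : y1 < n) (wM : w < M).

Lemma word_hi x : x <= n \/ x <= W -> x < M.
Proof.
move=> h; have hx : x <= maxn n W by rewrite leq_max; case: h => ->; rewrite ?orbT.
have N2 : 1 < maxn n W by rewrite leq_max n2.
by apply: leq_ltn_trans hx (leq_trans _ hb2); rewrite -mulnn ltn_Pmull // ltnW.
Qed.

Lemma M_ge4 : 4 <= M.
Proof. by apply: leq_trans hb2; rewrite -[4]/(2 ^ 2) leq_sqr leq_max n2. Qed.

Lemma n_sq_M : n ^ 2 <= M.
Proof. by apply: leq_trans hb2; rewrite leq_sqr leq_maxl. Qed.

Lemma init_inM : inM b st.
Proof.
have z : 0 < M by rewrite expn_gt0.
have sv : size vt < M by apply: word_hi; left; apply: size_vt_n.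
move=> i; rewrite /init_regs.
case: i => [|[|[|[|[|[|[|[|[|[|[|i]]]]]]]]]]] /=; rewrite ?nth_nil //; try by apply: word_hi; auto.
all: try by apply: word_hi; left; apply: ltnW.
by apply: ltn_expl.
Qed.

(** The value table has at most [n] entries, so it ends before the structure begins at address
    [n]. *)
Lemma mem_word i : i < nwords b bits -> me (n + i) = word_at b bits i.
Proof.
move=> hi; rewrite /init_mem ltnNge (leq_trans (size_vt_n wv)) ?leq_addr //= ltn_add2l hi.
by rewrite addKn.
Qed.

Lemma mem_value i : i < size vt -> me i = nth 0 vt i.
Proof. by move=> hi; rewrite /init_mem hi. Qed.

Lemma run_top k s2 D : sem b me (branch_of (n < 2 ^ k)) (upd st 90 (n %/ 2 ^ k)) = s2 ->
  correct_output (Succ pi wv w x0 x1 y0 y1) (s2 94) (s2 95) ->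
  correct_output (Pred pi wv w x0 x1 y0 y1) (s2 96) (s2 97) ->
  cost b me (branch_of (n < 2 ^ k)) (upd st 90 (n %/ 2 ^ k)) <= D ->
  exists T cf, [/\ T <= k * cmax halve_body + 200 + D,
    runs_within b (ccode (top k) 0 100) T (Config 0 st me) cf,
    correct_output (Succ pi wv w x0 x1 y0 y1) (regs cf 0) (regs cf 1) &
    correct_output (Pred pi wv w x0 x1 y0 y1) (regs cf 2) (regs cf 3)].
Proof.
move=> e cs cp hD.
have M1 : 1 < M by apply: leq_trans M_ge4.
have M2 : 2 < M by apply: leq_trans M_ge4.
have [rg [run out]] := ccode_runs me (top_wf k) M1 (fun i => erefl (st i)) init_inM.
have nM : st 0 < M by apply: init_inM.
have [o0 o1 o2 o3] := sem_top M2 nM e.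
exists (cost b me (top k) st), (Config (csize (top k)) rg me); split=> //.
- by apply: leq_trans (cost_top me k M2 nM) _; rewrite leq_add2l.
- rewrite [regs _]/= (out 0 isT) (out 1 isT) o0 o1; exact: cs.
- rewrite [regs _]/= (out 2 isT) (out 3 isT) o2 o3; exact: cp.
Qed.

Lemma run_small k : bits = naive_bits pi wv -> n < 2 ^ k ->
  (exists s2, [/\ sem b me (branch_of (n < 2 ^ k)) (upd st 90 (n %/ 2 ^ k)) = s2,
    correct_output (Succ pi wv w x0 x1 y0 y1) (s2 94) (s2 95) &
    correct_output (Pred pi wv w x0 x1 y0 y1) (s2 96) (s2 97)]).
Proof.
move=> e nk; rewrite nk; apply: naiveP => //.
- exact: n_sq_M.
- exact: ltn_expl.
- by rewrite -e; apply: mem_word.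
- exact: mem_value.
- by move=> x; apply: word_hi; right; apply: ltnW.
Qed.

Local Notation m := (minn n W).
Local Notation lam := (trunc_log 2 n).
Local Notation e := (trunc_log 2 lam).+1.
Local Notation u := (lam %/ 4).
Local Notation q := (2 ^ (e %/ 2)).
Local Notation H := (e * q + 2).
Local Notation g := (digit_width ell).
Local Notation K := (levels ell lam).
Local Notation r := (key_width m ell - g).
Definition big_bits := structure pi wv e.+1 (2 * lam) (2 * e + 1) u q H g K r.

Lemma run_big k C : bits = big_bits -> 256 <= k -> 2 ^ k <= n -> 1 < ell -> ell <= m ->
  (forall b me st s, sem b me load_params st = s -> s 36 = s 22 * s 21 ->
     cost b me big st <= C * Fall (s 21) (s 22) (s 23)) ->
  (exists s2, [/\ sem b me (branch_of (n < 2 ^ k)) (upd st 90 (n %/ 2 ^ k)) = s2,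
    correct_output (Succ pi wv w x0 x1 y0 y1) (s2 94) (s2 95),
    correct_output (Pred pi wv w x0 x1 y0 y1) (s2 96) (s2 97) &
    cost b me (branch_of (n < 2 ^ k)) (upd st 90 (n %/ 2 ^ k)) <= C * Fall g K r]).
Proof.
move=> eb k256 kn ell2 ell_m hC; rewrite ltnNge kn [branch_of _]/=.
have n_lo : 2 ^ lam <= n by apply: trunc_logP => //; apply: ltnW.
have n_hi : n < 2 ^ lam.+1 by apply: trunc_log_ltn.
have lam_k : k <= lam.
  by rewrite -ltnS -(ltn_exp2l _ _ (isT : 1 < 2)); apply: leq_ltn_trans n_hi.
have lam_big : 256 <= lam by apply: leq_trans lam_k.
have m2 : 1 < m by apply: leq_trans ell_m.
have mn : m <= n by apply: geq_minl.
have hb : 0 < b by case: b M_ge4.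
(* From [2 ^ lam <= n] and [n ^ 2 <= 2 ^ b]: the squared word bound leaves room for fields of
   [2 * lam] bits. *)
have b_lam : 2 * lam <= b.
  rewrite -(@leq_exp2l 2) //; apply: leq_trans n_sq_M.
  by rewrite mulnC expnM leq_sqr.
have Mlt x : x < 2 ^ (2 * lam) -> x < M by move=> h; apply: leq_trans h _; rewrite leq_exp2l.
have hsz := structure_size_lt lam_big n_lo n_hi m2 mn ell_m pi wv.
have tx := texp lam_big; have h9 := e9 lam_big.
have [t [s [q1 [t21 t22 t23 t36] q2 c1 c2]]] : exists t s, [/\ sem b me load_params (upd st 90 (n %/ 2 ^ k)) = t,
   [/\ t 21 = g, t 22 = K, t 23 = r & t 36 = K * g], sem b me big (upd st 90 (n %/ 2 ^ k)) = s,
   correct_output (Succ pi wv w x0 x1 y0 y1) (s 94) (s 95) &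
   correct_output (Pred pi wv w x0 x1 y0 y1) (s 96) (s 97)].
  apply: (@bigP n pi wv e.+1 (2 * lam) (2 * e + 1) u q H g K r) => //.
  - exact: ltn_expl.
  - by apply: leq_ltn_trans (leqnn 4) (Mlt _ _); rewrite -[4]/(2 ^ 2) ltn_exp2l //; clear -lam_big; lia.
  - by rewrite -/big_bits -eb; apply: mem_word.
  - rewrite -/big_bits; apply: leq_trans (ltnW (Mlt _ hsz)); rewrite leq_add2l -/big_bits.
    rewrite /nwords -ltnS ltn_divLR // mulSn.
    have : size big_bits <= size big_bits * b by apply: leq_pmulr.
    by move: (size big_bits) (size big_bits * b) hb => A1 A2; clear; lia.
  - exact: mem_value.
  - by move=> x; apply: word_hi; right; apply: ltnW.
  - exact: u_pos lam_big.
  - exact: q_pos.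
  - exact: class_window.
  - exact: window_cell.
  - by apply: leq_ltn_trans hsz; apply: leq_addl.
  - exact: super_width.
  - by have := header_room lam_big; clear; lia.
  - by clear -tx; lia.
  - by have := leq_div lam 4; clear -lam_big; lia.
  - by clear -lam_big; lia.
  - exact: header_room.
  - by rewrite expnS ltn_mul2l /=; apply: lam_hi.
  - exact: ltnW.
  - by rewrite /digit_width addn2.
  - by rewrite /levels addn1.
  - apply: leq_ltn_trans (vt_room m ell); rewrite leq_min size_vt_n; exact: size_vt_W.
  - exact: row_room.
  - exact: Mlt (key_room lam_big n_hi m2 mn ell_m).
  - exact: Mlt (class_room lam_big n_hi m2 mn ell_m).
have h36 : t 36 = t 22 * t 21 by rewrite t36 t22 t21.
have := hC b me _ _ q1 h36; rewrite t21 t22 t23 => hc.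
by exists s; split.
Qed.

End Run.

Theorem theorem10 :
  (* c : the word size is b = Theta(log N), N = max(n,W): N^2 <= 2^b <= N^c *)
  forall c : nat, 2 <= c ->
  exists (prog : program) (C : R), Rlt (INR 0) C /\
  forall (n W ell : nat) (pi : {perm 'I_n}) (wv : 'I_n -> nat),
    (forall x, wv x < W) ->
    let m := minn n W in
    2 <= ell <= m ->
    exists bits : seq bool,
      (* space: n log n log_ell m + O(n log m) bits *)
      Rle (INR (size bits))
        (Rplus (Rmult (Rmult (INR n) (log2R (INR n))) (logbR (INR ell) (INR m)))
               (Rmult (Rmult C (INR n)) (log2R (INR m)))) /\
      forall b : nat,
        (maxn n W) ^ 2 <= 2 ^ b -> 2 ^ b <= (maxn n W) ^ c ->
      forall (x0 x1 y0 y1 w : nat),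
        x0 < n -> x1 < n -> y0 < n -> y1 < n -> w < 2 ^ b ->
      exists (T : nat) (cf : config),
        (* time: O(ell log n log_ell m) *)
        Rle (INR T)
          (Rmult (Rmult (Rmult C (INR ell)) (log2R (INR n))) (logbR (INR ell) (INR m))) /\
        runs_within b prog T
          (Config 0 (init_regs wv W ell x0 x1 y0 y1 w b) (init_mem wv b bits)) cf /\
        correct_output (Succ pi wv w x0 x1 y0 y1) (regs cf 0) (regs cf 1) /\
        correct_output (Pred pi wv w x0 x1 y0 y1) (regs cf 2) (regs cf 3).
Proof.
move=> c c2.
(* The threshold between the two methods is [2 ^ 256], so that [lam >= 256] on large grids; only the
   inequality is kept, since such a number must not be computed in unary. *)
have [k k256] : exists k, 256 <= k by exists 256.
have [Cb hCb] := big_bounded.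
have [Cn hCn] := naive_cost.
have [s902 hs902] : exists s, s = 902 by exists 902.
pose D := k * cmax halve_body + 200.
pose Cs := D + Cn * (2 ^ k).+1.
(* One constant for both bounds and both branches: [8 + 2 * 902] comes from [space_bound], [Cs] and
   [72 * Cb] from the running times, and [2 * 2 ^ k] bounds the bits per point of a small grid. *)
pose C := (8 + 2 * INR s902 + (INR Cs + 72 * INR Cb) + INR (2 * 2 ^ k))%Re.
have p1 := pos_INR s902; have p2 := pos_INR Cs; have p3 := pos_INR Cb; have p4 := pos_INR (2 * 2 ^ k).
exists (ccode (top k) 0 100), C; split; first by rewrite /C /=; lra.
move=> n W ell pi wv hv m /andP[ell2 ell_m].
have m2 : 1 < m by apply: leq_trans ell_m.
have mn : m <= n by apply: geq_minl.
have n2 : 1 < n by apply: leq_trans mn.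
have ell_n : ell <= n by apply: leq_trans mn.
have A1 := log2R_ge1 n2; have B1 := log2R_ge1 m2; have R1 := rho_ge1 ell2 ell_m.
have E1 : (1 <= INR ell)%Re by rewrite -[1%Re]/(INR 1); apply: INR_le; apply: ltnW.
have N0 := pos_INR n.
set A := log2R (INR n) in A1 *; set Lm := log2R (INR m) in B1 *.
set rho := logbR (INR ell) (INR m) in R1 *.
(* The time bound is at least a constant, so it absorbs the size test and the whole scan of a small
   grid. *)
have EAR : (1 <= INR ell * A * rho)%Re.
  have : (1 <= INR ell * A)%Re by nra.
  nra.
have [nk|kn] := ltnP n (2 ^ k).
  exists (naive_bits pi wv); split.
    have : size (naive_bits pi wv) <= n * (2 * 2 ^ k).
      rewrite size_fields size_cat 2!size_map size_enum_ord addnn -mul2n mulnAC mulnC leq_mul2l.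
      apply/orP; right; rewrite leq_mul2l /=; apply: leq_trans (ltnW nk).
      by apply: up_log_min => //; apply: ltnW; apply: ltn_expl.
    move/INR_le; rewrite INR_mul => h; apply: Rle_trans h _.
    have : (0 <= INR n * A * rho)%Re by do 2!(apply: Rmult_le_pos; [|lra]).
    have : (INR n * INR (2 * 2 ^ k) <= C * INR n * Lm)%Re.
      apply: (Rle_trans _ (C * INR n * 1)).
        by rewrite /C; nra.
      apply: Rmult_le_compat_l B1; apply: Rmult_le_pos => //; rewrite /C; lra.
    lra.
  move=> b hb _ x0 x1 y0 y1 w x0n x1n y0n y1n wM.
  have [s2 [e cs cp]] := run_small ell x0 x1 y0 y1 hv n2 hb wM (erefl (naive_bits pi wv)) nk.
  have hD := hCn b (init_mem wv b (naive_bits pi wv)) (upd (init_regs wv W ell x0 x1 y0 y1 w b) 90 (n %/ 2 ^ k)).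
  have [|T [cf [hT run o1 o2]]] := run_top n2 ell_n hb x0n x1n y0n y1n wM e cs cp (D := Cn * (2 ^ k).+1).
    by rewrite nk; apply: leq_trans hD _; rewrite leq_mul2l ltnS ltnW ?orbT.
  exists T, cf; split=> //.
  apply: Rle_trans (INR_le hT) _; rewrite -/D -/Cs.
  apply: (Rle_trans _ (C * (INR ell * A * rho))); last by right; rewrite !Rmult_assoc.
  apply: (Rle_trans _ (C * 1)); first by rewrite /C; lra.
  apply: Rmult_le_compat_l => //; rewrite /C; lra.
have n_lo : 2 ^ trunc_log 2 n <= n by apply: trunc_logP => //; apply: ltnW.
have lam_k : k <= trunc_log 2 n.
  rewrite -ltnS -(ltn_exp2l _ _ (isT : 1 < 2)); apply: leq_ltn_trans kn _; exact: trunc_log_ltn.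
have lam_big : 256 <= trunc_log 2 n by apply: leq_trans lam_k.
exists (big_bits W ell pi wv); split.
  have h := structure_size_le lam_big n_lo ell_m pi wv; rewrite -hs902 in h.
  have := space_bound n_lo m2 ell2 ell_m h; rewrite -/A -/Lm -/rho => h1.
  apply: Rle_trans h1 _; apply: Rplus_le_compat_l.
  apply: Rmult_le_compat_r; first lra.
  by apply: Rmult_le_compat_r => //; rewrite /C; lra.
move=> b hb _ x0 x1 y0 y1 w x0n x1n y0n y1n wM.
have [s2 [e cs cp hc]] := run_big w hv n2 hb x0n x1n y0n y1n (erefl (big_bits W ell pi wv)) k256 kn ell2 ell_m hCb.
have [T [cf [hT run o1 o2]]] := run_top n2 ell_n hb x0n x1n y0n y1n wM e cs cp hc.
exists T, cf; split=> //.
apply: Rle_trans (INR_le hT) _; rewrite -/D INR_add INR_mul.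
have := time_bound n_lo m2 mn ell2 ell_m; rewrite -/A -/rho.
move: (INR (Fall _ _ _)) => F hF.
have hFC : (INR Cb * F <= INR Cb * (72 * (INR ell * A * rho)))%Re by apply: Rmult_le_compat_l.
have hDC : (INR D <= INR Cs)%Re by apply: INR_le; rewrite /Cs leq_addr.
apply: (Rle_trans _ (C * (INR ell * A * rho))); last by right; rewrite !Rmult_assoc.
move: (INR ell * A * rho)%Re EAR hFC => X X1 hFC.
have hC : ((INR Cs + 72 * INR Cb) * X <= C * X)%Re by apply: Rmult_le_compat_r; rewrite /C; lra.
have : (INR Cs * 1 <= INR Cs * X)%Re by apply: Rmult_le_compat_l.
lra.
Qed.
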